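(* Let $p$ be a prime with $p\equiv 1,7,17,23\pmod{24}$, and let $A_n=\sum_{k=0}^n\binom{2k}k\binom{2n-2k}{n-k}\binom nk^2$. If $p\equiv 1,7\pmod{24}$, so that $p=x^2+6y^2$ for some integers $x,y$, then $\sum_{n=0}^{p-1}\frac{A_n}{(-8)^n}\equiv 4x^2\pmod p$. If $p\equiv 17,23\pmod{24}$, then $\sum_{n=0}^{p-1}\frac{A_n}{(-8)^n}\equiv 0\pmod p$.
   Context: Congruences modulo $p$ are between rational numbers whose denominators are prime to $p$. *)

(* Defs.v *)
From mathcomp Require Import all_boot all_order all_algebra.
Set Implicit Arguments.
Unset Strict Implicit.
Unset Printing Implicit Defensive.
Import GRing.Theory Num.Theory.

Definition A (n : nat) : nat :=
  \sum_(0 <= k < n.+1)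
    'C(k.*2, k) * 'C(n.*2 - k.*2, n - k) * 'C(n, k) ^ 2.

Local Open Scope ring_scope.

Definition denom_prime_to (p : nat) (r : rat) : bool := coprime p `|denq r|%N.

(* The relation carries the requirement that both sides have denominator prime
   to p.  Since numq is taken in lowest terms, the last clause says a - b lies
   in p times the ring of such rationals when p is prime. *)
Definition congQ (p : nat) (a b : rat) : bool :=
  [&& denom_prime_to p a, denom_prime_to p b & (p%:Z %| numq (a - b))%Z].

Definition A_sum (p : nat) : rat :=
  \sum_(0 <= n < p) (A n)%:R / (- 8%:R) ^+ n.

(* Main.v *)
(** Put r^2 = 2 in F_p.  The sum of the A_n / (-8)^n turns, modulo p, into a
    truncated 3F2 series at 1/216, which by Clausen's formula is the square of a
    truncated series in (3k)!/k!^3.  That series is, up to sign, the sum over z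
    of f(z)^((p-1)/2), i.e. the trace of Frobenius modulo p, for the curve
    E : y^2 = f(z) = z^3 + 6 r z^2 + (9 - 6 r) z.

    If p = 17, 23 (mod 24), a 2-isogeny from E to its conjugate under r -> -r
    shows that the trace is its own opposite.  If p = x^2 + 6 y^2, then E has
    complex multiplication by s = sqrt(-6).  Following Manin, consider on the
    twist f(t) Y^2 = f(X) over F_p(t) the generic point P0 = (t, 1), its image Phi
    under s and the Frobenius point Q0 = (t^p, f(t)^((p-1)/2)).  The height of
    m P0 + n Phi is m^2 + 6 n^2.  Choosing s = - x / y makes the invariant
    differential vanish at x P0 + y Phi; this point has height p, so its abscissa
    is inseparable and it must be Q0 or - Q0.  The height of Q0 - P0 counts the
    points of E, and comparing it with that of (x - 1) P0 + y Phi, or of its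
    analogue with x + 1, gives the trace 2 x or - 2 x. *)
From HB Require Import structures.
Require Import Defs.
From mathcomp Require Import all_boot all_order all_algebra all_field zify ring.
Set Implicit Arguments.
Unset Strict Implicit.
Unset Printing Implicit Defensive.
Import GRing.Theory Num.Theory.
Local Open Scope ring_scope.

(** * The recurrence of the Domb numbers *)

(** At x = -1/8 one has 1 - 4 x = 3/2 and x^2 / (1 - 4 x)^3 = 1/216. The quadratic b (1 - 27 b) =
    1/216 of Clausen's formula has the roots (2 - r)/108 and (2 + r)/108: this is where r comes
    from, and 2 is a square because all four classes are 1 or 7 modulo 8. The curve y (y + 6 w + 2
    c) = w^3 with c = 2 - r, whose affine points are counted modulo p by the truncated series at
    c/108, becomes E after completing the square. Power series are avoided: a coefficient ratio
    vanishes modulo p at index p %/ 3, so the truncated sums satisfy the full differential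
    equations, and such an equation has at most one solution of degree below p with a given constant
    term. The twist has constant coefficients up to the factor f(t), so the degree of the abscissa
    obeys the parallelogram law without error term and can be compared with an exact point count. An
    inseparable abscissa is at first only known to be al t^p + be; that al = 1 and be = 0 could fail
    where the j-invariant is 0 or 1728, whence the conditions on 17 and 23. *)

Section Antidiagonal.
Variable V : zmodType.
Implicit Type g : nat -> nat -> V.

Definition adiag n g := \sum_(i < n.+1) g i (n - i)%N.

Lemma adiag_ext n g h : (forall i j, (i + j)%N = n -> g i j = h i j) ->
  adiag n g = adiag n h.
Proof. by move=> E; apply: eq_bigr => i _; apply: E; rewrite subnKC // -ltnS. Qed.

Lemma adiag_swap n g : adiag n g = adiag n (fun i j => g j i).
Proof.
rewrite /adiag (reindex_inj rev_ord_inj) /=; apply: eq_bigr => i _.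
by rewrite subSS subKn // -ltnS.
Qed.

Lemma adiagD n g h : adiag n g + adiag n h = adiag n (fun i j => g i j + h i j).
Proof. by rewrite /adiag big_split. Qed.

Lemma adiag_shift n g : (forall j, g 0%N j = 0) ->
  adiag n.+1 g = adiag n (fun i j => g i.+1 j).
Proof. by move=> g0; rewrite /adiag big_ord_recl g0 add0r. Qed.

End Antidiagonal.

Lemma adiagZ (R : pzRingType) n (c : R) g :
  c * adiag n g = adiag n (fun i j => c * g i j).
Proof. exact: mulr_sumr. Qed.

Lemma adiag_sym (R : pzRingType) n (g : nat -> nat -> R) :
  2 * adiag n g = adiag n (fun i j => g i j + g j i).
Proof. by rewrite mulr_natl mulr2n {2}adiag_swap adiagD. Qed.

(** The factor 1/(i!)^2 absorbs the squared binomial coefficient, so that A_n / (n!)^2 is the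
    convolution square of [dombf]. *)
Definition dombf (i : nat) : rat := 'C(i.*2, i)%:R / (i`!)%:R ^+ 2.

Lemma fact_neq0 (n : nat) : (n`!)%:R != 0 :> rat.
Proof. by rewrite pnatr_eq0 -lt0n fact_gt0. Qed.

Lemma bin2S n : (n.+1 * 'C(n.+1.*2, n.+1) = 2 * n.*2.+1 * 'C(n.*2, n))%N.
Proof.
have e := mul_bin_diag n.*2.+1 n.
rewrite doubleS binS.
have -> : 'C(n.*2.+1, n) = 'C(n.*2.+1, n.+1).
  by rewrite -bin_sub; [congr binomial; lia | lia].
by rewrite addnn -mul2n mulnCA -e /= mulnA.
Qed.

Lemma dombfS i : i.+1%:R ^+ 3 * dombf i.+1 = 2 * (2 * i%:R + 1) * dombf i.
Proof.
have e : (i%:R + 1) * 'C(i.+1.*2, i.+1)%:R = 2 * (2 * i%:R + 1) * 'C(i.*2, i)%:R :> rat.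
  have := congr1 (fun n : nat => n%:R : rat) (bin2S i).
  by rewrite !natrM -(addn1 i.*2) -(muln2 i) natrD natrM -natr1 [i%:R * 2]mulrC.
have i0 : i%:R + 1 != 0 :> rat by rewrite natr1 pnatr_eq0.
have f0 := fact_neq0 i.
rewrite /dombf factS natrM -[i.+1%:R]natr1.
transitivity (((i%:R + 1) * 'C(i.+1.*2, i.+1)%:R) / (i`!)%:R ^+ 2 : rat).
  by field; rewrite i0 f0.
by rewrite e; field.
Qed.

Lemma domb_adiag n : (A n)%:R = (n`!)%:R ^+ 2 * adiag n (fun i j => dombf i * dombf j).
Proof.
rewrite /A big_mkord natr_sum adiagZ; apply: eq_bigr => i _.
have le_in : (i <= n)%N by rewrite -ltnS.
rewrite /dombf -doubleB !natrM .
have := congr1 (fun n : nat => n%:R : rat) (bin_fact le_in).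
rewrite !natrM => <-; field.
by rewrite !fact_neq0.
Qed.

(* Split the weight as
   (i + j)^5 = i^3 (i^2 + 5 i j + 10 j^2) + j^3 (j^2 + 5 i j + 10 i^2), so that the
   first-order recurrence of dombf applies to each half. *)
Lemma domb_rec n :
  ((n.+2 ^ 3 * A n.+2 + 64 * n.+1 ^ 3 * A n) =
   2 * (2 * n + 3) * (5 * n ^ 2 + 15 * n + 12) * A n.+1)%N.
Proof.
pose B m := adiag m (fun i j => dombf i * dombf j).
suff E : n.+2%:R ^+ 5 * B n.+2 + 64 * n.+1%:R * B n =
    2 * (2 * n%:R + 3) * (5 * n%:R ^+ 2 + 15 * n%:R + 12) * B n.+1.
  apply/eqP; rewrite -(eqr_nat rat); apply/eqP.
  rewrite !(natrD, natrM, natrX) !domb_adiag -!/(B _) !factS !natrM.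
  rewrite -[n.+2]addn2 -[n.+1]addn1 !natrD in E *.
  transitivity ((n`!)%:R ^+ 2 * (n%:R + 1) ^+ 2 * ((n%:R + 2) ^+ 5 * B (n + 2)%N + 64 * (n%:R + 1) * B n)).
    by ring.
  by rewrite E; ring.
pose q i j : rat := i%:R ^+ 2 + 5 * i%:R * j%:R + 10 * j%:R ^+ 2.
(* A factor i^3 lets the recurrence of [dombf] lower i by one. In this way [B n.+2] and [B n] both
   become sums over the antidiagonal n+1, where all terms agree pointwise after symmetrisation. *)
have shift m (p : nat -> nat -> rat) :
    adiag m.+1 (fun i j => i%:R ^+ 3 * p i j * (dombf i * dombf j)) =
    adiag m (fun i j => 2 * (2 * i%:R + 1) * p i.+1 j * (dombf i * dombf j)).
  rewrite adiag_shift => [|j]; last by rewrite expr0n !mul0r.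
  apply: adiag_ext => i j _.
  transitivity (i.+1%:R ^+ 3 * dombf i.+1 * (p i.+1 j * dombf j)); first by ring.
  by rewrite dombfS; ring.
have e1 : n.+2%:R ^+ 5 * B n.+2 =
    adiag n.+1 (fun i j => 4 * (2 * i%:R + 1) * q i.+1 j * (dombf i * dombf j)).
  transitivity (2 * adiag n.+2 (fun i j => i%:R ^+ 3 * q i j * (dombf i * dombf j))).
    rewrite adiag_sym /B adiagZ.
    by apply: adiag_ext => i j <-; rewrite /q natrD; ring.
  by rewrite shift adiagZ; apply: adiag_ext => i j _; ring.
have e2 : 64 * n.+1%:R * B n =
    adiag n.+1 (fun i j => 16 * (i%:R ^+ 3 + j%:R ^+ 3) * (dombf i * dombf j)).
  transitivity (2 * adiag n.+1 (fun i j => i%:R ^+ 3 * 16 * (dombf i * dombf j))).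
    rewrite (shift n (fun _ _ => 16)) adiag_sym /B adiagZ.
    by apply: adiag_ext => i j <-; rewrite -[(i + j).+1]addn1 !natrD; ring.
  by rewrite adiag_sym; apply: adiag_ext => i j _; ring.
apply: (@mulfI _ 2) => //; rewrite e1 e2 mulrDr !adiag_sym adiagD /B !adiagZ.
apply: adiag_ext => i j.
move/(congr1 (fun n : nat => n%:R : rat)); rewrite -addn1 !natrD => e.
have -> : n%:R = i%:R + j%:R - 1 :> rat by rewrite e; ring.
by rewrite /q -[i.+1]addn1 -[j.+1]addn1 !natrD; ring.
Qed.

(** These are the coefficients of 2F1(1/3, 2/3; 1; 27 z). *)
Definition hyp (k : nat) : nat := 'C(k.*2, k) * 'C(k * 3, k).

Lemma hyp_fact k : (hyp k * k`! ^ 3 = (k * 3)`!)%N.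
Proof.
have l1 : (k <= k.*2)%N by lia.
have l2 : (k <= k * 3)%N by lia.
rewrite -(bin_fact l2); have -> : (k * 3 - k = k.*2)%N by lia.
by rewrite -(bin_fact l1) -addnn addnK /hyp addnn; ring.
Qed.

Lemma hypS k : (k.+1 ^ 2 * hyp k.+1 = 3 * (3 * k + 1) * (3 * k + 2) * hyp k)%N.
Proof.
apply/eqP; rewrite -(@eqn_pmul2l (k`! ^ 3 * k.+1)) ?muln_gt0 ?expn_gt0 ?fact_gt0 //; apply/eqP.
transitivity (hyp k.+1 * (k.+1)`! ^ 3)%N; first by rewrite factS; ring.
rewrite hyp_fact; have -> : (k.+1 * 3 = (k * 3).+3)%N by lia.
rewrite !factS -hyp_fact; ring.
Qed.

(** These are the coefficients of 3F2(1/2, 1/3, 2/3; 1, 1; 108 z), the other side of Clausen's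
    formula. *)
Definition acoef (k : nat) : nat := 'C(k.*2, k) * hyp k.

Lemma acoefS k :
  (k.+1 ^ 3 * acoef k.+1 = 6 * (2 * k + 1) * (3 * k + 1) * (3 * k + 2) * acoef k)%N.
Proof.
transitivity ((k.+1 * 'C(k.+1.*2, k.+1)) * (k.+1 ^ 2 * hyp k.+1))%N.
  by rewrite /acoef; ring.
by rewrite bin2S hypS /acoef -muln2; ring.
Qed.

(** * Reduction to a truncated hypergeometric sum *)

Section Euler.
Variable R : comNzRingType.
Implicit Types u v : {poly R}.

Definition euler u : {poly R} := 'X * u^`().

Lemma eulerM u v : euler (u * v) = euler u * v + u * euler v.
Proof. by rewrite /euler derivM; ring. Qed.

Lemma eulerD u v : euler (u + v) = euler u + euler v.
Proof. by rewrite /euler derivD mulrDr. Qed.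

Lemma eulerZ c u : euler (c *: u) = c *: euler u.
Proof. by rewrite /euler derivZ scalerAr. Qed.

Lemma eulerXn n : euler 'X^n = n%:R * 'X^n.
Proof.
rewrite /euler derivXn; case: n => [|n]; first by rewrite mulr0n mul0r mulr0.
by rewrite mulrnAr -exprS mulr_natl.
Qed.

Lemma eulerX : euler 'X = 'X.
Proof. by rewrite /euler derivX mulr1. Qed.

Lemma coef_euler u n : (euler u)`_n = n%:R * u`_n.
Proof.
rewrite /euler coefXM; case: n => [|n] /=; first by rewrite mul0r.
by rewrite coef_deriv mulr_natl.
Qed.

(** With theta = X d/dX this is theta^3 - 2 X (2 theta + 1)(5 theta^2 + 5 theta + 2) + 64 X^2 (theta
    + 1)^3, the operator form of the recurrence of A. *)
Definition domb_op u : {poly R} :=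
  let u1 := euler u in let u2 := euler u1 in let u3 := euler u2 in
  u3 - 'X * (20 *: u3 + 30 *: u2 + 18 *: u1 + 4 *: u)
  + 'X * ('X * (64 *: u3 + 192 *: u2 + 192 *: u1 + 64 *: u)).

Lemma domb_opD u v : domb_op (u + v) = domb_op u + domb_op v.
Proof. by rewrite /domb_op !eulerD; ring. Qed.

Lemma domb_opZ c u : domb_op (c *: u) = c *: domb_op u.
Proof. by rewrite /domb_op !eulerZ -!mul_polyC; ring. Qed.

Lemma domb_op0 : domb_op 0 = 0.
Proof. by rewrite -[X in domb_op X](scale0r 0) domb_opZ scale0r. Qed.

Lemma domb_op_rec u n : domb_op u = 0 ->
  n.+2%:R ^+ 3 * u`_n.+2 + 64 * n.+1%:R ^+ 3 * u`_n =
  2 * (2 * n%:R + 3) * (5 * n%:R ^+ 2 + 15 * n%:R + 12) * u`_n.+1.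
Proof.
move/(congr1 (fun v : {poly R} => v`_n.+2)); rewrite coef0 => e.
apply/eqP; rewrite -subr_eq0; apply/eqP; rewrite -[RHS]e /domb_op.
rewrite !(coefD, coefN, coef_euler) !coefXM /= !(coefD, coefZ, coef_euler).
by rewrite -[n.+2]addn2 -[n.+1]addn1 !natrD; ring.
Qed.

Lemma domb_op_rec1 u : domb_op u = 0 -> u`_1 = 4 * u`_0.
Proof.
move/(congr1 (fun v : {poly R} => v`_1)); rewrite coef0 => e.
apply/eqP; rewrite -subr_eq0; apply/eqP; rewrite -[RHS]e /domb_op.
rewrite !(coefD, coefN, coef_euler) !coefXM /= !(coefD, coefZ, coef_euler).
by ring.
Qed.
End Euler.

Section DombMod.
Variables (F : fieldType) (p : nat).
Hypotheses (pF : p \in [pchar F]) (p_gt3 : (3 < p)%N).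

Let p_pr : prime p. Proof. exact: pcharf_prime pF. Qed.

Lemma natf_neq0_lt n : (0 < n < p)%N -> n%:R != 0 :> F.
Proof.
case/andP=> n0 np; rewrite -(dvdn_pcharf pF); apply/negP => /dvdn_leq.
by move/(_ n0); rewrite leqNgt np.
Qed.

(** The recurrence determines the coefficient of index n+2 because (n+2)^3 is invertible while n+2 <
    p. *)
Lemma domb_unique (u : {poly F}) n : domb_op u = 0 -> u`_0 = 1 -> (n < p)%N ->
  u`_n = (A n)%:R.
Proof.
move=> Lu u0; elim/ltn_ind: n => -[|[|n]] IH np.
- by rewrite u0 /A big_mkord big_ord1.
- by rewrite (domb_op_rec1 Lu) u0 /A big_mkord !big_ord_recl big_ord0 /= mulr1.
have := domb_op_rec n Lu; rewrite (IH n.+1) ?(IH n) //; try by lia.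
have e : n.+2%:R ^+ 3 * (A n.+2)%:R + 64 * n.+1%:R ^+ 3 * (A n)%:R =
    2 * (2 * n%:R + 3) * (5 * n%:R ^+ 2 + 15 * n%:R + 12) * (A n.+1)%:R :> F.
  transitivity ((n.+2 ^ 3 * A n.+2 + 64 * n.+1 ^ 3 * A n)%:R : F).
    by rewrite !(natrD, natrM, natrX); ring.
  by rewrite domb_rec !(natrD, natrM, natrX); ring.
rewrite -e => /addIr; apply: mulfI; rewrite expf_neq0 // natf_neq0_lt //.
Qed.

(* By Fermat, the value at x is x^(2k) / (1 - 4 x)^(3k); this polynomial form
   keeps the degree below p. *)
Definition dterm k : {poly F} := 'X^(k.*2) * (1 - 4 *: 'X) ^+ (p.-1 - k * 3).

Let Z : {poly F} := 1 - 4 *: 'X.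

(** Since p - 1 - 3k is -1 - 3k in F, [dterm k] has the logarithmic derivative of X^(2k) / (1 - 4
    X)^(3k+1), the k-th term in the hypergeometric expansion of the generating function of A. *)
Lemma euler_dterm k : (k * 3 <= p.-1)%N ->
  Z * euler (dterm k) = ((2 * k%:R)%:P + (4 * (k%:R + 1)) *: 'X) * dterm k.
Proof.
move=> kp; rewrite /dterm eulerM eulerXn -/Z.
set e := (p.-1 - _)%N.
have eZ : Z * euler (Z ^+ e) = (- 4 * e%:R) *: 'X * Z ^+ e.
  rewrite /euler deriv_exp /Z !derivE -/Z; case: e => [|e'] /=.
    by rewrite mulr0n !mulr0 scale0r mul0r.
  by rewrite -mulr_natl -!mul_polyC exprS -/Z; ring.
have eE : e%:R = - 1 - 3 * k%:R :> F.
  rewrite natrB // natrM; have := pcharf0 pF.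
  rewrite -{1}(prednK (prime_gt0 p_pr)) -natr1 => /eqP; rewrite addr_eq0 => /eqP ->.
  by ring.
set x := 'X^_; have -> : k.*2%:R = 2 * k%:R :> {poly F} by rewrite -muln2 natrM mulrC.
transitivity (x * ((2 * k%:R * Z) * Z ^+ e + Z * euler (Z ^+ e))); first by ring.
rewrite eZ eE /Z -!mul_polyC !(polyCM, polyCD, polyCN, polyC_natr). by ring.
Qed.

Lemma size_Z : size Z = 2%N.
Proof.
have n4 : - 4 != 0 :> F.
  rewrite oppr_eq0 (_ : 4 = (2 * 2)%N%:R) // natrM.
  by rewrite mulf_neq0 // natf_neq0_lt //; lia.
by rewrite /Z addrC -scaleNr size_polyDl size_scale ?size_polyX // size_poly1.
Qed.

Lemma Z_neq0 : Z != 0.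
Proof. by rewrite -size_poly_eq0 size_Z. Qed.

Definition beta (k : nat) : F := 6 * (2 * k%:R + 1) * (3 * k%:R + 1) * (3 * k%:R + 2).

(** Only two terms appear, and ['X ^+ 2 * dterm k] is [Z ^+ 3 * dterm k.+1] as long as the exponents
    stay nonnegative. With the weights [acoef], whose ratio is [beta k] to (k+1)^3, the sum over k
    telescopes. *)
Lemma domb_op_dterm k : (k * 3 <= p.-1)%N ->
  Z ^+ 3 * domb_op (dterm k) = (8 *: (1 + 2 *: 'X)) * Z *
    (k%:R ^+ 3 *: (Z ^+ 3 * dterm k) - beta k *: ('X ^+ 2 * dterm k)).
Proof.
move=> kp; have h1 := euler_dterm kp; move: h1; rewrite /beta.
rewrite /domb_op; set y := dterm k; set y1 := euler y; set y2 := euler y1; set y3 := euler y2.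
move: (k%:R : F) => c.
set P1 := _ + _ *: 'X => h1.
have eP1 : euler P1 = (4 * (c + 1)) *: 'X.
  by rewrite /euler /P1 !derivE add0r -!mul_polyC mulr1 mulrC.
have eZ : euler Z = - 4 *: 'X.
  by rewrite /euler /Z !derivE sub0r -!mul_polyC mulr1 polyCN; ring.
have [d1 d2 d3] : [/\ euler y = y1, euler y1 = y2 & euler y2 = y3] by [].
clearbody y3 y2 y1 y; have Z0 := Z_neq0; have [defP1 defZ] : P1 = (2 * c)%:P + (4 * (c + 1)) *: 'X /\ Z = 1 - 4 *: 'X by [].
clearbody P1 Z; have h2 := congr1 (@euler F) h1; rewrite !eulerM d1 d2 eP1 eZ in h2.
have h3 := congr1 (@euler F) h2.
rewrite !(eulerD, eulerM, eulerZ, eulerX) d1 d2 d3 eP1 eZ in h3.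
(* Derivatives of the first-order relation, multiplied by powers of Z, express [Z ^+ 2 * y2] and
   [Z ^+ 3 * y3] through y; the claim becomes a polynomial identity. *)
have {}h2 : Z ^+ 2 * y2 = (Z * ((4 * (c + 1)) *: 'X) + (P1 + 4 *: 'X) * P1) * y.
  transitivity (Z * (- 4 *: 'X * y1 + Z * y2) + 4 *: 'X * (Z * y1)).
    by rewrite -!mul_polyC polyCN; ring.
  rewrite h2; transitivity (Z * ((4 * (c + 1)) *: 'X * y) + (P1 + 4 *: 'X) * (Z * y1)).
    by ring.
  by rewrite h1; ring.
have {}h3 : Z ^+ 3 * y3 = Z ^+ 2 * ((4 * (c + 1)) *: 'X) * y +
   Z * (2 * ((4 * (c + 1)) *: 'X) + 4 *: 'X) * (P1 * y) + (P1 + 8 *: 'X) * (Z ^+ 2 * y2).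
  transitivity (Z ^+ 2 * (- 4 *: 'X * y1 + - 4 *: 'X * y2 + (- 4 *: 'X * y2 + Z * y3))
     + Z * (4 *: 'X) * (Z * y1) + 8 *: 'X * (Z ^+ 2 * y2)).
    by rewrite -!mul_polyC !polyCN; ring.
  rewrite h3; transitivity (Z ^+ 2 * ((4 * (c + 1)) *: 'X) * y +
     Z * (2 * ((4 * (c + 1)) *: 'X) + 4 *: 'X) * (Z * y1) + (P1 + 8 *: 'X) * (Z ^+ 2 * y2)).
    by rewrite -!mul_polyC; ring.
  by rewrite h1.
transitivity ((1 - 20 *: 'X + 64 *: 'X ^+ 2) * (Z ^+ 3 * y3)
  + (192 *: 'X ^+ 2 - 30 *: 'X) * Z * (Z ^+ 2 * y2)
  + (192 *: 'X ^+ 2 - 18 *: 'X) * Z ^+ 2 * (Z * y1) + (64 *: 'X ^+ 2 - 4 *: 'X) * Z ^+ 3 * y).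
  by rewrite -!mul_polyC; ring.
rewrite h3 h2 h1.
rewrite defP1 defZ -!mul_polyC !(polyCM, polyCD, polyCN, polyC_exp, polyC_natr). by ring.
Qed.
Let m := (p %/ 3)%N.

Lemma m_le : (m * 3 <= p.-1)%N.
Proof.
have : (m * 3 != p)%N.
  apply/eqP=> e; move: p_pr; rewrite -e => /primeP[_ /(_ 3)].
  by rewrite dvdn_mull // => /(_ isT) /orP[] // /eqP; lia.
by rewrite /m; lia.
Qed.

(** One of 3m+1, 3m+2 is p. This stops the hypergeometric recurrences at index m modulo p, so that
    truncation there leaves no boundary term. *)
Lemma third_zero : (3 * m%:R + 1) * (3 * m%:R + 2) = 0 :> F.
Proof.
have : (p %| (3 * m + 1) * (3 * m + 2))%N.
  have := m_le; have : (p < m * 3 + 3)%N by rewrite /m; lia.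
  move=> h1 h2; have [-> | ->] : (p = 3 * m + 1 \/ p = 3 * m + 2)%N by lia.
    exact: dvdn_mulr.
  exact: dvdn_mull.
by rewrite (dvdn_pcharf pF) natrM (natrD _ (3 * m) 1) (natrD _ (3 * m) 2) (natrM _ 3 m) => /eqP.
Qed.

Lemma beta_m : beta m = 0.
Proof. by rewrite /beta -mulrA third_zero mulr0. Qed.

Lemma acoefS_beta k : k.+1%:R ^+ 3 * (acoef k.+1)%:R = beta k * (acoef k)%:R :> F.
Proof.
by rewrite -natrX -natrM acoefS !(natrM, natrD) /beta.
Qed.

Definition dsum : {poly F} := \sum_(k < m.+1) (acoef k)%:R *: dterm k.

Lemma domb_op_sum n (G : nat -> {poly F}) :
  domb_op (\sum_(k < n) G k) = \sum_(k < n) domb_op (G k).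
Proof.
elim: n => [|n IH]; first by rewrite !big_ord0 domb_op0.
by rewrite !big_ord_recr /= domb_opD IH.
Qed.

Lemma domb_op_dsum : domb_op dsum = 0.
Proof.
apply: (mulfI (expf_neq0 3 Z_neq0)); rewrite mulr0.
pose T k : {poly F} := ((acoef k)%:R * k%:R ^+ 3) *: (Z ^+ 3 * dterm k).
rewrite /dsum (@domb_op_sum _ (fun k => (acoef k)%:R *: dterm k)) mulr_sumr.
transitivity (\sum_(k < m.+1) (8 *: (1 + 2 *: 'X)) * Z * (T k - T k.+1)).
  apply: eq_bigr => k _; have km : (k <= m)%N by rewrite -ltnS.
  have kp : (k * 3 <= p.-1)%N by have := m_le; lia.
  rewrite domb_opZ -scalerAr domb_op_dterm // scalerAr scalerBr !scalerA /T.
  congr (_ * (_ - _)).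
  rewrite mulrC [X in _ = X *: _]mulrC acoefS_beta.
  (* At k = m the exponent of Z in the next term would be negative, and natural subtraction would
     spoil the identity; there [beta m] is zero. *)
  have [-> | ltkm] : k = m :> nat \/ (k < m)%N by lia.
    by rewrite beta_m !mul0r !scale0r.
  congr (_ *: _); rewrite /dterm doubleS.
  have -> : (p.-1 - k * 3 = (p.-1 - k.+1 * 3).+3)%N by have := m_le; lia.
  by rewrite -/Z !exprS; move: (_ ^+ k.*2) (_ ^+ (_ - _)) => a b; ring.
rewrite -mulr_sumr -(big_mkord xpredT (fun k => T k - T k.+1)).
rewrite (@telescope_sumr_eq _ _ _ (fun k => - T k)) => [|//|k _]; last by rewrite opprK addrC.
rewrite /T mulr0n expr0n mulr0 scale0r !oppr0 addr0.
by rewrite [_%:R * _]mulrC acoefS_beta beta_m mul0r scale0r oppr0 mulr0.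
Qed.

Lemma dsum0 : dsum`_0 = 1.
Proof.
have d k : (dterm k)`_0 = 0 ^+ k.*2.
  by rewrite -horner_coef0 /dterm hornerM hornerXn horner_exp /Z !hornerE subr0 expr1n mulr1.
rewrite /dsum coef_sum big_ord_recl /= big1 ?addr0 => [|k _].
  by rewrite coefZ d /acoef /hyp !bin0 mul1r.
by rewrite coefZ d expr0n /= mulr0.
Qed.

Lemma size_dsum : (size dsum <= p)%N.
Proof.
apply: (leq_trans (size_sum _ _ _)); apply/bigmax_leqP => k _.
apply: (leq_trans (size_scale_leq _ _)); rewrite /dterm.
rewrite size_monicM ?monicXn ?expf_neq0 ?Z_neq0 // size_polyXn -/Z.
have : (size (Z ^+ (p.-1 - k * 3)) <= (p.-1 - k * 3).+1)%N.
  by apply: leq_trans (size_poly_exp_leq _ _) _; rewrite size_Z mul1n.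
have : (k <= m)%N by rewrite -ltnS.
by have := m_le; move: (size _); lia.
Qed.

(** [dsum] is killed by [domb_op], has constant term 1 and degree below p, hence its coefficients
    are the A_n. Evaluating it at x, Fermat's theorem turns powers of 1 - 4 x into denominators. *)
Lemma domb_sum_hyp (x : F) : 1 - 4 * x != 0 -> (forall z : F, z != 0 -> z ^+ p.-1 = 1) ->
  \sum_(n < p) (A n)%:R * x ^+ n =
  \sum_(k < m.+1) (acoef k)%:R * (x ^+ 2 / (1 - 4 * x) ^+ 3) ^+ k.
Proof.
move=> nz flt; transitivity dsum.[x].
  rewrite (horner_coef_wide _ size_dsum); apply: eq_bigr => n _.
  by rewrite (domb_unique domb_op_dsum dsum0).
rewrite /dsum horner_sum; apply: eq_bigr => k _; rewrite hornerZ; congr (_ * _).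
rewrite /dterm /Z !hornerE; have kp : (k * 3 <= p.-1)%N by have := m_le; have := ltn_ord k; lia.
have e : (1 - 4 * x) ^+ (p.-1 - k * 3) * (1 - 4 * x) ^+ (k * 3) = 1.
  by rewrite -exprD subnK // flt.
rewrite expr_div_n -!exprM -muln2 mulnC (mulnC 3); apply: (canRL (mulfK _)).
  by rewrite expf_neq0.
by rewrite -mulrA e mulr1.
Qed.
End DombMod.

(** * Clausen's formula *)

Section Clausen.
Variables (F : fieldType) (p : nat).
Hypotheses (pF : p \in [pchar F]) (p_gt3 : (3 < p)%N).

Let m := (p %/ 3)%N.
Let m_lep : (m * 3 <= p.-1)%N. Proof. exact: (m_le pF). Qed.
Let beta0 := beta_m pF p_gt3.

(** With z = 27 b, the argument 4 z (1 - z) of Clausen's formula is 108 times the value of this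
    polynomial at b. *)
Definition quad27 : {poly F} := 'X - 27 *: 'X^2.
Let g := quad27.

Lemma quad27E u : g * u = 'X * (u - 27 *: ('X * u)).
Proof. by rewrite /g /quad27 -!mul_polyC; ring. Qed.

Lemma coef_derivE (u : {poly F}) n : u^`()`_n = n.+1%:R * u`_n.+1.
Proof. by rewrite coef_deriv mulr_natl. Qed.

Lemma deriv_sqr (u : {poly F}) : (u ^+ 2)^`() = 2 *: (u * u^`()).
Proof. by rewrite expr2 derivM -mul_polyC; ring. Qed.

(** The symmetric square of the equation (g u')' = 6 u satisfied by [hpoly]: it annihilates the
    squares of its solutions. *)
Definition clausen_op (u : {poly F}) : {poly F} :=
  (g * ((g * u^`())^`() - 12 *: u))^`() - 12 *: (g * u^`()).

Lemma clausen_opB u v : clausen_op (u - v) = clausen_op u - clausen_op v.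
Proof. by rewrite /clausen_op !derivE -!mul_polyC; ring. Qed.

Lemma clausen_opD u v : clausen_op (u + v) = clausen_op u + clausen_op v.
Proof. by rewrite /clausen_op !derivE -!mul_polyC; ring. Qed.

Lemma clausen_opZ c u : clausen_op (c *: u) = c *: clausen_op u.
Proof. by rewrite /clausen_op !derivE -!mul_polyC; ring. Qed.

(** The coefficient of index n contains u_(n+1) with the factor (n+1)^3 and otherwise only earlier
    coefficients. *)
Lemma clausen_unique u : clausen_op u = 0 -> u`_0 = 0 -> (size u <= p)%N -> u = 0.
Proof.
move=> Lu u0 su; apply/polyP => n; rewrite coef0.
elim/ltn_ind: n => -[//|n] IH.
have [np | pn] := ltnP n.+1 p; last by rewrite nth_default // (leq_trans su).
have := congr1 (fun v : {poly F} => v`_n) Lu; rewrite coef0 /clausen_op.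
set E := _ - 12 *: u.
have Ej j : E`_j = j.+1%:R * (j.+1%:R * u`_j.+1 - 27 * (j%:R * u`_j)) - 12 * u`_j.
  rewrite /E coefB coefZ coef_derivE quad27E coefXM /= coefB coefZ coefXM !coef_derivE.
  by case: j => [|j] /=; rewrite ?coef_derivE ?mul0r.
have gE : (g * E)`_n.+1 = n.+1%:R ^+ 2 * u`_n.+1.
  rewrite quad27E coefXM /= coefB coefZ coefXM !Ej (IH n) //.
  case: n {np} IH => [|n] IH /=; first by ring.
  by rewrite (IH n) // (IH n.+1) //; ring.
rewrite coefB coef_derivE gE quad27E coefZ coefXM.
have -> : (if n == 0%N then 0 else (u^`() - 27 *: ('X * u^`()))`_n.-1) = 0.
  case: n {np gE} IH => [//|n] IH /=.
  rewrite coefB coefZ coefXM coef_derivE (IH n.+1) //.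
  case: n IH => [|n] IH /=; first by ring.
  by rewrite coef_derivE (IH n.+1) //; ring.
rewrite mulr0 subr0 mulrA -exprS => /eqP; rewrite mulf_eq0 => /orP[|/eqP //].
by rewrite expf_eq0 /= (negPf (natf_neq0_lt pF _)).
Qed.

Definition hpoly : {poly F} := \poly_(k < m.+1) (hyp k)%:R.

Lemma hpoly_ode : (g * hpoly^`())^`() = 6 *: hpoly.
Proof.
apply/polyP => n; rewrite coefZ coef_derivE quad27E coefXM /= coefB coefZ coefXM.
have -> : (if n == 0%N then 0 else hpoly^`()`_n.-1) = n%:R * hpoly`_n.
  by case: n => [|n] /=; rewrite ?mul0r // coef_derivE.
rewrite coef_derivE !coef_poly !ltnS.
have [nm | nm | ->] := ltngtP n m.
- have e : n.+1%:R ^+ 2 * (hyp n.+1)%:R = 3 * (3 * n%:R + 1) * (3 * n%:R + 2) * (hyp n)%:R :> F.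
    by rewrite -natrX -natrM hypS !(natrM, natrD).
  rewrite mulrBr mulrA -expr2 e -[n.+1%:R]natr1; ring.
- by rewrite !mulr0 subr0 mulr0.
(* In the top degree there is no next coefficient; [third_zero] supplies the missing relation. *)
rewrite mulr0 sub0r -natr1.
transitivity ((6 - 3 * ((3 * m%:R + 1) * (3 * m%:R + 2))) * (hyp m)%:R : F); first by ring.
by rewrite (third_zero pF p_gt3) mulr0 subr0.
Qed.

(** With w = g H' and w' = 6 H, the successive stages of the operator on H^2 are 2 H w, 2 H' w and 2
    w^2, and the derivative of the last is 24 H w. *)
Lemma clausen_hpoly : clausen_op (hpoly ^+ 2) = 0.
Proof.
rewrite /clausen_op; have e := hpoly_ode; move: hpoly e => H; set w := g * H^`() => e.
have e1 : g * (H ^+ 2)^`() = 2 *: (H * w).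
  by rewrite deriv_sqr -!mul_polyC /w; ring.
have e2 : (2 *: (H * w))^`() - 12 *: H ^+ 2 = 2 *: (H^`() * w).
  by rewrite derivZ derivM e -!mul_polyC; ring.
rewrite e1 e2; have -> : g * (2 *: (H^`() * w)) = 2 *: w ^+ 2.
  by rewrite /w -!mul_polyC; ring.
rewrite derivZ deriv_sqr e -!mul_polyC; ring.
Qed.

Definition apoly : {poly F} := \sum_(k < m.+1) (acoef k)%:R *: g ^+ k.

Lemma deriv_quad27 : g^`() = 1 - 54 *: 'X.
Proof.
by rewrite /g /quad27 derivB derivX derivZ deriv_sqr derivX -!mul_polyC; ring.
Qed.

(** Because g'^2 = 1 - 108 g and g'' is constant, a power of g goes to two terms up to the factor
    g', with the same [beta] as in the recurrence of [acoef]; hence [apoly] telescopes. *)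
Lemma clausen_quad27 k :
  clausen_op (g ^+ k) = g^`() * (k%:R ^+ 3 *: g ^+ k.-1 - beta F k *: g ^+ k).
Proof.
have gk n : g * (g ^+ n)^`() = n%:R *: (g ^+ n * g^`()).
  rewrite deriv_exp; case: n => [|n] /=; first by rewrite mulr0n mulr0 scale0r.
  by rewrite mulrnAr -scaler_nat exprS; congr (_ *: _); ring.
have gg : g^`() ^+ 2 = 1 - 108 *: g.
  by rewrite deriv_quad27 /g /quad27 -!mul_polyC; ring.
have gdd : g^`()^`() = - 54%:P.
  by rewrite deriv_quad27 !derivE sub0r -mul_polyC mulr1.
have gS n : (g ^+ n.+1)^`() = n.+1%:R *: (g ^+ n * g^`()).
  by rewrite deriv_exp -scaler_nat mulrC.
have e1 : g * ((g * (g ^+ k)^`())^`() - 12 *: g ^+ k) =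
   k%:R ^+ 2 *: g ^+ k - (108 * k%:R ^+ 2 + 54 * k%:R + 12) *: g ^+ k.+1.
  rewrite gk derivZ derivM gdd (exprS g k).
  transitivity (k%:R *: ((g * (g ^+ k)^`()) * g^`() - 54 *: (g * g ^+ k)) - 12 *: (g * g ^+ k)).
    by rewrite -!mul_polyC; ring.
  rewrite gk; transitivity (k%:R *: (k%:R *: (g ^+ k * g^`() ^+ 2) - 54 *: (g * g ^+ k)) - 12 *: (g * g ^+ k)).
    by rewrite -!mul_polyC; ring.
  by rewrite gg -!mul_polyC !(polyC_natr, polyCM, polyCD, polyC_exp); ring.
rewrite /clausen_op e1 gk derivB !derivZ gS.
have -> : (g ^+ k)^`() = k%:R *: (g ^+ k.-1 * g^`()) by rewrite deriv_exp -scaler_nat mulrC.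
rewrite /beta -[k.+1%:R]natr1; move: (g ^+ k.-1) (k%:R : F) => x c.
by rewrite -!mul_polyC !(polyC_natr, polyCM, polyCD, polyC_exp); ring.
Qed.

Lemma clausen_op_sum n (G : nat -> {poly F}) :
  clausen_op (\sum_(k < n) G k) = \sum_(k < n) clausen_op (G k).
Proof.
elim: n => [|n IH]; first by rewrite !big_ord0 -[X in clausen_op X](subrr 0) clausen_opB subrr.
by rewrite !big_ord_recr /= clausen_opD IH.
Qed.

Lemma clausen_apoly : clausen_op apoly = 0.
Proof.
pose T k : {poly F} := ((acoef k)%:R * k%:R ^+ 3) *: g ^+ k.-1.
rewrite /apoly (@clausen_op_sum _ (fun k => (acoef k)%:R *: g ^+ k)).
transitivity (\sum_(k < m.+1) g^`() * (T k - T k.+1)).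
  apply: eq_bigr => k _; rewrite clausen_opZ clausen_quad27 scalerAr scalerBr !scalerA /T.
  congr (_ * (_ - _)); rewrite [X in _ = X *: _]mulrC (acoefS_beta F).
  by rewrite mulrC.
rewrite -mulr_sumr -(big_mkord xpredT (fun k => T k - T k.+1)).
rewrite (@telescope_sumr_eq _ _ _ (fun k => - T k)) => [|//|k _]; last by rewrite opprK addrC.
rewrite /T mulr0n expr0n mulr0 scale0r !oppr0 addr0.
by rewrite [_%:R * _]mulrC acoefS_beta beta0 mul0r scale0r oppr0 mulr0.
Qed.

Lemma size_quad27 : size g = 3%N.
Proof.
rewrite /g /quad27 addrC -scaleNr size_polyDl size_scale ?size_polyXn ?size_polyX //;
rewrite oppr_eq0 (_ : 27 = (3 ^ 3)%N%:R) // natrX expf_neq0 // (natf_neq0_lt pF) //.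
Qed.

Lemma size_apoly : (size apoly <= p)%N.
Proof.
apply: (leq_trans (size_sum _ _ _)); apply/bigmax_leqP => k _.
apply: (leq_trans (size_scale_leq _ _)); apply: leq_trans (size_poly_exp_leq _ _) _.
by rewrite size_quad27; have := ltn_ord k; have := m_lep; lia.
Qed.

Lemma hpoly0 : hpoly`_0 = 1.
Proof. by rewrite coef_poly /hyp !bin0. Qed.

Lemma clausen : hpoly ^+ 2 = apoly.
Proof.
apply/eqP; rewrite -subr_eq0; apply/eqP; apply: clausen_unique.
- by rewrite clausen_opB clausen_hpoly clausen_apoly subr0.
- rewrite coefB -!horner_coef0 horner_exp (horner_coef0 hpoly) hpoly0 expr1n.
  rewrite /apoly horner_sum big_ord_recl big1 ?addr0 => [|k _].
    by rewrite hornerZ expr0 hornerC mulr1 /acoef /hyp !bin0 subrr.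
  have g0 : g.[0] = 0.
    by rewrite /g /quad27 hornerD hornerN hornerZ hornerXn hornerX expr0n mulr0 subr0.
  by rewrite hornerZ horner_exp g0 expr0n mulr0.
apply: leq_trans (size_polyD _ _) _; rewrite size_polyN geq_max size_apoly andbT.
apply: leq_trans (size_poly_exp_leq _ _) _.
have := size_poly m.+1 (fun k => (hyp k)%:R : F); rewrite -/hpoly.
by move: (size _) => sz; have := m_lep; nia.
Qed.

Lemma horner_quad27 b : g.[b] = b * (1 - 27 * b).
Proof. by rewrite /g /quad27 hornerD hornerN hornerZ hornerXn hornerX; ring. Qed.

Lemma clausen_horner b : hpoly.[b] ^+ 2 = \sum_(k < m.+1) (acoef k)%:R * (b * (1 - 27 * b)) ^+ k.
Proof.
rewrite -horner_exp clausen /apoly horner_sum; apply: eq_bigr => k _.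
by rewrite hornerZ horner_exp horner_quad27.
Qed.

Lemma comp_poly_exp (u v : {poly F}) n : (u ^+ n) \Po v = (u \Po v) ^+ n.
Proof. by elim: n => [|n IH]; rewrite ?comp_polyC // !exprS comp_polyM IH. Qed.

Lemma hyp_neq0 k : (k <= m)%N -> (hyp k)%:R != 0 :> F.
Proof.
move=> km; have : ((k * 3)`!)%:R != 0 :> F.
  have : (k * 3 <= p.-1)%N by have := m_lep; lia.
  elim: (k * 3)%N => [|n IH] np; first exact: oner_neq0.
  by rewrite factS natrM mulf_neq0 ?IH ?(natf_neq0_lt pF) //; lia.
by rewrite -hyp_fact natrM mulf_eq0 negb_or => /andP[].
Qed.

Lemma size_hpoly : size hpoly = m.+1.
Proof. by rewrite size_poly_eq //= hyp_neq0. Qed.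

(** The map b -> 1/27 - b fixes b (1 - 27 b), so by [clausen] it preserves the square of [hpoly] and
    changes [hpoly] by a sign. The leading coefficient gives the sign, the degree m being odd. *)
Lemma hpoly_anti b : odd m -> hpoly.[27^-1 - b] = - hpoly.[b].
Proof.
move=> odd_m; pose q : {poly F} := 27^-1%:P - 'X.
have n27 : 27 != 0 :> F.
  by rewrite (_ : 27 = (3 ^ 3)%N%:R) // natrX expf_neq0 // (natf_neq0_lt pF).
have gq : g \Po q = g.
  rewrite /g /quad27 comp_polyB comp_polyZ !comp_Xn_poly comp_polyX /q.
  have e : 27%:P * 27^-1%:P = 1 :> {poly F} by rewrite -polyCM mulfV.
  rewrite -!mul_polyC; transitivity (27^-1%:P - 'X - (27%:P * 27^-1%:P) * (27^-1%:P - 2 * 'X) - 27%:P * 'X^2 : {poly F}).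
    by ring.
  by rewrite e; ring.
have aq : apoly \Po q = apoly.
  rewrite /apoly linear_sum /=; apply: eq_bigr => k _.
  by rewrite comp_polyZ comp_poly_exp gq.
have : (hpoly \Po q - hpoly) * (hpoly \Po q + hpoly) = 0.
  by rewrite -subr_sqr -comp_poly_exp clausen aq subrr.
move/eqP; rewrite mulf_eq0 subr_eq0 addr_eq0 => /orP[] /eqP e; last first.
  by rewrite -hornerN -e horner_comp /q !hornerE.
have lq : lead_coef q = -1.
  rewrite /q lead_coefDr ?lead_coefN ?lead_coefX //.
  by rewrite size_polyN size_polyX size_polyC; case: (_ != 0).
have sq : (1 < size q)%N.
  rewrite /q addrC size_polyDl ?size_polyN ?size_polyX // size_polyC; by case: (_ != 0).
have := congr1 lead_coef e; rewrite lead_coef_comp // size_hpoly lq /= -signr_odd odd_m expr1 mulrN1.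
have l0 : lead_coef hpoly != 0 by rewrite lead_coef_eq0 -size_poly_eq0 size_hpoly.
move=> e2; have : 2 * lead_coef hpoly = 0 by rewrite mulr_natl mulr2n -{1}e2 addNr.
move/eqP; rewrite mulf_eq0 (negPf l0) orbF.
by rewrite (negPf (natf_neq0_lt pF _)) //; lia.
Qed.
End Clausen.

(** * The group law *)

Section RawGroupLaw.
Variables (K : fieldType) (D a b : K).
Hypotheses (two_neq0 : 2 != 0 :> K) (D_neq0 : D != 0) (b_neq0 : b != 0)
  (disc_neq0 : a ^+ 2 - 4 * b != 0).

Definition cubic (x : K) : K := x ^+ 3 + a * x ^+ 2 + b * x.

Definition on_curve (o : option (K * K)) : bool :=
  if o is Some (x, y) then D * y ^+ 2 == cubic x else true.

Definition opp_pt (o : option (K * K)) := if o is Some (x, y) then Some (x, - y) else None.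

Definition slope (x1 y1 x2 y2 : K) : K :=
  if x1 == x2 then (3 * x1 ^+ 2 + 2 * a * x1 + b) / (2 * D * y1) else (y2 - y1) / (x2 - x1).

Definition add_pt (o1 o2 : option (K * K)) : option (K * K) :=
  match o1, o2 with
  | None, _ => o2
  | _, None => o1
  | Some (x1, y1), Some (x2, y2) =>
    if (x1 == x2) && (y1 == - y2) then None else
    let l := slope x1 y1 x2 y2 in
    let x3 := D * l ^+ 2 - a - x1 - x2 in
    Some (x3, - (y1 + l * (x3 - x1)))
  end.

(* [y = l x + c] meets the curve exactly in the abscissae [x1], [x2], [x3]. *)
Definition collinear l c x1 x2 x3 :=
  [/\ x1 + x2 + x3 = D * l ^+ 2 - a, x1 * x2 + x1 * x3 + x2 * x3 = b - 2 * D * l * c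
    & x1 * x2 * x3 = D * c ^+ 2].

Lemma collinear_curve l c x1 x2 x3 : collinear l c x1 x2 x3 ->
  D * (l * x1 + c) ^+ 2 = cubic x1.
Proof.
case=> e1 e2 e3; rewrite /cubic.
have -> : a = D * l ^+ 2 - (x1 + x2 + x3) by rewrite e1; ring.
have -> : b = 2 * D * l * c + (x1 * x2 + x1 * x3 + x2 * x3) by rewrite e2; ring.
transitivity (D * l ^+ 2 * x1 ^+ 2 + 2 * D * l * c * x1 + x1 * x2 * x3); last by ring.
by rewrite e3; ring.
Qed.

(** The discriminant of the cubic is b^2 (a^2 - 4 b). *)
Lemma cubic_separable x : cubic x = 0 -> 3 * x ^+ 2 + 2 * a * x + b = 0 -> False.
Proof.
rewrite /cubic => e1 e2.
have /eqP : x * (x ^+ 2 + a * x + b) = 0 by rewrite -[RHS]e1; ring.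
rewrite mulf_eq0 => /orP[] /eqP x0.
  by move/eqP: e2; rewrite x0 expr0n /= !mulr0 !add0r (negPf b_neq0).
have e3 : x * (2 * x + a) = 0.
  by rewrite -[RHS]e2 -[RHS]subr0 -x0; ring.
have /eqP := disc_neq0; apply.
have : (2 * x + a) ^+ 2 = a ^+ 2 - 4 * b.
  transitivity (a ^+ 2 - 4 * b + 4 * (x ^+ 2 + a * x + b)); first by ring.
  by rewrite x0 mulr0 addr0.
move=> <-; move/eqP: e3; rewrite mulf_eq0 => /orP[/eqP x00 | /eqP ->]; last by rewrite expr0n.
by move/eqP: x0; rewrite x00 expr0n /= mulr0 !add0r (negPf b_neq0).
Qed.

(** For x1 = x2 the symmetric functions force l to be the tangent slope; the ordinate is then
    nonzero, since otherwise x1 would be a double root of the cubic. *)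
Lemma collinear_add l c x1 x2 x3 : collinear l c x1 x2 x3 ->
  add_pt (Some (x1, l * x1 + c)) (Some (x2, l * x2 + c)) = Some (x3, - (l * x3 + c)).
Proof.
move=> col; have [e1 e2 e3] := col; rewrite /=.
have ex3 : x3 = D * l ^+ 2 - a - x1 - x2 by rewrite -e1; ring.
have [x12 | x12] /= := eqVneq x1 x2; last first.
  rewrite /slope (negPf x12); have -> : (l * x2 + c - (l * x1 + c)) / (x2 - x1) = l.
    by field; rewrite subr_eq0 eq_sym.
  by rewrite -ex3; congr (Some (_, _)); ring.
subst x2; set y1 := l * x1 + c.
have ed : 3 * x1 ^+ 2 + 2 * a * x1 + b = 2 * D * y1 * l.
  rewrite (_ : a = D * l ^+ 2 - (x1 + x1 + x3)); last by rewrite e1; ring.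
  rewrite (_ : b = 2 * D * l * c + (x1 * x1 + x1 * x3 + x1 * x3)); last by rewrite e2; ring.
  by rewrite /y1; ring.
have y1n : y1 != 0.
  apply/negP => /eqP y10; apply: (@cubic_separable x1); last by rewrite ed y10; ring.
  by rewrite -(collinear_curve col) -/y1 y10 expr0n mulr0.
have -> : (y1 == - y1) = false.
  by rewrite -addr_eq0 -mulr2n -mulr_natl mulf_eq0 (negPf two_neq0) (negPf y1n).
rewrite /slope eqxx ed; have -> : 2 * D * y1 * l / (2 * D * y1) = l.
  by field; rewrite y1n D_neq0 two_neq0.
by rewrite -ex3; congr (Some (_, _)); rewrite /y1; ring.
Qed.

(** This hides the distinction between chord and tangent: later arguments only see [collinear],
    which is symmetric in the three abscissae. *)
Variant add_spec (x1 y1 x2 y2 : K) : option (K * K) -> Prop :=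
 | AddOpp of x1 = x2 & y1 = - y2 : add_spec x1 y1 x2 y2 None
 | AddLine l c x3 of y1 = l * x1 + c & y2 = l * x2 + c & collinear l c x1 x2 x3
     : add_spec x1 y1 x2 y2 (Some (x3, - (l * x3 + c))).

Lemma addP x1 y1 x2 y2 : on_curve (Some (x1, y1)) -> on_curve (Some (x2, y2)) ->
  add_spec x1 y1 x2 y2 (add_pt (Some (x1, y1)) (Some (x2, y2))).
Proof.
move=> /eqP c1 /eqP c2 /=; case: ifP => [/andP[/eqP-> /eqP->]|N]; first by constructor.
set l := slope _ _ _ _; set x3 := _ - x2.
have [ey2 star] : y2 = y1 + l * (x2 - x1) /\
    2 * D * l * y1 = x1 ^+ 2 + x1 * x2 + x2 ^+ 2 + a * (x1 + x2) + b - D * l ^+ 2 * (x2 - x1).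
  rewrite /l /slope; case: eqP N => [ex | /eqP x12] /= N.
    subst x2; have /eqP : (y1 - y2) * (y1 + y2) = 0.
      apply: (mulfI D_neq0); rewrite mulr0 -subr_sqr mulrBr c1 c2; exact: subrr.
    rewrite mulf_eq0 subr_eq0 addr_eq0 N orbF => /eqP e; subst y2.
    have y1n : y1 != 0 by apply: contraFN N => /eqP ->; rewrite oppr0.
    split; first by rewrite subrr mulr0 addr0.
    by field; rewrite y1n D_neq0 two_neq0.
  split; first by field; rewrite subr_eq0 eq_sym.
  have d0 : x2 - x1 != 0 by rewrite subr_eq0 eq_sym.
  apply: (mulfI d0).
  transitivity (D * y2 ^+ 2 - D * y1 ^+ 2 - D * ((y2 - y1) / (x2 - x1)) ^+ 2 * (x2 - x1) ^+ 2).
    by field.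
  by rewrite c1 c2 /cubic; ring.
have -> : - (y1 + l * (x3 - x1)) = - (l * x3 + (y1 - l * x1)) by ring.
constructor; [by ring | by rewrite ey2; ring |].
split; first by rewrite /x3; ring.
  transitivity (b - 2 * D * l * y1 + 2 * D * l ^+ 2 * x1); last by ring.
  by rewrite star /x3; ring.
transitivity (D * y1 ^+ 2 - 2 * D * l * y1 * x1 + D * l ^+ 2 * x1 ^+ 2); last by ring.
by rewrite star c1 /cubic /x3; ring.
Qed.

Lemma collinear_perm l c x1 x2 x3 : collinear l c x1 x2 x3 ->
  collinear l c x2 x1 x3 /\ collinear l c x2 x3 x1.
Proof. by case=> e1 e2 e3; split; split; rewrite -?e1 -?e2 -?e3; ring. Qed.

Lemma opp_ptK : involutive opp_pt.
Proof. by case=> [[x y]|] //=; rewrite opprK. Qed.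

Lemma on_curve_opp o : on_curve o -> on_curve (opp_pt o).
Proof. by case: o => [[x y]|] //=; rewrite sqrrN. Qed.

Lemma on_curve_add o1 o2 : on_curve o1 -> on_curve o2 -> on_curve (add_pt o1 o2).
Proof.
case: o1 o2 => [[x1 y1]|] [[x2 y2]|] // h1 h2.
case: (addP h1 h2) => // l c x3 _ _ /collinear_perm[_ /collinear_perm[_ /collinear_curve e]].
by rewrite /= sqrrN e.
Qed.

Lemma add_pt0 o : add_pt o None = o. Proof. by case: o => [[]|]. Qed.

Lemma add_ptC o1 o2 : on_curve o1 -> on_curve o2 -> add_pt o1 o2 = add_pt o2 o1.
Proof.
case: o1 o2 => [[x1 y1]|] [[x2 y2]|] // h1 h2.
case: (addP h1 h2) => [-> -> | l c x3 -> -> /collinear_perm[col _]].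
  by rewrite /= eqxx opprK eqxx.
by rewrite (collinear_add col).
Qed.

Lemma add_pt_opp o : add_pt o (opp_pt o) = None.
Proof. by case: o => [[x y]|] //=; rewrite eqxx opprK eqxx. Qed.

Lemma collinear_add_opp l c x1 x2 x3 : collinear l c x1 x2 x3 ->
  add_pt (Some (x1, - (l * x1 + c))) (Some (x2, - (l * x2 + c))) = Some (x3, l * x3 + c).
Proof.
case=> e1 e2 e3; have col : collinear (- l) (- c) x1 x2 x3.
  by split; rewrite ?e1 ?e2 ?e3; ring.
have := collinear_add col.
have N x : - l * x - c = - (l * x + c) by ring.
by rewrite !N opprK.
Qed.

Lemma opp_pt_add o1 o2 : on_curve o1 -> on_curve o2 ->
  opp_pt (add_pt o1 o2) = add_pt (opp_pt o1) (opp_pt o2).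
Proof.
case: o1 o2 => [[x1 y1]|] [[x2 y2]|] // h1 h2.
case: (addP h1 h2) => [-> -> | l c x3 -> -> col].
  by rewrite /= !eqxx.
by rewrite {2 3}/opp_pt (collinear_add_opp col) /= opprK.
Qed.

Lemma add_ptK o1 o2 : on_curve o1 -> on_curve o2 ->
  add_pt (add_pt o1 o2) (opp_pt o2) = o1.
Proof.
case: o1 o2 => [[x1 y1]|] [[x2 y2]|] // h1 h2; last exact: add_pt_opp.
case: (addP h1 h2) => [-> -> //| l c x3 -> -> col].
have [_ /collinear_perm[col' _]] := collinear_perm col.
by rewrite /opp_pt (collinear_add_opp col').
Qed.

(* The parabola [y = u x^2 + v x + w] meets the curve in four points [P_i]; the
   line through [P_1, P_2] and the line through [P_3, P_4] then meet the curve in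
   opposite points. *)
Definition coparabolic u v w x1 x2 x3 x4 :=
  [/\ 1 - 2 * D * u * v = D * u ^+ 2 * (x1 + x2 + x3 + x4),
      D * (v ^+ 2 + 2 * u * w) - a =
        D * u ^+ 2 * (x1 * x2 + x1 * x3 + x1 * x4 + x2 * x3 + x2 * x4 + x3 * x4),
      b - 2 * D * v * w =
        D * u ^+ 2 * (x1 * x2 * x3 + x1 * x2 * x4 + x1 * x3 * x4 + x2 * x3 * x4)
    & D * w ^+ 2 = D * u ^+ 2 * (x1 * x2 * x3 * x4)].

(** The third abscissa does not change when {x1, x2} and {x3, x4} are exchanged, so both lines end
    at the same abscissa. *)
Lemma coparabolic_line u v w x1 x2 x3 x4 : coparabolic u v w x1 x2 x3 x4 ->
  collinear (v + u * (x1 + x2)) (w - u * x1 * x2) x1 x2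
    (D * u ^+ 2 * (x1 * x2 + x3 * x4) - 2 * D * u * w).
Proof.
case=> e1 e2 e3 e4.
have ea : a = D * (v ^+ 2 + 2 * u * w) -
    D * u ^+ 2 * (x1 * x2 + x1 * x3 + x1 * x4 + x2 * x3 + x2 * x4 + x3 * x4).
  by rewrite -e2; ring.
have eb : b = 2 * D * v * w +
   D * u ^+ 2 * (x1 * x2 * x3 + x1 * x2 * x4 + x1 * x3 * x4 + x2 * x3 * x4).
  by rewrite -e3; ring.
have e5 : 2 * D * u * v = 1 - D * u ^+ 2 * (x1 + x2 + x3 + x4) by rewrite -e1; ring.
split.
- rewrite ea; apply/eqP; rewrite -subr_eq0; apply/eqP.
  transitivity ((x1 + x2) * (1 - D * u ^+ 2 * (x1 + x2 + x3 + x4) - 2 * D * u * v)); first by ring.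
  by rewrite e5; ring.
- rewrite eb; apply/eqP; rewrite -subr_eq0; apply/eqP.
  transitivity (x1 * x2 * (1 - D * u ^+ 2 * (x1 + x2 + x3 + x4) - 2 * D * u * v)); first by ring.
  by rewrite e5; ring.
rewrite (_ : D * (w - u * x1 * x2) ^+ 2 =
   D * w ^+ 2 - 2 * D * u * w * x1 * x2 + D * u ^+ 2 * x1 ^+ 2 * x2 ^+ 2); last by ring.
by rewrite e4; ring.
Qed.

Lemma coparabolic_add u v w x1 x2 x3 x4 : u != 0 -> coparabolic u v w x1 x2 x3 x4 ->
  let q x := u * x ^+ 2 + v * x + w in
  add_pt (Some (x1, q x1)) (Some (x2, q x2)) =
  opp_pt (add_pt (Some (x3, q x3)) (Some (x4, q x4))).
Proof.
move=> u0 cop q; have [e1 e2 e3 e4] := cop.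
have cop' : coparabolic u v w x3 x4 x1 x2.
  by split; rewrite ?e1 ?e2 ?e3 ?e4; ring.
have := collinear_add (coparabolic_line cop); have := collinear_add (coparabolic_line cop').
have line y z : (v + u * (y + z)) * y + (w - u * y * z) = q y by rewrite /q; ring.
have line' y z : (v + u * (y + z)) * z + (w - u * y * z) = q z by rewrite /q; ring.
rewrite !line !line' => -> -> /=; rewrite opprK (addrC (x3 * x4)); congr (Some (_, _)).
set X := _ - 2 * D * u * w.
have eX : 2 * v + u * (x1 + x2 + x3 + x4) = (D * u)^-1.
  apply: (mulIf (mulf_neq0 D_neq0 u0)); rewrite mulVf ?mulf_neq0 //.
  by rewrite -[RHS](subrK (2 * D * u * v)) e1; ring.
apply/eqP; rewrite eq_sym -subr_eq0 opprK; apply/eqP.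
transitivity (X * (2 * v + u * (x1 + x2 + x3 + x4)) + 2 * w - u * (x1 * x2 + x3 * x4)); first by ring.
by rewrite eX /X; field; rewrite D_neq0 u0.
Qed.

Lemma coparabolic_perm u v w x1 x2 x3 x4 : coparabolic u v w x1 x2 x3 x4 ->
  coparabolic u v w x2 x3 x1 x4.
Proof. by case=> e1 e2 e3 e4; split; rewrite ?e1 ?e2 ?e3 ?e4; ring. Qed.

(** The two lines take opposite values at z, and k is the sum of their slopes. Eliminating a and b
    leaves the symmetric functions of the second pair. *)
Lemma collinear_opp_sum l c x1 x2 x3 x4 z k :
  collinear l c x1 x2 z -> collinear (k - l) (- c - k * z) x3 x4 z ->
  x3 + x4 = D * k ^+ 2 - 2 * D * k * l + x1 + x2 /\
  x3 * x4 = x1 * x2 + D * k ^+ 2 * z + 2 * D * k * c.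
Proof.
move=> [e1 e2 e3] [f1 f2 f3].
have ea : a = D * l ^+ 2 - (x1 + x2 + z) by rewrite e1; ring.
have eb : b = 2 * D * l * c + (x1 * x2 + x1 * z + x2 * z) by rewrite e2; ring.
rewrite ea in f1; rewrite eb in f2.
have g1 : x3 + x4 = D * k ^+ 2 - 2 * D * k * l + x1 + x2.
  by apply: (addIr z); rewrite f1; ring.
split=> //; apply: (addIr ((x3 + x4) * z)).
transitivity (x3 * x4 + x3 * z + x4 * z); first by ring.
by rewrite f2 g1; ring.
Qed.

(* Two lines meeting the curve in opposite points span a parabola. *)
Lemma coparabolic_lines l c x1 x2 x3 x4 z k : k != 0 ->
  collinear l c x1 x2 z -> collinear (k - l) (- c - k * z) x3 x4 z ->
  coparabolic (D * k)^-1 (l - (D * k)^-1 * (x1 + x2)) (c + (D * k)^-1 * (x1 * x2)) x1 x2 x3 x4.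
Proof.
move=> k0 col col'.
have [g1 g2] := collinear_opp_sum col col'.
have [e1 e2 e3] := col.
have ea : a = D * l ^+ 2 - (x1 + x2 + z) by rewrite e1; ring.
have eb : b = 2 * D * l * c + (x1 * x2 + x1 * z + x2 * z) by rewrite e2; ring.
set u := (D * k)^-1; have uk : D * k * u = 1 by rewrite mulfV ?mulf_neq0.
split; rewrite ?ea ?eb.
- rewrite -[x1 + x2 + x3 + x4]addrA g1 /u; field; rewrite k0 D_neq0 //.
- rewrite (_ : x1 * x2 + x1 * x3 + x1 * x4 + x2 * x3 + x2 * x4 + x3 * x4 = x1 * x2 + (x1 + x2) * (x3 + x4) + x3 * x4); last by ring.
  by rewrite g1 g2 /u; field; rewrite k0 D_neq0.
- rewrite (_ : x1 * x2 * x3 + x1 * x2 * x4 + x1 * x3 * x4 + x2 * x3 * x4 = x1 * x2 * (x3 + x4) + (x1 + x2) * (x3 * x4)); last by ring.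
  by rewrite g1 g2 /u; field; rewrite k0 D_neq0.
rewrite (_ : x1 * x2 * x3 * x4 = x1 * x2 * (x3 * x4)); last by ring.
rewrite g2; transitivity (D * c ^+ 2 + 2 * D * u * c * (x1 * x2) + D * u ^+ 2 * (x1 * x2) ^+ 2).
  by ring.
by rewrite -e3 /u; field; rewrite k0 D_neq0.
Qed.

Lemma add_pt_eq0 o1 o2 : on_curve o1 -> on_curve o2 -> add_pt o1 o2 = None -> o2 = opp_pt o1.
Proof. by move=> h1 h2 e; rewrite -{1}(add_ptK h1 h2) e /= opp_ptK. Qed.

(** Generically, the line through o1, o2 and the line through o1 + o2, o3 contain the opposite
    points -(o1 + o2) and o1 + o2. Hence a parabola passes through o1, o2, o3 and o4 = -((o1 + o2) +
    o3), and pairing o2 with o3 and o1 with o4 instead gives the claim. *)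
Lemma add_ptA o1 o2 o3 : on_curve o1 -> on_curve o2 -> on_curve o3 ->
  add_pt (add_pt o1 o2) o3 = add_pt o1 (add_pt o2 o3).
Proof.
move=> h1 h2 h3; have [h1' h2'] := (on_curve_opp h1, on_curve_opp h2).
have h3' := on_curve_opp h3; have h12 := on_curve_add h1 h2.
have canc o o' : on_curve o -> on_curve o' -> add_pt o (add_pt (opp_pt o) o') = o'.
  move=> h h'; have hn := on_curve_opp h.
  by rewrite (add_ptC h (on_curve_add hn h')) (add_ptC hn h') -{2}(opp_ptK o) add_ptK.
have [e3 | n3] := eqVneq o3 (opp_pt o1).
  by rewrite e3 (add_ptC h2 h1') canc // (add_ptC h1 h2) add_ptK.
have [e3' | n3'] := eqVneq o3 (opp_pt o2).
  by rewrite e3' add_ptK // add_pt_opp add_pt0.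
have [e12 | n12] := eqVneq (add_pt o1 o2) None.
  by rewrite e12 (add_pt_eq0 h1 h2 e12) canc.
have [e123 | n123] := eqVneq (add_pt (add_pt o1 o2) o3) None.
  rewrite e123 (add_pt_eq0 h12 h3 e123) opp_pt_add // (add_ptC h1' h2') canc //.
  by rewrite add_pt_opp.
case: o1 o2 o3 h1 h2 h3 h1' h2' h3' h12 n3 n3' n12 n123 => [[x1 y1]|] [[x2 y2]|] [[x3 y3]|] // h1 h2 h3 h1' h2' h3'; first last.
  by rewrite add_pt0.
case: (addP h1 h2) => // l c z ey1 ey2 col h12 n3 n3' _.
case: (addP h12 h3) => // l' c' x4 ez ey3 col' _.
set k := l + l'; have el' : l' = k - l by rewrite /k; ring.
have ec' : c' = - c - k * z.
  by apply: (addrI (l' * z)); rewrite -ez /k; ring.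
(* For k = 0 the two lines are mirror images, so {x3, x4} = {x1, x2} and o3 is the opposite of o1 or
   o2, which has been excluded. *)
have [k0 | k0] := eqVneq k 0.
  case: col' col => [f1 f2 f3] [e1 e2 e3]; rewrite ec' el' k0 in f1 f2 f3 ey3.
  have /eqP : (x3 - x1) * (x3 - x2) = 0.
    transitivity (x3 * (x3 + x4 - (x1 + x2)) + x1 * x2 - x3 * x4); first by ring.
    have g1 : x3 + x4 = x1 + x2.
      by apply: (addrI z); rewrite addrA f1; transitivity (x1 + x2 + z); [rewrite e1|]; ring.
    have g2 : x3 * x4 = x1 * x2.
      apply: (addIr ((x3 + x4) * z)); transitivity (z * x3 + z * x4 + x3 * x4); first by ring.
      rewrite f2 g1; transitivity (x1 * x2 + x1 * z + x2 * z); last by ring.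
      by rewrite e2; ring.
    by rewrite g1 g2; ring.
  rewrite mulf_eq0 !subr_eq0 => /orP[] /eqP ex.
    by case/eqP: n3; rewrite /= ey3 ex ey1; congr (Some (_, _)); ring.
  by case/eqP: n3'; rewrite /= ey3 ex ey2; congr (Some (_, _)); ring.
have [_ col''] := collinear_perm col'; rewrite el' ec' in col''.
have cop := coparabolic_lines k0 col col''.
have u0 : (D * k)^-1 != 0 by rewrite invr_eq0 mulf_neq0.
have esum := coparabolic_add u0 (coparabolic_perm cop); cbv beta zeta in esum; move: esum.
have [g1 g2] : x3 + x4 = D * k ^+ 2 - 2 * D * k * l + x1 + x2 /\
    x3 * x4 = x1 * x2 + D * k ^+ 2 * z + 2 * D * k * c.
  exact: collinear_opp_sum col col''.
have uk : (D * k)^-1 * (D * k) = 1 by rewrite mulVf ?mulf_neq0.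
move: (D * k)^-1 uk => u uk.
have q1 : u * x1 ^+ 2 + (l - u * (x1 + x2)) * x1 + (c + u * (x1 * x2)) = y1.
  by rewrite ey1; ring.
have q2 : u * x2 ^+ 2 + (l - u * (x1 + x2)) * x2 + (c + u * (x1 * x2)) = y2.
  by rewrite ey2; ring.
have q34 t s : t + s = x3 + x4 -> t * s = x3 * x4 ->
    u * t ^+ 2 + (l - u * (x1 + x2)) * t + (c + u * (x1 * x2)) = l' * t + c'.
  move=> e1 e2; rewrite el' ec'.
  transitivity (u * (t * (t + s - (x1 + x2)) + x1 * x2 - t * s) + l * t + c); first by ring.
  rewrite e1 e2 g1 g2; transitivity ((u * (D * k)) * (k * t - 2 * l * t - k * z - 2 * c) + l * t + c); first by ring.
  by rewrite uk; ring.
rewrite q1 q2 (q34 x3 x4) // (q34 x4 x3) 1?[x4 + x3]addrC 1?[x4 * x3]mulrC // -ey3 => ->.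
have h4 : on_curve (Some (x4, l' * x4 + c')).
  by have [_ /collinear_perm[_ /collinear_curve/eqP]] := collinear_perm col'.
by rewrite opp_pt_add // canc // on_curve_opp.
Qed.

End RawGroupLaw.

Record ecurve (K : fieldType) := ECurve {
  ecD : K; eca : K; ecb : K;
  ec2_neq0 : 2 != 0 :> K; ecD_neq0 : ecD != 0; ecb_neq0 : ecb != 0;
  ecdisc_neq0 : eca ^+ 2 - 4 * ecb != 0 }.

Section PointGroup.
Variables (K : fieldType) (E : ecurve K).
Let D := ecD E. Let a := eca E. Let b := ecb E.

Record ecpt := EcPt { ecval : option (K * K); ecvalP : on_curve D a b ecval }.
HB.instance Definition _ := [isSub for ecval].
HB.instance Definition _ := [Choice of ecpt by <:].

Definition ecpt0 := @EcPt None isT.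
Definition ecpt_opp (P : ecpt) := EcPt (on_curve_opp (ecvalP P)).
Definition ecpt_add (P Q : ecpt) :=
  EcPt (on_curve_add (ec2_neq0 E) (ecD_neq0 E) (ecvalP P) (ecvalP Q)).

Fact ecpt_addA : associative ecpt_add.
Proof.
move=> P Q R; apply: val_inj; symmetry.
exact: (add_ptA (ec2_neq0 E) (ecD_neq0 E) (ecb_neq0 E) (ecdisc_neq0 E)
  (ecvalP P) (ecvalP Q) (ecvalP R)).
Qed.

Fact ecpt_addC : commutative ecpt_add.
Proof.
move=> P Q; apply: val_inj.
exact: (add_ptC (ec2_neq0 E) (ecD_neq0 E) (ecb_neq0 E) (ecdisc_neq0 E)
  (ecvalP P) (ecvalP Q)).
Qed.

Fact ecpt_add0 : left_id ecpt0 ecpt_add. Proof. by move=> P; apply: val_inj. Qed.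

Fact ecpt_addN : left_inverse ecpt0 ecpt_opp ecpt_add.
Proof. by move=> P; rewrite ecpt_addC; apply: val_inj; exact: add_pt_opp. Qed.

HB.instance Definition _ := GRing.isZmodule.Build ecpt ecpt_addA ecpt_addC ecpt_add0 ecpt_addN.

Lemma ecval_add (P Q : ecpt) : ecval (P + Q) = add_pt D a b (ecval P) (ecval Q).
Proof. by []. Qed.
Lemma ecval_opp (P : ecpt) : ecval (- P) = opp_pt (ecval P).
Proof. by []. Qed.
End PointGroup.

(** * Heights over a rational function field *)

Ltac sizelia :=
  repeat match goal with H : context [@size _ _] |- _ => revert H end;
  repeat match goal with
  | |- context [@size ?T ?s] => let n := fresh "n" in move: (@size T s) => n
  end; lia.

Section Height.
Variables (F K : fieldType) (tf : {rmorphism {poly F} -> K}).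
Hypotheses (tf_inj : injective tf)
  (tf_surj : forall x, exists u v : {poly F}, v != 0 /\ x = tf u / tf v).

Lemma tf_eq0 u : (tf u == 0) = (u == 0).
Proof. by rewrite -(inj_eq tf_inj) rmorph0. Qed.

Fact reduced_fraction x : exists uv : {poly F} * {poly F},
  [&& uv.2 != 0, coprimep uv.1 uv.2 & x * tf uv.2 == tf uv.1].
Proof.
have [u [v [v0 ->]]] := tf_surj x.
have g0 : gcdp u v != 0 by rewrite gcdp_eq0 negb_and v0 orbT.
have : coprimep (u %/ gcdp u v) (v %/ gcdp u v) by rewrite coprimep_div_gcd ?v0 ?orbT.
have eu := divpK (dvdp_gcdl u v); have ev := divpK (dvdp_gcdr u v).
move: (u %/ _) (v %/ _) eu ev g0 => u1 v1; move: (gcdp u v) => d eu ev d0 cop.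
rewrite -{}eu -ev in v0 *; exists (u1, v1).
have v10 : v1 != 0 by apply: contraNneq v0 => ->; rewrite mul0r.
rewrite /= v10 cop !rmorphM /=; apply/eqP; field.
by rewrite !tf_eq0 d0 v10.
Qed.

Definition fnum x := (xchoose (reduced_fraction x)).1.
Definition fden x := (xchoose (reduced_fraction x)).2.

Lemma fden_neq0 x : fden x != 0.
Proof. by case/and3P: (xchooseP (reduced_fraction x)). Qed.

Lemma coprime_numden x : coprimep (fnum x) (fden x).
Proof. by case/and3P: (xchooseP (reduced_fraction x)). Qed.

Lemma fnumE x : x * tf (fden x) = tf (fnum x).
Proof. by case/and3P: (xchooseP (reduced_fraction x)) => _ _ /eqP. Qed.

Lemma fracE x : x = tf (fnum x) / tf (fden x).
Proof. by rewrite -fnumE mulfK // tf_eq0 fden_neq0. Qed.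

Lemma frac_factor x u v : v != 0 -> x * tf v = tf u ->
  exists w, [/\ w != 0, u = fnum x * w & v = fden x * w].
Proof.
move=> v0 e; have e1 : fnum x * v = u * fden x.
  by apply: tf_inj; rewrite !rmorphM -fnumE -e; ring.
have /dvdpP[w ew] : fden x %| v.
  rewrite -(Gauss_dvdpr _ (_ : coprimep (fden x) (fnum x))) ?e1 ?dvdp_mull //.
  by rewrite coprimep_sym coprime_numden.
exists w; split; last by rewrite ew mulrC.
  by apply: contraNneq v0 => w0; rewrite ew w0 mul0r.
by apply: (mulIf (fden_neq0 x)); rewrite -e1 ew; ring.
Qed.

(** As [size] is the degree plus one, this is the degree of x as a map of the projective line to
    itself; [pole] says that the map fixes infinity. *)
Definition ht x := (maxn (size (fnum x)) (size (fden x))).-1.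
Definition pole x := (size (fden x) < size (fnum x))%N.

Lemma frac_coprime x u v : v != 0 -> coprimep u v -> x * tf v = tf u ->
  size (fnum x) = size u /\ size (fden x) = size v.
Proof.
move=> v0 cop /(frac_factor v0) [w [w0 eu ev]].
have sw : size w = 1%N.
  apply/eqP; rewrite -coprimepp; move: cop; rewrite eu ev coprimepMl !coprimepMr.
  by case/andP=> _ /andP[].
have /size_poly1P[c c0 ew] : size w == 1%N by rewrite sw.
by rewrite eu ev ew ![_ * c%:P]mulrC !mul_polyC !size_scale.
Qed.

Lemma ht_le x u v n : v != 0 -> x * tf v = tf u -> (size u <= n.+1)%N ->
  (size v <= n.+1)%N -> (ht x <= n)%N.
Proof.
move=> v0 /(frac_factor v0) [w [w0 -> ->]] su sv.
have d0 := fden_neq0 x; have s0 : (0 < size (fden x))%N by rewrite size_poly_gt0.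
have w1 : (0 < size w)%N by rewrite size_poly_gt0.
rewrite size_mul // in sv; rewrite /ht.
have [n0 | n0] := eqVneq (fnum x) 0; first by rewrite n0 size_poly0 max0n; sizelia.
by rewrite size_mul // in su; sizelia.
Qed.

(** Gauss's lemma: the quadratic G0 T^2 - G1 T + G2 with roots x = e/g and y = h/k is a multiple of
    (g T - e)(k T - h), whose factors are primitive. *)
Lemma pair_factor x y G0 G1 G2 : G0 != 0 -> (x + y) * tf G0 = tf G1 ->
  x * y * tf G0 = tf G2 -> exists r, [/\ r != 0, G0 = fden x * fden y * r,
    G1 = (fnum x * fden y + fden x * fnum y) * r & G2 = fnum x * fnum y * r].
Proof.
move=> G00 e1 e2; set e := fnum x; set g := fden x; set h := fnum y; set k := fden y.
have [g0 k0] : g != 0 /\ k != 0 by rewrite !fden_neq0.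
have cg : coprimep g e by rewrite coprimep_sym coprime_numden.
have root : G0 * e ^+ 2 = g * (G1 * e - G2 * g).
  apply: tf_inj; rewrite !(rmorphM, rmorphB, rmorphXn) /= -fnumE -/g -e1 -e2.
  by ring.
have /dvdpP[w ew] : g %| G0.
  by rewrite -(Gauss_dvdpl _ (_ : coprimep g (e ^+ 2))) ?coprimep_expr // root dvdp_mulr.
have w0 : w != 0 by apply: contraNneq G00 => w0; rewrite ew w0 mul0r.
have ez : (tf w * y) * tf g = tf (G1 - w * e).
  rewrite rmorphB rmorphM -e1 ew rmorphM /e -fnumE -/g; ring.
have /dvdpP[z ez'] : g %| G1 - w * e.
  rewrite -(Gauss_dvdpl _ cg); have -> : (G1 - w * e) * e = g * G2.
    apply: (mulfI g0); transitivity (g * (G1 * e) - w * g * e ^+ 2); first by ring.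
    by rewrite -ew root; ring.
  exact: dvdp_mulr.
have ey : y * tf w = tf z.
  have tg0 : tf g != 0 by rewrite tf_eq0.
  by apply: (mulIf tg0); rewrite -[RHS]rmorphM -ez' -ez; ring.
have [r [r0 ez2 ew2]] := frac_factor w0 ey; exists r; split => //.
- by rewrite ew ew2 -/k; ring.
- rewrite -[LHS](subrK (w * e)) ez' ez2 ew2 -/k -/h; ring.
apply: tf_inj; rewrite -e2 ew ew2 !rmorphM /e /h -!fnumE -/g -/k; ring.
Qed.

(** One coefficient of (g T - e)(k T - h) has degree [ht x + ht y]: g k if neither x nor y has a
    pole at infinity, e h if both have one, the middle coefficient otherwise. *)
Lemma pair_height x y G0 G1 G2 n : G0 != 0 -> (x + y) * tf G0 = tf G1 ->
  x * y * tf G0 = tf G2 ->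
  (size G0 <= n.+1)%N -> (size G1 <= n.+1)%N -> (size G2 <= n.+1)%N ->
  (ht x + ht y <= n)%N.
Proof.
move=> G00 e1 e2; have [r [r0 -> -> ->]] := pair_factor G00 e1 e2.
rewrite /ht; set e := fnum x; set g := fden x; set h := fnum y; set k := fden y.
have [g0 k0] : g != 0 /\ k != 0 by rewrite !fden_neq0.
have sr : (0 < size r)%N by rewrite size_poly_gt0.
have le u : (size (u * r)%R <= n.+1)%N -> (size u <= n.+1)%N.
  have [-> | u0] := eqVneq u 0; first by rewrite size_poly0.
  by rewrite size_mul //; sizelia.
move=> /le s0 /le s1 /le s2.
have sg : (0 < size g)%N by rewrite size_poly_gt0.
have sk : (0 < size k)%N by rewrite size_poly_gt0.
have [ge | ge] := leqP (size e) (size g); have [kh | kh] := leqP (size h) (size k).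
- by rewrite size_mul // in s0; sizelia.
- have h0 : h != 0 by rewrite -size_poly_gt0; sizelia.
  have : (size (e * k)%R < size (g * h)%R)%N.
    rewrite [X in (_ < X)%N]size_mul //; have [-> | e0] := eqVneq e 0; first by rewrite mul0r size_poly0; sizelia.
    have : (0 < size e)%N by rewrite size_poly_gt0.
    by rewrite size_mul //; sizelia.
  by move=> lt; rewrite addrC size_polyDl // size_mul // in s1; sizelia.
- have e0 : e != 0 by rewrite -size_poly_gt0; sizelia.
  have : (size (g * h)%R < size (e * k)%R)%N.
    rewrite [X in (_ < X)%N]size_mul //; have [-> | h0] := eqVneq h 0; first by rewrite mulr0 size_poly0; sizelia.
    have : (0 < size h)%N by rewrite size_poly_gt0.
    by rewrite size_mul //; sizelia.
  by move=> lt; rewrite size_polyDl // size_mul // in s1; sizelia.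
have e0 : e != 0 by rewrite -size_poly_gt0; sizelia.
have h0 : h != 0 by rewrite -size_poly_gt0; sizelia.
by rewrite size_mul // in s2; sizelia.
Qed.

Lemma pair_pole x y G0 G1 G2 : G0 != 0 -> (x + y) * tf G0 = tf G1 ->
  x * y * tf G0 = tf G2 ->
  (size G0 < size G2)%N -> (size G1 < size G2)%N -> pole x && pole y.
Proof.
move=> G00 e1 e2; have [r [r0 -> -> ->]] := pair_factor G00 e1 e2.
rewrite /pole; set e := fnum x; set g := fden x; set h := fnum y; set k := fden y.
have [g0 k0] : g != 0 /\ k != 0 by rewrite !fden_neq0.
have sr : (0 < size r)%N by rewrite size_poly_gt0.
have lt u v : v != 0 -> (size (u * r)%R < size (v * r)%R)%N -> (size u < size v)%N.
  move=> v0; have [-> | u0] := eqVneq u 0; first by rewrite size_poly0 size_poly_gt0.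
  by rewrite !size_mul //; sizelia.
have [-> | e0] := eqVneq e 0; first by rewrite !mul0r size_poly0 ltn0.
have [-> | h0] := eqVneq h 0; first by rewrite !mulr0 !mul0r size_poly0 ltn0.
have eh0 : e * h != 0 by rewrite mulf_neq0.
move=> /(lt _ _ eh0) s0 /(lt _ _ eh0) s1.
have [se sh] : (0 < size e)%N /\ (0 < size h)%N by rewrite !size_poly_gt0.
have [sg sk] : (0 < size g)%N /\ (0 < size k)%N by rewrite !size_poly_gt0.
rewrite !size_mul // in s0.
have [ge | ge] := leqP (size e) (size g); have [kh | kh] //= := leqP (size h) (size k).
- by exfalso; sizelia.
- exfalso; rewrite addrC size_polyDl !size_mul // in s1; sizelia.
exfalso; rewrite size_polyDl !size_mul // in s1; sizelia.
Qed.
End Height.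

Lemma coefM_top (R : nzRingType) (u v : {poly R}) m n :
  (size u <= m.+1)%N -> (size v <= n.+1)%N -> (u * v)`_(m + n) = u`_m * v`_n.
Proof.
move=> su sv; rewrite coefM.
have mP : (m < (m + n).+1)%N by rewrite ltnS leq_addr.
rewrite (bigD1 (Ordinal mP)) //= addKn big1 ?addr0 // => i; rewrite -val_eqE /= => im.
have [lt | gt] := ltnP m i; first by rewrite nth_default ?mul0r //; apply: leq_trans su lt.
by rewrite [v`_ _]nth_default ?mulr0 //; apply: leq_trans sv _; have := ltn_ord i; lia.
Qed.

Lemma size_mul_top (R : nzRingType) (u v : {poly R}) m n :
  (size u <= m.+1)%N -> (size v <= n.+1)%N -> (size (u * v)%R <= (m + n).+1)%N.
Proof. by move=> su sv; apply: leq_trans (size_polyMleq _ _) _; sizelia. Qed.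

Lemma size_add_le (R : nzRingType) (s t : {poly R}) k :
  (size s <= k)%N -> (size t <= k)%N -> (size (s + t)%R <= k)%N.
Proof. by move=> h1 h2; apply: leq_trans (size_polyD _ _) _; rewrite geq_max h1. Qed.

Lemma size_scale_le (R : nzRingType) (c : R) (s : {poly R}) k :
  (size s <= k)%N -> (size (c *: s) <= k)%N.
Proof. exact: leq_trans (size_scale_leq _ _). Qed.

(** * The duplication formula and its degree *)

Section Doubling.
Variables (F : fieldType) (a b : F).
Hypotheses (two0 : 2 != 0 :> F) (b0 : b != 0) (disc0 : a ^+ 2 - 4 * b != 0).

Lemma dup_resultant (c d : F) : (c ^+ 2 - b * d ^+ 2) ^+ 2 = 0 ->
  4 * c * d * (c ^+ 2 + a * c * d + b * d ^+ 2) = 0 -> c = 0 /\ d = 0.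
Proof.
move=> /eqP; rewrite expf_eq0 /= subr_eq0 => /eqP e1 e2.
have four0 : 4 != 0 :> F by rewrite (_ : 4 = 2 * 2) ?mulf_neq0 //; ring.
have [d0 | d0] := eqVneq d 0.
  have /eqP : c * c = 0 by rewrite -expr2 e1 d0 expr2 !mulr0.
  by rewrite mulf_eq0 orbb => /eqP.
have c0 : c != 0.
  apply/negP => /eqP c0; move/eqP: e1; rewrite c0 expr0n eq_sym mulf_eq0 expf_eq0 /=.
  by rewrite (negPf b0) (negPf d0).
move/eqP: e2; rewrite !mulf_eq0 (negPf four0) (negPf c0) (negPf d0) /= => /eqP e2.
have e3 : a * c = - (2 * b * d).
  apply: (mulIf d0); rewrite -[LHS]subr0 -e2 e1; ring.
have /eqP : (a ^+ 2 - 4 * b) * (b * d ^+ 2) = 0.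
  by rewrite -e1; transitivity ((a * c) ^+ 2 - 4 * b * c ^+ 2); [|rewrite e3 e1]; ring.
by rewrite !mulf_eq0 (negPf disc0) (negPf b0) (negPf d0).
Qed.

Variables (u v : {poly F}).
Hypotheses (cop : coprimep u v) (v0 : v != 0).

(** The duplication formula x(2P) = (x^2 - b)^2 / (4 (x^3 + a x^2 + b x)), made homogeneous with x =
    u / v; the twisting factor D has cancelled. *)
Definition dup_num := (u ^+ 2 - b *: v ^+ 2) ^+ 2.
Definition dup_den := 4 *: (u * v) * (u ^+ 2 + a *: (u * v) + b *: v ^+ 2).

(** Modulo u^2 - b v^2 the last factor of [dup_den] is v (a u + 2 b v), and (a u - 2 b v)(a u + 2 b
    v) is b (a^2 - 4 b) v^2. *)
Lemma dup_coprime : coprimep dup_num dup_den.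
Proof.
have four0 : 4 != 0 :> F by rewrite (_ : 4 = 2 * 2) ?mulf_neq0 //; ring.
have cop' : coprimep v u by rewrite coprimep_sym.
rewrite /dup_num /dup_den coprimep_expl //; set w := _ - _.
have cu : coprimep w u.
  rewrite coprimep_sym /w expr2 coprimep_addl_mul -scaleNr coprimepZr ?oppr_eq0 //.
  exact: coprimep_expr.
have cv : coprimep w v.
  rewrite coprimep_sym /w addrC expr2 -scaleNr scalerAl coprimep_addl_mul.
  exact: coprimep_expr.
rewrite -scalerAl coprimepZr // !coprimepMr cu cv /=.
have -> : u ^+ 2 + a *: (u * v) + b *: v ^+ 2 = 1 * w + (a *: u + (2 * b) *: v) * v.
  by rewrite /w -!mul_polyC polyCM; ring.
rewrite coprimep_addl_mul coprimepMr cv andbT.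
suff : coprimep w ((a *: u - (2 * b) *: v) * (a *: u + (2 * b) *: v)).
  by rewrite coprimepMr => /andP[].
have -> : (a *: u - (2 * b) *: v) * (a *: u + (2 * b) *: v) =
    (a ^+ 2)%:P * w + (b * (a ^+ 2 - 4 * b)) *: v ^+ 2.
  by rewrite /w -!mul_polyC !(polyCM, polyC_exp, polyCB); ring.
by rewrite coprimep_addl_mul coprimepZr ?mulf_neq0 // coprimep_expr.
Qed.

(** Both are forms of degree 4 in u and v without common zero. By [dup_resultant] at the top
    coefficients of u and v, they do not both drop in degree. *)
Lemma dup_sizes : (maxn (size dup_num) (size dup_den)).-1 = (4 * (maxn (size u) (size v)).-1)%N.
Proof.
have [m em] : exists m, (maxn (size u) (size v)).-1 = m by exists (maxn (size u) (size v)).-1.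
rewrite em; have sv0 : (0 < size v)%N by rewrite size_poly_gt0.
have su : (size u <= m.+1)%N by sizelia.
have sv : (size v <= m.+1)%N by sizelia.
have tops : u`_m != 0 \/ v`_m != 0.
  have [lt | ge] := ltnP (size v) (size u).
    left; have -> : m = (size u).-1 by sizelia.
    by rewrite -/(lead_coef u) lead_coef_eq0 -size_poly_gt0; sizelia.
  right; have -> : m = (size v).-1 by sizelia.
  by rewrite -/(lead_coef v) lead_coef_eq0.
have suu := size_mul_top su su; have svv := size_mul_top sv sv; have suv := size_mul_top su sv.
have sadd := @size_add_le F; have sZ := @size_scale_le F.
have sw : (size (u ^+ 2 - b *: v ^+ 2)%R <= (m + m).+1)%N.
  by rewrite !expr2 -scaleNr; apply: (sadd) => //; apply: (sZ).
have sq : (size (u ^+ 2 + a *: (u * v) + b *: v ^+ 2)%R <= (m + m).+1)%N.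
  by rewrite !expr2; apply: (sadd); [apply: (sadd) => //|]; apply: (sZ).
have s4 := sZ 4 _ _ suv.
have sN : (size dup_num <= (m + m + (m + m)).+1)%N by rewrite /dup_num expr2 size_mul_top.
have sD : (size dup_den <= (m + m + (m + m)).+1)%N by rewrite /dup_den size_mul_top.
have cN : dup_num`_(m + m + (m + m)) = (u`_m ^+ 2 - b * v`_m ^+ 2) ^+ 2.
  rewrite /dup_num expr2 (coefM_top sw sw) -expr2; congr (_ ^+ 2).
  by rewrite coefB coefZ !expr2 !coefM_top.
have cD : dup_den`_(m + m + (m + m)) =
    4 * u`_m * v`_m * (u`_m ^+ 2 + a * u`_m * v`_m + b * v`_m ^+ 2).
  rewrite /dup_den (coefM_top s4 sq) !(coefD, coefZ) !expr2 !coefM_top //; ring.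
have ge : (m + m + (m + m) < maxn (size dup_num) (size dup_den))%N.
  rewrite ltnNge geq_max; apply/negP => /andP[h1 h2].
  have [] := @dup_resultant u`_m v`_m.
  - by rewrite -cN nth_default.
  - by rewrite -cD nth_default.
  by move=> e1 e2; case: tops; rewrite ?e1 ?e2 eqxx.
by move: ge sN sD; clear; sizelia.
Qed.

Lemma dup_pole : (size v < size u)%N -> (size dup_den < size dup_num)%N.
Proof.
move=> lt; have sv0 : (0 < size v)%N by rewrite size_poly_gt0.
have u0 : u != 0 by rewrite -size_poly_gt0; sizelia.
have su2 : size (u * u)%R = (size u + size u).-1 by rewrite size_mul.
have sw : size (u ^+ 2 - b *: v ^+ 2)%R = (size u + size u).-1.
  rewrite -su2 !expr2 size_polyDl // -scaleNr size_scale ?oppr_eq0 // su2 size_mul //.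
  by sizelia.
have w0 : u ^+ 2 - b *: v ^+ 2 != 0 by rewrite -size_poly_gt0 sw; sizelia.
have -> : size dup_num = ((size u + size u).-1 + (size u + size u).-1).-1.
  by rewrite /dup_num expr2 size_mul // sw.
have sq : (size (u ^+ 2 + a *: (u * v) + b *: v ^+ 2)%R <= (size u + size u).-1)%N.
  apply: leq_trans (size_polyD _ _) _; rewrite geq_max; apply/andP; split.
    apply: leq_trans (size_polyD _ _) _; rewrite geq_max expr2 su2 leqnn /=.
    by apply: leq_trans (size_scale_leq _ _) _; rewrite size_mul //; sizelia.
  by apply: leq_trans (size_scale_leq _ _) _; rewrite expr2 size_mul //; sizelia.
have s4 := size_scale_leq 4 (u * v)%R; rewrite (size_mul u0 v0) in s4.
apply: leq_ltn_trans (size_polyMleq _ _) _.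
by move: lt sv0 sq s4; clear; sizelia.
Qed.
End Doubling.

(** * The degree of the abscissa as a quadratic form *)

Section PointHeight.
Variables (F K : fieldType) (tf : {rmorphism {poly F} -> K}).
Hypotheses (tf_inj : injective tf)
  (tf_surj : forall x, exists u v : {poly F}, v != 0 /\ x = tf u / tf v).
Variables (a b : F) (E : ecurve K).
Hypotheses (two0 : 2 != 0 :> F) (b0 : b != 0) (disc0 : a ^+ 2 - 4 * b != 0).
Hypotheses (aE : eca E = tf a%:P) (bE : ecb E = tf b%:P).

Local Notation ht := (ht tf_inj tf_surj).
Local Notation pole := (pole tf_inj tf_surj).
Local Notation num := (fnum tf_inj tf_surj).
Local Notation den := (fden tf_inj tf_surj).

Definition hpt (P : ecpt E) := if ecval P is Some (x, _) then ht x else 0%N.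
(** Counting the origin among the points with a pole at t = infinity makes the set closed under
    addition and subtraction. *)
Definition polept (P : ecpt E) := if ecval P is Some (x, _) then pole x else true.

Lemma size_num x : (size (num x) <= (ht x).+1)%N.
Proof. by have := fden_neq0 tf_inj tf_surj x; rewrite /ht -size_poly_gt0; sizelia. Qed.

Lemma size_den x : (size (den x) <= (ht x).+1)%N.
Proof. by have := fden_neq0 tf_inj tf_surj x; rewrite /ht -size_poly_gt0; sizelia. Qed.

Lemma hpt0 : hpt 0 = 0%N. Proof. by []. Qed.

Lemma hptN P : hpt (- P) = hpt P.
Proof. by rewrite /hpt ecval_opp; case: (ecval P) => [[]|]. Qed.

Lemma poleptN P : polept (- P) = polept P.
Proof. by rewrite /polept ecval_opp; case: (ecval P) => [[]|]. Qed.

Lemma curve_eq (P : ecpt E) x y : ecval P = Some (x, y) ->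
  ecD E * y ^+ 2 = cubic (tf a%:P) (tf b%:P) x.
Proof. by move=> e; have := ecvalP P; rewrite e /= aE bE => /eqP. Qed.

Lemma two0K : 2 != 0 :> K. Proof. exact: ec2_neq0 E. Qed.

Lemma tf_dup_num x : tf (dup_num b (num x) (den x)) =
  (x ^+ 2 - tf b%:P) ^+ 2 * tf (den x) ^+ 4.
Proof.
rewrite /dup_num -!mul_polyC !(rmorphXn, rmorphB, rmorphM) /= -fnumE; ring.
Qed.

Lemma tf_dup_den x : tf (dup_den a b (num x) (den x)) =
  4 * cubic (tf a%:P) (tf b%:P) x * tf (den x) ^+ 4.
Proof.
rewrite /dup_den /cubic -!mul_polyC !(rmorphXn, rmorphD, rmorphM) /= -fnumE.
by rewrite polyC1 rmorph1; ring.
Qed.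

Lemma double_opp (P : ecpt E) x y : ecval P = Some (x, y) -> y = 0 -> P + P = 0.
Proof.
by move=> e y0; apply: val_inj; rewrite /= e /= eqxx y0 oppr0 eqxx.
Qed.

Lemma double_val (P : ecpt E) x y : ecval P = Some (x, y) -> y != 0 ->
  exists x' y', [/\ ecval (P + P) = Some (x', y'), dup_den a b (num x) (den x) != 0 &
    x' * tf (dup_den a b (num x) (den x)) = tf (dup_num b (num x) (den x))].
Proof.
move=> e y0; have ce := curve_eq e; have D0 := ecD_neq0 E.
have four0 : 4 != 0 :> K by rewrite (_ : 4 = 2 * 2) ?mulf_neq0 ?two0K //; ring.
have N : (y == - y) = false.
  by rewrite -addr_eq0 -mulr2n -mulr_natl mulf_eq0 (negPf two0K) (negPf y0).
have td0 : tf (den x) != 0 by rewrite (tf_eq0 tf_inj) fden_neq0.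
have dd0 : dup_den a b (num x) (den x) != 0.
  by rewrite -(tf_eq0 tf_inj) tf_dup_den -ce; do !apply: mulf_neq0 => //; apply: expf_neq0.
rewrite ecval_add e /= eqxx N /=; eexists; eexists; split=> //.
rewrite tf_dup_den tf_dup_num mulrA; congr (_ * _).
rewrite /slope eqxx aE bE; move: ce; move: (tf a%:P) (tf b%:P) (ecD E) D0 => a' b' D D0 ce.
transitivity ((3 * x ^+ 2 + 2 * a' * x + b') ^+ 2 * (cubic a' b' x / (D * y ^+ 2)) -
  (a' + 2 * x) * (4 * cubic a' b' x)).
  by field; rewrite y0 D0 two0K.
rewrite -ce divff ?mulf_neq0 ?expf_neq0 // ce /cubic; ring.
Qed.

Lemma hpt_double P : hpt (P + P) = (4 * hpt P)%N.
Proof.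
rewrite {2}/hpt; case e: (ecval P) => [[x y]|]; last first.
  by rewrite (_ : P = 0) ?addr0 ?hpt0 //; apply: val_inj; exact: e.
have cop := coprime_numden tf_inj tf_surj x; have d0 := fden_neq0 tf_inj tf_surj x.
rewrite -(dup_sizes two0 b0 disc0 cop d0).
have dcop := dup_coprime two0 b0 disc0 cop.
have [y0 | y0] := eqVneq y 0.
  rewrite (double_opp e y0) hpt0.
  have dd0 : dup_den a b (num x) (den x) = 0.
    apply: tf_inj; rewrite tf_dup_den -(curve_eq e) y0 expr0n /= !mulr0 mul0r rmorph0 //.
  by move: dcop; rewrite dd0 coprimep0 -size_poly_eq1 size_poly0 maxn0 => /eqP ->.
have [x' [y' [e' dd0 ex']]] := double_val e y0.
by rewrite /hpt e' /ht; have [-> ->] := frac_coprime tf_inj tf_surj dd0 dcop ex'.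
Qed.

Lemma polept_double P : polept P -> polept (P + P).
Proof.
rewrite {1}/polept; case e: (ecval P) => [[x y]|]; last first.
  by rewrite (_ : P = 0) ?addr0 //; apply: val_inj; exact: e.
have cop := coprime_numden tf_inj tf_surj x; have d0 := fden_neq0 tf_inj tf_surj x.
have dcop := dup_coprime two0 b0 disc0 cop.
have [y0 | y0] := eqVneq y 0; first by rewrite (double_opp e y0).
have [x' [y' [e' dd0 ex']]] := double_val e y0.
rewrite /polept e' /pole; have [-> ->] := frac_coprime tf_inj tf_surj dd0 dcop ex'.
exact: dup_pole.
Qed.

(* Numerators and denominator of the symmetric functions of x(P + Q), x(P - Q)
   in terms of x(P) = u1 / v1 and x(Q) = u2 / v2. *)
Definition sym0 (u1 v1 u2 v2 : {poly F}) := (u1 * v2 - u2 * v1) ^+ 2.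
Definition sym1 (u1 v1 u2 v2 : {poly F}) :=
  2 *: (u1 * u2 * (u1 * v2 + u2 * v1) + (2 * a) *: ((u1 * v1) * (u2 * v2))
        + b *: (v1 * v2 * (u1 * v2 + u2 * v1))).
Definition sym2 (u1 v1 u2 v2 : {poly F}) := (u1 * u2 - b *: (v1 * v2)) ^+ 2.

Lemma sym_sizes (u1 v1 u2 v2 : {poly F}) m1 m2 :
  (size u1 <= m1.+1)%N -> (size v1 <= m1.+1)%N -> (size u2 <= m2.+1)%N -> (size v2 <= m2.+1)%N ->
  let n := (2 * m1 + 2 * m2).+1 in
  [/\ (size (sym0 u1 v1 u2 v2) <= n)%N, (size (sym1 u1 v1 u2 v2) <= n)%N &
      (size (sym2 u1 v1 u2 v2) <= n)%N].
Proof.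
move=> su1 sv1 su2 sv2; have s12 := size_mul_top su1 sv2; have s21 := size_mul_top su2 sv1.
have svv := size_mul_top sv1 sv2; have suu := size_mul_top su1 su2.
have suv1 := size_mul_top su1 sv1; have suv2 := size_mul_top su2 sv2.
rewrite (addnC m2) in s21; have sadd := @size_add_le F; have sZ := @size_scale_le F.
have -> : (2 * m1 + 2 * m2 = m1 + m2 + (m1 + m2))%N by lia.
split.
- by rewrite /sym0 expr2; apply: size_mul_top; apply: (sadd); rewrite ?size_polyN.
- rewrite /sym1; apply: (sZ); apply: (sadd); [apply: (sadd) |].
  + by apply: size_mul_top => //; apply: (sadd).
  + apply: (sZ); rewrite (_ : m1 + m2 + (m1 + m2) = m1 + m1 + (m2 + m2))%N; last by lia.
    exact: size_mul_top.
  by apply: (sZ); apply: size_mul_top => //; apply: (sadd).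
by rewrite /sym2 expr2; apply: size_mul_top; apply: (sadd); rewrite ?size_polyN //; apply: (sZ).
Qed.

Lemma addsub_val (P Q : ecpt E) x1 y1 x2 y2 : ecval P = Some (x1, y1) ->
  ecval Q = Some (x2, y2) -> x1 != x2 -> exists x3 y3 x4 y4,
  [/\ ecval (P + Q) = Some (x3, y3), ecval (P - Q) = Some (x4, y4),
   sym0 (num x1) (den x1) (num x2) (den x2) != 0,
   (x3 + x4) * tf (sym0 (num x1) (den x1) (num x2) (den x2)) =
     tf (sym1 (num x1) (den x1) (num x2) (den x2)) &
   (x3 * x4) * tf (sym0 (num x1) (den x1) (num x2) (den x2)) =
     tf (sym2 (num x1) (den x1) (num x2) (den x2))].
Proof.
move=> e1 e2 x12; have ce1 := curve_eq e1; have ce2 := curve_eq e2.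
rewrite !ecval_add ecval_opp e1 e2 /= (negPf x12) /=.
eexists; eexists; eexists; eexists; split; [by [] | by [] | | |].
- rewrite /sym0 expf_neq0 // -(tf_eq0 tf_inj) rmorphB !rmorphM -!fnumE.
  rewrite (_ : _ - _ = (x1 - x2) * tf (den x1) * tf (den x2)); last by ring.
  by rewrite !mulf_neq0 ?subr_eq0 // (tf_eq0 tf_inj) fden_neq0.
- rewrite /slope (negPf x12) aE /sym0 /sym1 -!mul_polyC polyCM polyC_natr.
  rewrite !(rmorphXn, rmorphB, rmorphD, rmorphM, rmorph1) -!fnumE.
  move: ce1 ce2; move: (tf (den x1)) (tf (den x2)) (tf a%:P) (tf b%:P) (ecD E) => d1 d2 a' b' D ce1 ce2.
  transitivity ((2 * (D * y1 ^+ 2 + D * y2 ^+ 2) - 2 * (a' + x1 + x2) * (x1 - x2) ^+ 2) * (d1 * d2) ^+ 2).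
    by field; rewrite subr_eq0 eq_sym.
  by rewrite ce1 ce2 /cubic; ring.
rewrite /slope (negPf x12) aE /sym0 /sym2 -!mul_polyC !(rmorphXn, rmorphB, rmorphD, rmorphM) -!fnumE.
move: ce1 ce2; move: (tf (den x1)) (tf (den x2)) (tf a%:P) (tf b%:P) (ecD E) => d1 d2 a' b' D ce1 ce2.
have d0 : (x1 - x2) ^+ 2 != 0 by rewrite expf_neq0 // subr_eq0.
apply: (mulfI d0).
transitivity (((D * y1 ^+ 2 + D * y2 ^+ 2 - (a' + x1 + x2) * (x1 - x2) ^+ 2) ^+ 2 -
    4 * (D * y1 ^+ 2) * (D * y2 ^+ 2)) * (d1 * d2) ^+ 2).
  by field; rewrite subr_eq0 eq_sym.
by rewrite ce1 ce2 /cubic; ring.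
Qed.

Lemma same_abscissa (P Q : ecpt E) x y1 y2 : ecval P = Some (x, y1) ->
  ecval Q = Some (x, y2) -> Q = P \/ Q = - P.
Proof.
move=> e1 e2; have := curve_eq e1; rewrite -(curve_eq e2) => /(mulfI (ecD_neq0 E)) /eqP.
rewrite eqf_sqr => /orP[] /eqP ey; [left | right]; apply: val_inj.
  by rewrite /= e1 e2 ey.
by rewrite /= e1 e2 ey /= opprK.
Qed.

(** The symmetric functions of x(P + Q) and x(P - Q) are quotients of forms of bidegree (2, 2) in
    the numerators and denominators; equal abscissae reduce to duplication. *)
Lemma hpt_addsub_le (P Q : ecpt E) : (hpt (P + Q)%R + hpt (P - Q)%R <= 2 * hpt P + 2 * hpt Q)%N.
Proof.
have pt0 R : ecval R = None -> R = 0 :> ecpt E by move=> e; apply: val_inj.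
case eP: (ecval P) => [[x1 y1]|]; last first.
  by rewrite (pt0 _ eP) add0r sub0r hptN hpt0; lia.
case eQ: (ecval Q) => [[x2 y2]|]; last first.
  by rewrite (pt0 _ eQ) addr0 subr0 hpt0; lia.
have [x12 | x12] := eqVneq x1 x2.
  subst x2; have [-> | ->] := same_abscissa eP eQ.
    by rewrite subrr hpt0 hpt_double; lia.
  by rewrite subrr opprK hpt0 hptN hpt_double; lia.
have [x3 [y3 [x4 [y4 [e3 e4 G0 e5 e6]]]]] := addsub_val eP eQ x12.
rewrite /hpt eP eQ e3 e4 /=; apply: (pair_height tf_inj tf_surj G0 e5 e6).
all: by have [] := sym_sizes (size_num x1) (size_den x1) (size_num x2) (size_den x2).
Qed.

(** The reverse inequality is the first one for P + Q and P - Q, whose sum and difference 2 P and 2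
    Q have four times the heights of P and Q. *)
Lemma hpt_addsub (P Q : ecpt E) : (hpt (P + Q)%R + hpt (P - Q)%R = 2 * hpt P + 2 * hpt Q)%N.
Proof.
apply/eqP; rewrite eqn_leq hpt_addsub_le /=.
have := hpt_addsub_le (P + Q) (P - Q).
have -> : P + Q + (P - Q) = P + P by rewrite addrACA subrr addr0.
have -> : P + Q - (P - Q) = Q + Q by rewrite opprB addrC addrA subrK.
by rewrite !hpt_double; lia.
Qed.

Lemma polept_addsub P Q : polept P -> polept Q -> polept (P + Q) && polept (P - Q).
Proof.
have pt0 R : ecval R = None -> R = 0 :> ecpt E by move=> e; apply: val_inj.
case eP: (ecval P) => [[x1 y1]|]; last first.
  by rewrite (pt0 _ eP) add0r sub0r poleptN => _ ->.
case eQ: (ecval Q) => [[x2 y2]|]; last first.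
  by rewrite (pt0 _ eQ) addr0 subr0 => ->.
have [x12 | x12] := eqVneq x1 x2.
  subst x2; have [-> | ->] := same_abscissa eP eQ => h _.
    by rewrite subrr polept_double.
  by rewrite subrr opprK polept_double.
have [x3 [y3 [x4 [y4 [e3 e4 G0 e5 e6]]]]] := addsub_val eP eQ x12.
rewrite /polept eP eQ e3 e4 => p1 p2; 
move: p1 p2; rewrite /pole => p1 p2.
have d1 := fden_neq0 tf_inj tf_surj x1; have d2 := fden_neq0 tf_inj tf_surj x2.
have n1 : num x1 != 0 by rewrite -size_poly_gt0; sizelia.
have n2 : num x2 != 0 by rewrite -size_poly_gt0; sizelia.
suff [lt0 lt1] : (size (sym0 (num x1) (den x1) (num x2) (den x2)) <
     size (sym2 (num x1) (den x1) (num x2) (den x2)))%N /\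
  (size (sym1 (num x1) (den x1) (num x2) (den x2)) <
     size (sym2 (num x1) (den x1) (num x2) (den x2)))%N.
  exact: (pair_pole tf_inj tf_surj G0 e5 e6).
move: (num x1) (den x1) (num x2) (den x2) p1 p2 d1 d2 n1 n2.
clear => u1 v1 u2 v2 p1 p2 v10 v20 u10 u20.
have [[s1 s2] [t1 t2]] : ((0 < size u1)%N /\ (0 < size u2)%N) /\ (0 < size v1)%N /\ (0 < size v2)%N.
  by rewrite !size_poly_gt0.
have sw : size (u1 * u2 - b *: (v1 * v2)) = (size u1 + size u2).-1.
  rewrite size_polyDl size_mul // size_polyN.
  by apply: leq_ltn_trans (size_scale_leq _ _) _; rewrite size_mul //; sizelia.
have w0 : u1 * u2 - b *: (v1 * v2) != 0 by rewrite -size_poly_gt0 sw; sizelia.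
have -> : size (sym2 u1 v1 u2 v2) = ((size u1 + size u2).-1 + (size u1 + size u2).-1).-1.
  by rewrite /sym2 expr2 size_mul // sw.
have sadd := @size_add_le F; have sZ := @size_scale_le F.
have sM (s t : {poly F}) k l : (size s <= k)%N -> (size t <= l)%N -> (size (s * t)%R <= (k + l).-1)%N.
  by move=> h1 h2; apply: leq_trans (size_polyMleq _ _) _; move: h1 h2; clear; sizelia.
have [k [ek ek']] : exists k, k = (size u1 + size u2).-2 /\ (0 < k)%N.
  by exists (size u1 + size u2).-2; split=> //; sizelia.
have ssum (s t : {poly F}) : (size s <= k)%N -> (size t <= k)%N -> (size (s + t)%R <= k)%N.
  exact: sadd.
have c1 : (size (u1 * v2)%R <= k)%N by rewrite size_mul //; sizelia.
have c2 : (size (u2 * v1)%R <= k)%N by rewrite size_mul //; sizelia.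
have c3 : (size (v1 * v2)%R <= k)%N by rewrite size_mul //; sizelia.
have c4 : (size (u1 * u2)%R <= k.+1)%N by rewrite size_mul //; sizelia.
have c5 : (size (u1 * v1 * (u2 * v2))%R <= k + k)%N.
  rewrite (_ : u1 * v1 * (u2 * v2) = u1 * v2 * (u2 * v1)); last by ring.
  by apply: leq_trans (sM _ _ _ _ c1 c2) _; lia.
have eN : (((size u1 + size u2).-1 + (size u1 + size u2).-1).-1 = (k + k).+1)%N.
  by move: ek ek'; sizelia.
rewrite eN !ltnS; split.
  rewrite /sym0 expr2; apply: leq_trans (sM _ _ k k _ _) _; try by apply: (ssum); rewrite ?size_polyN.
  exact: leq_pred.
rewrite /sym1; apply: (sZ); apply: (sadd); [apply: (sadd); last exact: sZ |].
  by apply: leq_trans (sM _ _ _ _ c4 (ssum _ _ c1 c2)) _; lia.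
by apply: (sZ); apply: leq_trans (sM _ _ _ _ c3 (ssum _ _ c1 c2)) _; lia.
Qed.

Lemma polept_mulz P n : polept P -> polept (P *~ n).
Proof.
move=> h; have hn k : polept (P *+ k).
  elim: k => [//|k IH]; rewrite mulrS.
  by have /andP[] := polept_addsub h IH.
by case: n => k; rewrite ?NegzE ?mulrNz ?poleptN -pmulrn.
Qed.
End PointHeight.

Lemma second_difference (g : nat -> int) (c : int) :
  (forall n, g n.+2 + g n = 2 * g n.+1 + 2 * c) ->
  forall n : nat, g n = g 0%N + n%:Z * (g 1%N - g 0%N - c) + n%:Z ^+ 2 * c.
Proof.
move=> rec n; suff [] : g n = g 0%N + n%:Z * (g 1%N - g 0%N - c) + n%:Z ^+ 2 * c /\
  g n.+1 = g 0%N + n.+1%:Z * (g 1%N - g 0%N - c) + n.+1%:Z ^+ 2 * c by [].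
elim: n => [|n [IH1 IH2]]; first by split; ring.
split=> //; apply: (addIr (g n)); rewrite rec IH1 IH2 -[n.+2]addn2 -[n.+1]addn1 !PoszD.
by ring.
Qed.

Lemma second_difference_int (g : int -> int) (c : int) :
  (forall m, g (m + 1) + g (m - 1) = 2 * g m + 2 * c) ->
  forall m, g m = g 0 + m * (g 1 - g 0 - c) + m ^+ 2 * c.
Proof.
move=> rec; have pos n : g n%:Z = g 0 + n%:Z * (g 1 - g 0 - c) + n%:Z ^+ 2 * c.
  apply: (second_difference (g := fun n : nat => g n%:Z)) => k.
  by rewrite -rec; congr (g _ + g _); rewrite -addn1 PoszD; ring.
have neg n : g (- n%:Z) = g 0 + n%:Z * (g (- 1) - g 0 - c) + n%:Z ^+ 2 * c.
  apply: (second_difference (g := fun n : nat => g (- n%:Z))) => k.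
  rewrite -rec addrC; congr (g _ + g _); rewrite -addn1 PoszD; ring.
case=> n; first exact: pos.
have := rec 0; rewrite add0r sub0r => e1.
have -> : g (Negz n) = g (- n.+1%:Z) by rewrite NegzE.
rewrite neg NegzE; have -> : g (- 1) = 2 * g 0 + 2 * c - g 1 by rewrite -e1; ring.
ring.
Qed.

(** The parallelogram law says that q has constant second difference 2 q(S) along R + m S; this is
    used in each of the two directions. *)
Lemma quadratic_form (M : zmodType) (q : M -> int) :
  (forall P Q, q (P + Q) + q (P - Q) = 2 * q P + 2 * q Q) ->
  forall P Q (x y : int),
  q (P *~ x + Q *~ y) = x ^+ 2 * q P + x * y * (q (P + Q) - q P - q Q) + y ^+ 2 * q Q.
Proof.
move=> par P Q x y.
have line R S m : q (R + S *~ m) = q R + m * (q (R + S) - q R - q S) + m ^+ 2 * q S.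
  have := @second_difference_int (fun m => q (R + S *~ m)) (q S) _ m.
  rewrite mulr0z addr0 mulr1z; apply => k.
  by rewrite -par !mulrzDr mulrNz mulr1z !addrA.
have q0 : q 0 = 0.
  by have := par 0 0; rewrite subrr addr0; lia.
have qy : q (Q *~ y) = y ^+ 2 * q Q.
  by have := line 0 Q y; rewrite !add0r q0 subr0 subrr mulr0 !add0r.
rewrite addrC line qy [Q *~ y + P]addrC line; ring.
Qed.

(** * The invariant differential *)

Section LogDerivative.
Variables (K : fieldType) (d : K -> K) (E : ecurve K).
Hypotheses (dD : forall x y, d (x + y) = d x + d y)
  (dM : forall x y, d (x * y) = d x * y + x * d y).
Let D := ecD E. Let a := eca E. Let b := ecb E.
Hypotheses (da0 : d a = 0) (db0 : d b = 0).

Lemma der0 : d 0 = 0.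
Proof. by apply: (addrI (d 0)); rewrite -dD !addr0. Qed.

Lemma derN x : d (- x) = - d x.
Proof. by apply/eqP; rewrite -addr_eq0 -dD addNr der0. Qed.

Lemma der1 : d 1 = 0.
Proof. by apply: (addrI (d 1)); rewrite addr0; have := dM 1 1; rewrite !mulr1 mul1r. Qed.

Lemma der_nat n : d n%:R = 0.
Proof. by elim: n => [|n IH]; rewrite ?der0 // -natr1 dD IH der1 addr0. Qed.

Definition derE := (dD, derN, dM, der_nat, da0, db0).

Let slope_at x := 3 * x ^+ 2 + 2 * a * x + b.

(** The invariant differential dx / y pulled back by P. The value 0 produced by division at y = 0 is
    right: x is then a root of a separable cubic with coefficients killed by d, so [d x] is 0. *)
Definition lam (P : ecpt E) : K := if ecval P is Some (x, y) then d x / y else 0.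

Lemma der_curve x y : D * y ^+ 2 = cubic a b x ->
  d D * y ^+ 2 + 2 * D * y * d y = slope_at x * d x.
Proof.
move/(congr1 d); rewrite /cubic /slope_at exprS !expr2 !derE => e.
transitivity (d D * (y * y) + D * (d y * y + y * d y)); first by ring.
by rewrite e; ring.
Qed.

Lemma point_curve (P : ecpt E) x y : ecval P = Some (x, y) -> D * y ^+ 2 = cubic a b x.
Proof. by move=> e; have := ecvalP P; rewrite e => /eqP. Qed.

Lemma lam_dx (P : ecpt E) x y : ecval P = Some (x, y) -> d x = lam P * y.
Proof.
move=> e; rewrite /lam e; have [y0 | y0] := eqVneq y 0; last by rewrite mulfVK.
rewrite y0 mulr0; have ce := point_curve e; have := der_curve ce.
rewrite y0 expr0n /= !mulr0 mul0r add0r => /esym/eqP.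
rewrite mulf_eq0 => /orP[] /eqP // s0; exfalso.
apply: (cubic_separable (ecb_neq0 E) (ecdisc_neq0 E) (x := x)) => //.
by rewrite -/a -/b -ce y0 expr0n /= mulr0.
Qed.

Lemma lam_torsion (P : ecpt E) x : ecval P = Some (x, 0) -> lam P = 0.
Proof. by move=> e; rewrite /lam e invr0 mulr0. Qed.

Lemma lam_dy (P : ecpt E) x y : ecval P = Some (x, y) ->
  2 * D * d y = slope_at x * lam P - d D * y.
Proof.
move=> e; have [y0 | y0] := eqVneq y 0.
  by rewrite y0 in e *; rewrite (lam_torsion e) der0 !mulr0 subr0.
apply: (mulIf y0); transitivity (slope_at x * d x - d D * y ^+ 2).
  by rewrite -(der_curve (point_curve e)); ring.
by rewrite (lam_dx e); ring.
Qed.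

Lemma lamN P : lam (- P) = - lam P.
Proof.
by rewrite /lam ecval_opp; case: (ecval P) => [[x y]|] /=; rewrite ?oppr0 // invrN mulrN.
Qed.

Lemma collinear_tangent l c x1 x2 x3 : collinear D a b l c x1 x2 x3 ->
  slope_at x1 - 2 * D * l * (l * x1 + c) = (x1 - x2) * (x1 - x3).
Proof.
case=> e1 e2 e3; rewrite /slope_at.
have -> : a = D * l ^+ 2 - (x1 + x2 + x3) by rewrite e1; ring.
have -> : b = 2 * D * l * c + (x1 * x2 + x1 * x3 + x2 * x3) by rewrite e2; ring.
by ring.
Qed.

(** In the derivative of the chord formula the terms in [d D] cancel, and [collinear_tangent] at the
    two points gives the rest. *)
Lemma lam_chord (P Q : ecpt E) x1 y1 x2 y2 x3 y3 : ecval P = Some (x1, y1) ->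
  ecval Q = Some (x2, y2) -> ecval (P + Q) = Some (x3, y3) -> x1 != x2 ->
  d x3 = (lam P + lam Q) * y3.
Proof.
move=> e1 e2 e3 x12; have c1 := ecvalP P; have c2 := ecvalP Q; rewrite e1 in c1; rewrite e2 in c2.
move: e3; rewrite ecval_add e1 e2.
case: (addP (ec2_neq0 E) (ecD_neq0 E) c1 c2) => // l c z ey1 ey2 col [<- <-].
have [s1 _ _] := col.
have dx1 := lam_dx e1; have dx2 := lam_dx e2; have dy1 := lam_dy e1; have dy2 := lam_dy e2.
have t1 := collinear_tangent col; have [/collinear_tangent t2 _] := collinear_perm col.
move: (lam P) (lam Q) dx1 dx2 dy1 dy2 => p q dx1 dx2 dy1 dy2.
have ez : z = D * l ^+ 2 - a - x1 - x2 by rewrite -s1; ring.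
have el : y2 - y1 = l * (x2 - x1) by rewrite ey1 ey2; ring.
have x0 : x2 - x1 != 0 by rewrite subr_eq0 eq_sym.
have dl := congr1 d el; rewrite !derE in dl.
have dz : d z = d D * l ^+ 2 + 2 * D * l * d l - d x1 - d x2.
  by rewrite ez expr2 !derE; ring.
apply: (mulIf x0); rewrite dz.
transitivity (d D * l * (l * (x2 - x1)) + l * (2 * D * d y2 - 2 * D * d y1 - 2 * D * l * (d x2 - d x1))
   - (d x1 + d x2) * (x2 - x1)).
  transitivity (d D * l ^+ 2 * (x2 - x1) + 2 * D * l * (d l * (x2 - x1) + l * (d x2 - d x1))
     - 2 * D * l ^+ 2 * (d x2 - d x1) - (d x1 + d x2) * (x2 - x1)); first by ring.
  by rewrite -dl; ring.
rewrite dy1 dy2 dx1 dx2 -el.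
transitivity (l * (q * (slope_at x2 - 2 * D * l * y2) - p * (slope_at x1 - 2 * D * l * y1))
  - (p * y1 + q * y2) * (x2 - x1)); first by ring.
by rewrite {1}ey1 {1}ey2 t1 t2 ey1 ey2; ring.
Qed.

Lemma lam_tangent (P : ecpt E) x y x3 y3 : ecval P = Some (x, y) -> y != 0 ->
  ecval (P + P) = Some (x3, y3) -> d x3 = 2 * lam P * y3.
Proof.
move=> e y0 e3; have c1 := ecvalP P; rewrite e in c1.
move: e3; rewrite ecval_add e.
case: (addP (ec2_neq0 E) (ecD_neq0 E) c1 c1) => // l c z ey _ col [<- <-].
have [s1 _ _] := col; have dx := lam_dx e; have dy := lam_dy e.
have t1 := collinear_tangent col; rewrite subrr mul0r in t1.
move: (lam P) dx dy => p dx dy.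
have {}t1 : 2 * D * l * y = slope_at x by rewrite ey -[LHS]addr0 -t1; ring.
have ez : z = D * l ^+ 2 - a - 2 * x by rewrite -s1; ring.
have dt := congr1 d t1; rewrite /slope_at expr2 !derE in dt.
have {}dt : 2 * d D * l * y + 2 * D * d l * y + 2 * D * l * d y = 3 * (d x * x + x * d x) + 2 * a * d x.
  transitivity (((0 * D + 2 * d D) * l + 2 * D * d l) * y + 2 * D * l * d y); first by ring.
  by rewrite dt; ring.
have dz : d z = d D * l ^+ 2 + 2 * D * l * d l - 2 * d x.
  by rewrite ez expr2 !derE; ring.
have dt' : d D * l + 2 * D * l ^+ 2 * p + 2 * D * d l = (6 * x + 2 * a) * p.
  apply: (mulIf y0).
  transitivity (2 * d D * l * y + l * (2 * D * l * y * p - d D * y) + 2 * D * y * d l); first by ring.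
  rewrite t1 -dy; transitivity (3 * (d x * x + x * d x) + 2 * a * d x); last by rewrite dx; ring.
  by rewrite -dt; ring.
rewrite dz; transitivity (l * (d D * l + 2 * D * l ^+ 2 * p + 2 * D * d l) - 2 * D * l ^+ 3 * p - 2 * d x); first by ring.
rewrite dt' dx ez ey; ring.
Qed.

Lemma lam0 : lam 0 = 0. Proof. by []. Qed.

Lemma lam_affine (P Q : ecpt E) x1 y1 x2 y2 x3 y3 : ecval P = Some (x1, y1) ->
  ecval Q = Some (x2, y2) -> ecval (P + Q) = Some (x3, y3) -> d x3 = (lam P + lam Q) * y3.
Proof.
move=> e1 e2 e3; have [x12 | x12] := eqVneq x1 x2; last exact: lam_chord e1 e2 e3 x12.
subst x2; have := point_curve e1; rewrite -(point_curve e2) => /(mulfI (ecD_neq0 E)) /eqP.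
have N : (y1 == - y2) = false.
  by apply/eqP => N; move: e3; rewrite ecval_add e1 e2 /= eqxx N eqxx.
rewrite eqf_sqr N orbF => /eqP ey; subst y2.
have eQ : Q = P by apply: val_inj; rewrite /= e1 e2.
rewrite eQ in e3 *; rewrite (lam_tangent e1 _ e3); first by ring.
by apply: contraFneq N => ->; rewrite oppr0.
Qed.

Lemma lamD (P Q : ecpt E) : lam (P + Q) = lam P + lam Q.
Proof.
have pt0 R : ecval R = None -> R = 0 :> ecpt E by move=> e; apply: val_inj.
case eP: (ecval P) => [[x1 y1]|]; last by rewrite (pt0 _ eP) !add0r.
case eQ: (ecval Q) => [[x2 y2]|]; last by rewrite (pt0 _ eQ) !addr0.
case eR: (ecval (P + Q)) => [[x3 y3]|]; last first.
  by move: (pt0 _ eR) => /eqP; rewrite addr_eq0 => /eqP ->; rewrite addNr lam0 lamN addNr.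
have eNP : ecval (- P) = Some (x1, - y1) by rewrite ecval_opp eP.
have eNQ : ecval (- Q) = Some (x2, - y2) by rewrite ecval_opp eQ.
have [y0 | y0] := eqVneq y3 0; last first.
  by apply: (mulIf y0); rewrite -(lam_dx eR) (lam_affine eP eQ eR).
(* Here P + Q has order two and its ordinate cannot be cancelled. The formula is applied to P = (P +
   Q) - Q or to Q = (P + Q) - P instead. *)
rewrite y0 in eR; rewrite (lam_torsion eR).
have [z1 | z1] := eqVneq y1 0; last first.
  have eP' : ecval (P + Q - Q) = Some (x1, y1) by rewrite addrK.
  have := lam_affine eR eNQ eP'; rewrite (lam_torsion eR) add0r lamN (lam_dx eP).
  by move/(mulIf z1) => ->; rewrite addNr.
rewrite z1 in eP; rewrite (lam_torsion eP) add0r.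
have [z2 | z2] := eqVneq y2 0; first by rewrite z2 in eQ; rewrite (lam_torsion eQ).
have eQ' : ecval (P + Q - P) = Some (x2, y2) by rewrite addrC addKr.
have := lam_affine eR eNP eQ'; rewrite (lam_torsion eR) add0r lamN (lam_torsion eP).
by rewrite oppr0 mul0r (lam_dx eQ) => /eqP; rewrite mulf_eq0 (negPf z2) orbF => /eqP.
Qed.

Lemma lam_mulz P n : lam (P *~ n) = lam P *~ n.
Proof.
have hn k : lam (P *+ k) = lam P *+ k.
  by elim: k => [//|k IH]; rewrite !mulrS lamD IH.
by case: n => k; rewrite ?NegzE ?mulrNz ?lamN -!pmulrn hn.
Qed.
End LogDerivative.

(** * The derivation of a rational function field *)

Section FracDerivative.
Variables (F K : fieldType) (tf : {rmorphism {poly F} -> K}).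
Hypotheses (tf_inj : injective tf)
  (tf_surj : forall x, exists u v : {poly F}, v != 0 /\ x = tf u / tf v).

Local Notation num := (fnum tf_inj tf_surj).
Local Notation den := (fden tf_inj tf_surj).

Definition wronskian (u v : {poly F}) := u^`() * v - u * v^`().

Definition dfrac (x : K) : K := tf (wronskian (num x) (den x)) / tf (den x) ^+ 2.

Lemma dfracE x u v : v != 0 -> x * tf v = tf u -> dfrac x = tf (wronskian u v) / tf v ^+ 2.
Proof.
move=> v0 e; have [w [w0 eu ev]] := frac_factor tf_inj tf_surj v0 e.
have -> : wronskian u v = wronskian (num x) (den x) * w ^+ 2.
  by rewrite eu ev /wronskian !derivM; ring.
rewrite ev /dfrac !rmorphM; field.
by rewrite !(tf_eq0 tf_inj) w0 fden_neq0.
Qed.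

Lemma dfrac_tf u : dfrac (tf u) = tf u^`().
Proof.
rewrite (@dfracE _ u 1) ?oner_neq0 ?rmorph1 ?mulr1 // /wronskian -polyC1 derivC.
by rewrite polyC1 mulr0 subr0 mulr1 expr1n divr1.
Qed.

Lemma dfracD x y : dfrac (x + y) = dfrac x + dfrac y.
Proof.
have dx := fden_neq0 tf_inj tf_surj x; have dy := fden_neq0 tf_inj tf_surj y.
have ex := fnumE tf_inj tf_surj x; have ey := fnumE tf_inj tf_surj y.
rewrite (@dfracE (x + y) (num x * den y + num y * den x) (den x * den y)) ?mulf_neq0 //.
  rewrite /dfrac /wronskian !(derivM, derivD) !(rmorphM, rmorphD, rmorphB); field.
  by rewrite !(tf_eq0 tf_inj) dx dy.
by rewrite rmorphD !rmorphM -ex -ey; ring.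
Qed.

Lemma dfracM x y : dfrac (x * y) = dfrac x * y + x * dfrac y.
Proof.
have dx := fden_neq0 tf_inj tf_surj x; have dy := fden_neq0 tf_inj tf_surj y.
have ex := fnumE tf_inj tf_surj x; have ey := fnumE tf_inj tf_surj y.
rewrite (@dfracE (x * y) (num x * num y) (den x * den y)) ?mulf_neq0 //.
  rewrite /dfrac /wronskian !derivM !(rmorphM, rmorphD, rmorphB).
  move: (fracE tf_inj tf_surj x) (fracE tf_inj tf_surj y) dx dy {ex ey}.
  move: (num x) (den x) (num y) (den y) => u v s t -> -> v0 t0; field.
  by rewrite !(tf_eq0 tf_inj) v0 t0.
by rewrite !rmorphM -ex -ey; ring.
Qed.

Variable p : nat.
Hypothesis pF : p \in [pchar F].

Lemma deriv_eq0 (u : {poly F}) : u^`() = 0 -> (size u <= p.+1)%N ->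
  u = u`_p *: 'X^p + (u`_0)%:P.
Proof.
move=> e su; have p_pr := pcharf_prime pF; have p0 := prime_gt0 p_pr.
apply/polyP => i; rewrite coefD coefZ coefXn coefC.
have [-> | i0] := eqVneq i 0%N; first by rewrite ltn_eqF // mulr0 add0r.
have [-> | ip] := eqVneq i p; first by rewrite mulr1 addr0.
rewrite mulr0 addr0; have [lt | ge] := ltnP i p; last first.
  by rewrite nth_default //; apply: leq_trans su _; lia.
have := congr1 (fun v : {poly F} => v`_i.-1) e; rewrite coef0 coef_deriv prednK; last by lia.
move/eqP; rewrite -mulr_natl mulf_eq0 -(dvdn_pcharf pF) => /orP[/dvdn_leq|/eqP //].
by lia.
Qed.

(** In lowest terms, a zero Wronskian makes the denominator divide its own derivative, so both
    derivatives vanish. The pole at infinity keeps the degree of the denominator below p, hence it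
    is constant. *)
Lemma inseparable x : dfrac x = 0 -> (ht tf_inj tf_surj x <= p)%N -> pole tf_inj tf_surj x ->
  exists al be, al != 0 /\ x = tf (al *: 'X^p + be%:P).
Proof.
move=> dx0 hx px; have d0 := fden_neq0 tf_inj tf_surj x.
have cop := coprime_numden tf_inj tf_surj x.
have w0 : wronskian (num x) (den x) = 0.
  apply: tf_inj; rewrite rmorph0; have td0 : tf (den x) ^+ 2 != 0.
    by rewrite expf_neq0 // (tf_eq0 tf_inj).
  by apply: (mulIf (invr_neq0 td0)); rewrite mul0r.
move/eqP: w0; rewrite subr_eq0 => /eqP w0.
have dd0 : (den x)^`() = 0.
  apply/eqP/negPn/negP => n0.
  have : den x %| (den x)^`().
    by rewrite -(Gauss_dvdpr _ (_ : coprimep (den x) (num x))) -?w0 ?dvdp_mull // coprimep_sym.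
  move/(dvdp_leq n0); have := lt_size_deriv d0; sizelia.
have nd0 : (num x)^`() = 0.
  by move/eqP: w0; rewrite dd0 mulr0 mulf_eq0 (negPf d0) orbF => /eqP.
have sn : (size (num x) <= p.+1)%N by move: hx; rewrite /ht; sizelia.
have sd : (size (den x) <= p)%N by move: px sn; rewrite /pole; sizelia.
have en := deriv_eq0 nd0 sn; have ed := deriv_eq0 dd0 (leqW sd).
rewrite [(den x)`_p]nth_default // scale0r add0r in ed.
set d := (den x)`_0 in ed; have dn0 : d != 0 by apply: contraNneq d0 => e; rewrite ed e polyC0.
exists ((num x)`_p / d), ((num x)`_0 / d); split.
  rewrite mulf_neq0 ?invr_neq0 //; apply/negP => /eqP e.
  move: px; rewrite /pole ed en e scale0r add0r size_polyC dn0 size_polyC.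
  by case: (_ != 0).
have td : tf d%:P != 0 by rewrite (tf_eq0 tf_inj) polyC_eq0.
apply: (mulIf td); rewrite -{1}ed fnumE -rmorphM {1}en; congr (tf _).
have dV : d^-1%:P * d%:P = 1 :> {poly F} by rewrite -polyCM mulVf.
rewrite -!mul_polyC !polyCM -[LHS]mulr1 -dV; ring.
Qed.
End FracDerivative.

(** * Multiplication by the square root of -6 *)

Section IsogenyFormulas.
Variables (R : comNzRingType) (r s z : R).

(* On y^2 = z^3 + 6 r z^2 + (9 - 6 r) z, the endomorphism acting as s on dz / y is
   (z, y) |-> (ison / (6 z isoq^2), y isom / (36 z^2 isoq^3)), and the sum of
   (z, y) and its image has abscissa z (sumx_num / sumx_den)^2. *)
Definition isoq := z ^+ 2 + (2 * r - 6) * z + (9 - 6 * r).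
Definition ison := 6 * (3 - 2 * r) * z * isoq ^+ 2 -
  (isoq ^+ 3 + 24 * z * isoq ^+ 2 + 48 * (2 + r) * z ^+ 2 * isoq + 32 * (2 + r) ^+ 2 * z ^+ 3).
Definition isom := s * (z ^+ 2 - (9 - 6 * r)) *
  (isoq ^+ 3 - 48 * (2 + r) * z ^+ 2 * isoq - 64 * (2 + r) ^+ 2 * z ^+ 3).
Definition sumx_num := 2 * z ^+ 3 + (18 * r - 12 + 2 * s - 3 * r * s) * z ^+ 2
  + (102 - 72 * r - 24 * s + 12 * r * s) * z + (126 * r - 180 + 30 * s - 21 * r * s).
Definition sumx_den := 2 * (1 + s) * z ^+ 3 + (7 * r * s - 24 - 10 * s) * z ^+ 2
  + (30 - 24 * r + 30 * s - 24 * r * s) * z + (21 * r * s - 30 * s).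

Hypotheses (hr : r ^+ 2 = 2) (hs : s ^+ 2 = - 6).

Lemma iso_curve : z * (z ^+ 2 + 6 * r * z + (9 - 6 * r)) * isom ^+ 2 =
  6 * z * ison * (ison ^+ 2 + 6 * r * ison * (6 * z * isoq ^+ 2) +
                  (9 - 6 * r) * (6 * z * isoq ^+ 2) ^+ 2).
Proof. by rewrite /isom /ison /isoq; ring: hr hs. Qed.

(** This exhibits the cancellation in the addition formula: the abscissa is z times the square of a
    quotient of polynomials of degree at most 3, so its degree is at most 7, the norm of 1 + s. *)
Lemma iso_sum :
  (z * (z ^+ 2 + 6 * r * z + (9 - 6 * r)) * (isom - 36 * z ^+ 2 * isoq ^+ 3) ^+ 2
   - (36 * 6 * r * z ^+ 2 * isoq ^+ 2 + 6 * z * ison + 36 * z ^+ 3 * isoq ^+ 2)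
     * (ison - 6 * z ^+ 2 * isoq ^+ 2) ^+ 2) * sumx_den ^+ 2 =
  z * sumx_num ^+ 2 * (36 * z ^+ 2 * isoq ^+ 2) * (ison - 6 * z ^+ 2 * isoq ^+ 2) ^+ 2.
Proof. by rewrite /sumx_num /sumx_den /isom /ison /isoq; ring: hr hs. Qed.

(** With [dq] the derivative of [isoq], the identity states X' = s Y / y for the image (X, Y) of (z,
    y), cleared of denominators. *)
Lemma iso_derivative (dq := 2 * z + (2 * r - 6)) :
  6 * (z * isoq * (6 * (3 - 2 * r) * (isoq ^+ 2 + 2 * z * isoq * dq) -
   (3 * isoq ^+ 2 * dq + 24 * (isoq ^+ 2 + 2 * z * isoq * dq) +
    48 * (2 + r) * (2 * z * isoq + z ^+ 2 * dq) + 96 * (2 + r) ^+ 2 * z ^+ 2))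
   - ison * (isoq + 2 * z * dq)) = s * isom.
Proof. by rewrite /dq /isom /ison /isoq; ring: hr hs. Qed.

End IsogenyFormulas.

Section IsogenyMorphism.
Variables (R S : comNzRingType) (g : {rmorphism R -> S}) (r s z : R).

Lemma rmorph_isoq : g (isoq r z) = isoq (g r) (g z).
Proof. rewrite /isoq; ring. Qed.
Lemma rmorph_ison : g (ison r z) = ison (g r) (g z).
Proof. rewrite /ison -rmorph_isoq; ring. Qed.
Lemma rmorph_isom : g (isom r s z) = isom (g r) (g s) (g z).
Proof. rewrite /isom -rmorph_isoq; ring. Qed.
Lemma rmorph_sumx_num : g (sumx_num r s z) = sumx_num (g r) (g s) (g z).
Proof. rewrite /sumx_num; ring. Qed.
Lemma rmorph_sumx_den : g (sumx_den r s z) = sumx_den (g r) (g s) (g z).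
Proof. rewrite /sumx_den; ring. Qed.
End IsogenyMorphism.

(** * The generic point and its image under s on the twist *)

Section ConcreteCurve.
Variables (F K : fieldType) (tf : {rmorphism {poly F} -> K}).
Hypotheses (tf_inj : injective tf)
  (tf_surj : forall x, exists u v : {poly F}, v != 0 /\ x = tf u / tf v).
Variables (r : F).
Hypotheses (hr : r ^+ 2 = 2) (two0 : 2 != 0 :> F) (three0 : 3 != 0 :> F).

Let a := 6 * r. Let b := 9 - 6 * r.
Let t : K := tf 'X.
Let rK : K := tf r%:P.

Definition fpoly : {poly F} := 'X * ('X ^+ 2 + a *: 'X + b%:P).

Lemma b_neq0 : b != 0.
Proof.
apply/negP => /eqP e; have : b * (9 + 6 * r) = 3 ^+ 2.
  by rewrite /b; ring: hr.
by rewrite e mul0r => /esym/eqP; rewrite expf_eq0 (negPf three0).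
Qed.

Lemma disc_neq0 : a ^+ 2 - 4 * b != 0.
Proof.
apply/negP => /eqP e; have : (a ^+ 2 - 4 * b) * (3 - 2 * r) = 2 ^+ 2 * 3.
  by rewrite /a /b; ring: hr.
by rewrite e mul0r => /esym/eqP; rewrite mulf_eq0 expf_eq0 /= (negPf two0) (negPf three0).
Qed.

Lemma tf_natr n : tf n%:R = n%:R. Proof. exact: rmorph_nat. Qed.

Lemma constK_neq0 (c : F) : c != 0 -> tf c%:P != 0.
Proof. by rewrite (tf_eq0 tf_inj) polyC_eq0. Qed.

Lemma natK_neq0 n : n%:R != 0 :> F -> n%:R != 0 :> K.
Proof. by move/constK_neq0; rewrite polyC_natr rmorph_nat. Qed.

Lemma fpolyE : tf fpoly = t * (t ^+ 2 + tf a%:P * t + tf b%:P).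
Proof. by rewrite /fpoly -mul_polyC /t; ring. Qed.

Lemma fpoly_neq0 : fpoly != 0.
Proof.
apply/negP => /eqP /(congr1 (fun u : {poly F} => u`_1)).
rewrite /fpoly coefXM /= !coefD coefZ coefXn coefX coefC /= mulr0 !add0r coef0 => /eqP.
by rewrite (negPf b_neq0).
Qed.

Fact ec_disc : tf a%:P ^+ 2 - 4 * tf b%:P != 0.
Proof.
have := constK_neq0 disc_neq0; congr (_ != 0).
by rewrite !expr2 polyCB (polyCM a) (polyCM 4) polyC_natr rmorphB !rmorphM tf_natr.
Qed.

Definition twist : ecurve K := @ECurve K (tf fpoly) (tf a%:P) (tf b%:P)
  (natK_neq0 two0) (etrans (congr1 negb (tf_eq0 tf_inj _)) fpoly_neq0)
  (constK_neq0 b_neq0) ec_disc.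

Fact generic_on_curve : on_curve (tf fpoly) (tf a%:P) (tf b%:P) (Some (t, 1)).
Proof. by rewrite /= fpolyE /cubic; apply/eqP; ring. Qed.

Definition P0 : ecpt twist := @EcPt K twist _ generic_on_curve.

Lemma aKE : tf a%:P = 6 * rK.
Proof. by rewrite /a polyCM polyC_natr rmorphM tf_natr. Qed.
Lemma bKE : tf b%:P = 9 - 6 * rK.
Proof. by rewrite /b polyCB polyCM !polyC_natr rmorphB rmorphM !tf_natr. Qed.
Lemma rKE : rK ^+ 2 = 2.
Proof. by rewrite /rK -rmorphXn -polyC_exp hr polyC_natr tf_natr. Qed.

Lemma tK_neq0 : t != 0.
Proof. by rewrite (tf_eq0 tf_inj) polyX_eq0. Qed.

Let qp : {poly F} := isoq r%:P 'X.
Lemma isoqK : tf qp = isoq rK t. Proof. exact: rmorph_isoq. Qed.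

Lemma horner_isoq0 : qp.[0] = b.
Proof.
by rewrite -/(horner_eval 0 qp) /qp rmorph_isoq /= !horner_evalE hornerC hornerX /isoq /b; ring.
Qed.

Lemma isoq_neq0 : isoq rK t != 0.
Proof.
rewrite -isoqK (tf_eq0 tf_inj); apply: contraNneq b_neq0 => e.
by rewrite -horner_isoq0 e horner0.
Qed.

Lemma six_neq0 : 6 != 0 :> K.
Proof. by rewrite (_ : 6 = 2 * 3) ?mulf_neq0 ?natK_neq0 //; ring. Qed.

Lemma n36_neq0 : 36 != 0 :> K.
Proof. by have -> : 36 = 6 * 6 :> K; [ring | rewrite mulf_neq0 // six_neq0]. Qed.

Definition isoX : K := ison rK t / (6 * t * isoq rK t ^+ 2).
(** The endomorphism multiplies the ordinate by a rational function; on the twist the generic point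
    has ordinate 1, so no square root of f(t) appears. *)
Definition isoY (s : F) : K := isom rK (tf s%:P) t / (36 * t ^+ 2 * isoq rK t ^+ 3).

Fact iso_on_curve s : s ^+ 2 = - 6 ->
  on_curve (tf fpoly) (tf a%:P) (tf b%:P) (Some (isoX, isoY s)).
Proof.
move=> hs; have hsK : tf s%:P ^+ 2 = - 6.
  by rewrite -rmorphXn -polyC_exp hs polyCN polyC_natr rmorphN tf_natr.
have := iso_curve t rKE hsK; rewrite /= fpolyE aKE bKE /isoX /isoY /cubic.
have := isoq_neq0; have := tK_neq0; have := six_neq0; have h36 := n36_neq0.
have h1296 : 1296 != 0 :> K by have -> : 1296 = 36 * 36 :> K; [ring | rewrite mulf_neq0].
move: (isoq _ _) (ison _ _) (isom _ _ _) => q n m h6 t0 q0 e; apply/eqP.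
transitivity (t * (t ^+ 2 + 6 * rK * t + (9 - 6 * rK)) * m ^+ 2 / (36 ^+ 2 * t ^+ 4 * q ^+ 6)).
  by field; rewrite t0 q0 h36 h1296.
rewrite e; field.
by rewrite t0 q0 h6 h1296.
Qed.

Definition Phi s (hs : s ^+ 2 = - 6) : ecpt twist := @EcPt K twist _ (iso_on_curve hs).

Local Notation hpt := (@hpt F K tf tf_inj tf_surj twist).
Local Notation polept := (@polept F K tf tf_inj tf_surj twist).

Lemma PhiN s (hs : s ^+ 2 = - 6) (hs' : (- s) ^+ 2 = - 6) : - Phi hs = Phi hs'.
Proof.
apply: val_inj => /=; congr (Some (_, _)).
by rewrite /isoY polyCN rmorphN /isom !mulNr.
Qed.

Lemma hpt_P0 : hpt P0 = 1%N.
Proof.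
have cop : coprimep 'X (1 : {poly F}) by exact: coprimep1.
have e : t * tf 1 = tf 'X by rewrite rmorph1 mulr1.
have [e1 e2] := frac_coprime tf_inj tf_surj (oner_neq0 _) cop e.
by rewrite /hpt /= /ht e1 e2 size_polyX size_poly1.
Qed.

Lemma polept_P0 : polept P0.
Proof.
have cop : coprimep 'X (1 : {poly F}) by exact: coprimep1.
have e : t * tf 1 = tf 'X by rewrite rmorph1 mulr1.
have [e1 e2] := frac_coprime tf_inj tf_surj (oner_neq0 _) cop e.
by rewrite /polept /= /pole e1 e2 size_polyX size_poly1.
Qed.

Let np : {poly F} := ison r%:P 'X.
Let dp : {poly F} := 6 *: 'X * qp ^+ 2.

Lemma sixF_neq0 : 6 != 0 :> F.
Proof. by rewrite (_ : 6 = 2 * 3) ?mulf_neq0 //; ring. Qed.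

Lemma qpE : qp = 'X^2 + ((2 * r - 6) *: 'X + b%:P).
Proof.
rewrite /qp /isoq /b -mul_polyC !(polyCB, polyCM, polyC_natr); ring.
Qed.

Lemma size_qp : size qp = 3%N.
Proof.
rewrite qpE size_polyDl size_polyXn // ltnS.
by apply: size_add_le; [apply: size_scale_le; rewrite size_polyX | rewrite size_polyC; case: (_ != 0)].
Qed.

Lemma isoX_frac : isoX * tf dp = tf np.
Proof.
rewrite /isoX /np rmorph_ison -/rK -/t /dp -mul_polyC.
rewrite polyC_natr !(rmorphM, rmorphXn, rmorph_nat) isoqK -/t; field.
by rewrite tK_neq0 isoq_neq0 six_neq0.
Qed.

Lemma horner_ison0 : np.[0] = - b ^+ 3.
Proof.
rewrite -/(horner_eval 0 np) /np rmorph_ison /= !horner_evalE hornerC hornerX.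
by rewrite /ison /isoq /b; ring.
Qed.

(** Since r^2 = 2, [qp] is (X - 3)(X - 3 + 2 r); its roots are abscissae of points of order 6 and 3,
    which with (0, 0) account for a kernel of order 6. Modulo [qp] only the last term of [np]
    survives, a unit times X^3. *)
Lemma coprime_np_dp : coprimep np dp.
Proof.
have cX : coprimep qp 'X by rewrite coprimepX rootE horner_isoq0 b_neq0.
have four0 : 4 != 0 :> F by rewrite (_ : 4 = 2 * 2) ?mulf_neq0 //; ring.
have r0 : 2 + r != 0.
  apply/negP => /eqP e; have : (2 + r) * (2 - r) = 2 by ring: hr.
  by rewrite e mul0r => /esym/eqP; rewrite (negPf two0).
have c0 : 32 * (2 + r) ^+ 2 != 0.
  have -> : 32 = 4 * 4 * 2 :> F by ring.
  by rewrite !mulf_neq0.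
have eq : np = (6 * (3 - 2 * r%:P) * 'X * qp - (qp ^+ 2 + 24 * 'X * qp + 48 * (2 + r%:P) * 'X ^+ 2)) * qp
    + (- (32 * (2 + r) ^+ 2)) *: 'X^3.
  rewrite /np /ison -/qp -mul_polyC polyCN polyCM polyC_natr polyC_exp polyCD polyC_natr; ring.
rewrite /dp -scalerAl coprimepZr ?sixF_neq0 // coprimepMr; apply/andP; split.
  by rewrite coprimepX rootE horner_ison0 oppr_eq0 expf_neq0 // b_neq0.
rewrite coprimep_expr // coprimep_sym eq coprimep_addl_mul coprimepZr ?oppr_eq0 //.
by rewrite coprimep_expr.
Qed.

Lemma npE : np = - (qp ^+ 3) + ((6 * (3 - 2 * r) - 24) *: ('X * qp ^+ 2) -
   (48 * (2 + r)) *: ('X^2 * qp) - (32 * (2 + r) ^+ 2) *: 'X^3).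
Proof.
rewrite /np /ison -/qp -!mul_polyC !(polyC_natr, polyC_exp, polyCM, polyCD, polyCN); ring.
Qed.

Lemma size_np : size np = 7%N.
Proof.
have q0 : qp != 0 by rewrite -size_poly_eq0 size_qp.
have s3 : size (- (qp ^+ 3)) = 7%N.
  by rewrite size_polyN exprS expr2 !size_mul ?mulf_neq0 // size_qp.
rewrite npE size_polyDl s3 //; apply: size_add_le; first apply: size_add_le.
- by apply: size_scale_le; rewrite expr2 !size_mul ?mulf_neq0 ?polyX_eq0 // size_qp size_polyX.
- rewrite size_polyN; apply: size_scale_le.
  by rewrite size_mul -?size_poly_eq0 ?size_polyXn ?size_qp.
by rewrite size_polyN; apply: size_scale_le; rewrite size_polyXn.
Qed.

Lemma size_dp : size dp = 6%N.
Proof.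
rewrite /dp -scalerAl size_scale ?sixF_neq0 // size_mul ?polyX_eq0 ?expf_neq0 // -?size_poly_eq0 ?size_qp //.
by rewrite expr2 size_mul -?size_poly_eq0 ?size_qp // size_polyX.
Qed.

Lemma dp_neq0 : dp != 0. Proof. by rewrite -size_poly_eq0 size_dp. Qed.

Lemma hpt_Phi s (hs : s ^+ 2 = - 6) : hpt (Phi hs) = 6%N.
Proof.
have [e1 e2] := frac_coprime tf_inj tf_surj dp_neq0 coprime_np_dp isoX_frac.
by rewrite /hpt /= /ht e1 e2 size_np size_dp.
Qed.

Lemma polept_Phi s (hs : s ^+ 2 = - 6) : polept (Phi hs).
Proof.
have [e1 e2] := frac_coprime tf_inj tf_surj dp_neq0 coprime_np_dp isoX_frac.
by rewrite /polept /= /pole e1 e2 size_np size_dp.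
Qed.

Lemma hpt_P0_Phi_le s (hs : s ^+ 2 = - 6) : (hpt (P0 + Phi hs)%R <= 7)%N.
Proof.
have hsK : tf s%:P ^+ 2 = - 6.
  by rewrite -rmorphXn -polyC_exp hs polyCN polyC_natr rmorphN tf_natr.
pose sn : {poly F} := sumx_num r%:P s%:P 'X; pose sd : {poly F} := sumx_den r%:P s%:P 'X.
have tX : t != isoX.
  rewrite eq_sym -subr_eq0; apply/negP => /eqP e.
  have : np - 'X * dp = 0.
    by apply: tf_inj; rewrite rmorphB rmorphM -isoX_frac -/t -mulrBl e mul0r rmorph0.
  move/(congr1 (horner_eval 0)); rewrite !horner_evalE hornerD hornerN hornerM hornerX mul0r subr0.
  by rewrite horner_ison0 horner0 => /eqP; rewrite oppr_eq0 (negPf (expf_neq0 3 b_neq0)).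
have sd0 : sd != 0.
  apply/negP => /eqP /(congr1 (horner_eval 0)); rewrite {1}/sd rmorph_sumx_den /= !horner_evalE.
  rewrite !hornerC hornerX /sumx_den => e.
  (* The constant term of [sd] is s (21 r - 30), and (21 r - 30)(21 r + 30) = -18. *)
  have /eqP : s ^+ 2 * (2 * 3 * 3) = 0.
    transitivity (- s * (21 * r + 30) * (21 * r * s - 30 * s)); first by ring: hr.
    apply/eqP; rewrite mulf_eq0 orbC; apply/orP; left; apply/eqP; rewrite -[RHS]e; ring.
  by rewrite hs !mulf_eq0 oppr_eq0 (negPf sixF_neq0) (negPf two0) (negPf three0).
rewrite /hpt ecval_add /= (negPf tX) /=.
have bound (c3 c2 c1 c0 : F) : (size (c3 *: 'X^3 + c2 *: 'X^2 + c1 *: 'X + c0%:P)%R <= 4)%N.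
  apply: size_add_le; last by rewrite size_polyC; case: (_ != 0).
  apply: size_add_le; last by apply: size_scale_le; rewrite size_polyX.
  by apply: size_add_le; apply: size_scale_le; rewrite size_polyXn.
have ssn : (size sn <= 4)%N.
  have -> : sn = 2 *: 'X^3 + (18 * r - 12 + 2 * s - 3 * r * s) *: 'X^2
      + (102 - 72 * r - 24 * s + 12 * r * s) *: 'X + (126 * r - 180 + 30 * s - 21 * r * s)%:P.
    rewrite /sn /sumx_num -!mul_polyC !(polyC_natr, polyCN, polyCM, polyCD); ring.
  exact: bound.
have ssd : (size sd <= 4)%N.
  have -> : sd = (2 * (1 + s)) *: 'X^3 + (7 * r * s - 24 - 10 * s) *: 'X^2
      + (30 - 24 * r + 30 * s - 24 * r * s) *: 'X + (21 * r * s - 30 * s)%:P.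
    rewrite /sd /sumx_den -!mul_polyC !(polyC_natr, polyCN, polyCM, polyCD); ring.
  exact: bound.
apply: (ht_le tf_inj tf_surj (u := 'X * sn ^+ 2) (v := sd ^+ 2)).
- by rewrite expf_neq0.
- have esn : tf sn = sumx_num rK (tf s%:P) t by exact: rmorph_sumx_num.
  have esd : tf sd = sumx_den rK (tf s%:P) t by exact: rmorph_sumx_den.
  rewrite [tf (sd ^+ 2)]rmorphXn [tf ('X * _)]rmorphM [tf (sn ^+ 2)]rmorphXn /= esn esd /slope (negPf tX).
  have := iso_sum t rKE hsK.
  move: tX; rewrite aKE fpolyE aKE bKE /isoX /isoY -/rK -/t.
  have := isoq_neq0; have := tK_neq0; have h6 := six_neq0; have h36 := n36_neq0.
  move: (isoq _ _) (ison _ _) (isom _ _ _) (sumx_num _ _ _) (sumx_den _ _ _) => q n m un ud t0 q0 tX e.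
  have W0 : n - 6 * t ^+ 2 * q ^+ 2 != 0.
    apply: contraNneq tX => W; apply/eqP; rewrite -[n](subrK (6 * t ^+ 2 * q ^+ 2)) W add0r.
    by field; rewrite t0 q0 h6.
  have n0 : 36 * t ^+ 2 * q ^+ 2 * (n - 6 * t ^+ 2 * q ^+ 2) ^+ 2 != 0.
    by rewrite !mulf_neq0 ?expf_neq0.
  apply: (mulIf n0); transitivity (t * un ^+ 2 * (36 * t ^+ 2 * q ^+ 2) * (n - 6 * t ^+ 2 * q ^+ 2) ^+ 2); last by ring.
  rewrite -e; field.
  rewrite q0 t0 h6 h36 andbT /=; apply: contraNneq W0 => W.
  by apply/eqP; rewrite -[RHS]W -/t; ring.
- rewrite expr2; apply: (size_mul_top (m := 1) (n := 6)); rewrite ?size_polyX //.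
  exact: (size_mul_top (m := 3) (n := 3)).
apply: leq_trans (_ : 7 <= 8)%N; last by [].
by rewrite expr2; exact: (size_mul_top (m := 3) (n := 3)).
Qed.

(** The bound 7 holds for s and -s, hence for P0 + Phi and P0 - Phi, while the parallelogram law
    makes the two heights add up to 14. Both are therefore 7, and the cross term of the quadratic
    form vanishes. *)
Lemma hpt_comb s (hs : s ^+ 2 = - 6) (x y : int) :
  (hpt (P0 *~ x + Phi hs *~ y))%:Z = x ^+ 2 + 6 * y ^+ 2.
Proof.
have par P Q : (hpt (P + Q))%:Z + (hpt (P - Q))%:Z = 2 * (hpt P)%:Z + 2 * (hpt Q)%:Z.
  have := @hpt_addsub F K tf tf_inj tf_surj a b twist two0 b_neq0 disc_neq0 erefl erefl P Q.
  lia.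
rewrite (@quadratic_form _ (fun P => (hpt P)%:Z) par) hpt_P0 hpt_Phi.
have hs' : (- s) ^+ 2 = - 6 by rewrite sqrrN.
have := par P0 (Phi hs); have h1 := hpt_P0_Phi_le hs; have := hpt_P0_Phi_le hs'.
rewrite -(PhiN hs hs') hpt_P0 hpt_Phi => h2 h3.
have -> : (hpt (P0 + Phi hs)%R)%:Z = 7 by lia.
lia.
Qed.

Lemma polept_comb s (hs : s ^+ 2 = - 6) (x y : int) : polept (P0 *~ x + Phi hs *~ y).
Proof.
have mz P n := @polept_mulz F K tf tf_inj tf_surj a b twist two0 b_neq0 disc_neq0 erefl erefl P n.
have := @polept_addsub F K tf tf_inj tf_surj a b twist two0 b_neq0 disc_neq0 erefl erefl _ _
  (mz _ x polept_P0) (mz _ y (polept_Phi hs)).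
by case/andP.
Qed.

Local Notation d := (dfrac tf_inj tf_surj).
Lemma dconst (c : F) : d (tf c%:P) = 0.
Proof. by rewrite dfrac_tf derivC rmorph0. Qed.

Let lamD' := @lamD K d twist (dfracD tf_inj tf_surj) (dfracM tf_inj tf_surj) (dconst a) (dconst b).
Let lam_mulz' := @lam_mulz K d twist (dfracD tf_inj tf_surj) (dfracM tf_inj tf_surj) (dconst a) (dconst b).

Lemma dt : d t = 1. Proof. by rewrite dfrac_tf derivX rmorph1. Qed.

Lemma lam_P0 : lam d P0 = 1.
Proof. by rewrite /lam /= dt divr1. Qed.

Lemma lam_Phi s (hs : s ^+ 2 = - 6) : lam d (Phi hs) = tf s%:P.
Proof.
have hsK : tf s%:P ^+ 2 = - 6.
  by rewrite -rmorphXn -polyC_exp hs polyCN polyC_natr rmorphN tf_natr.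
have isom0 : isom rK (tf s%:P) t != 0.
  have -> : isom rK (tf s%:P) t = tf (isom r%:P s%:P 'X) by symmetry; exact: rmorph_isom.
  rewrite (tf_eq0 tf_inj); apply/negP => /eqP /(congr1 (horner_eval 0)).
  rewrite rmorph_isom /= !horner_evalE !hornerC hornerX => e.
  have /eqP : s ^+ 2 * b ^+ 4 = 0.
    transitivity (- s * isom r s 0); first by rewrite /isom /isoq /b; ring.
    by rewrite e ?horner0 ?rmorph0 mulr0.
  by rewrite hs mulf_eq0 oppr_eq0 (negPf sixF_neq0) (negPf (expf_neq0 4 b_neq0)).
have dq : qp^`() = 2 *: 'X + (2 * r - 6)%:P.
  by rewrite qpE expr2 !derivE -!mul_polyC polyC_natr; ring.
have dnp : np^`() = 6 * (3 - 2 * r%:P) * (qp ^+ 2 + 2 * 'X * qp * qp^`()) -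
   (3 * qp ^+ 2 * qp^`() + 24 * (qp ^+ 2 + 2 * 'X * qp * qp^`()) +
    48 * (2 + r%:P) * (2 * 'X * qp + 'X ^+ 2 * qp^`()) + 96 * (2 + r%:P) ^+ 2 * 'X ^+ 2).
  rewrite npE exprS !expr2 (exprS 'X 2) !expr2 !derivE -!mul_polyC.
  by rewrite !(polyC_natr, polyC_exp, polyCM, polyCD, polyCN); ring.
have ddp : dp^`() = 6 * (qp ^+ 2 + 2 * 'X * qp * qp^`()).
  by rewrite /dp expr2 !derivE -!mul_polyC polyC_natr; ring.
have hrP : r%:P ^+ 2 = 2 :> {poly F} by rewrite -polyC_exp hr polyC_natr.
have hsP : s%:P ^+ 2 = - 6 :> {poly F} by rewrite -polyC_exp hs polyCN polyC_natr.
have w : wronskian np dp = qp * (s%:P * isom r%:P s%:P 'X).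
  rewrite -(iso_derivative 'X hrP hsP) /wronskian dnp ddp -/np -/qp.
  have -> : 2 * 'X + (2 * r%:P - 6) = qp^`() :> {poly F}.
    by rewrite dq -mul_polyC polyCB polyCM !polyC_natr.
  by rewrite /dp -mul_polyC polyC_natr; ring.
rewrite /lam /= (dfracE tf_inj tf_surj dp_neq0 isoX_frac) w.
have -> : tf dp = 6 * t * isoq rK t ^+ 2.
  by rewrite /dp -mul_polyC polyC_natr !(rmorphM, rmorphXn, rmorph_nat) isoqK.
rewrite /isoY [tf (qp * _)]rmorphM [tf (s%:P * _)]rmorphM isoqK (rmorph_isom tf) -/rK -/t.
have := isoq_neq0; have := tK_neq0; have h6 := six_neq0; have h36 := n36_neq0.
move: (isoq _ _) (isom _ _ _) isom0 => q m m0 t0 q0; field.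
by rewrite m0 t0 q0 h6 h36.
Qed.

Lemma lam_comb s (hs : s ^+ 2 = - 6) (x y : int) :
  lam d (P0 *~ x + Phi hs *~ y) = tf (x%:~R + s * y%:~R)%:P.
Proof.
rewrite lamD' !lam_mulz' lam_P0 lam_Phi polyCD polyCM rmorphD rmorphM.
by rewrite !rmorph_int mulrzr.
Qed.
End ConcreteCurve.

(** With g = gcd(u, v) and u = k g, squarefreeness makes k prime to g, hence to v; as k divides a
    power of v, it is constant. *)
Lemma squarefree_dvdp_exp (F : fieldType) (u v : {poly F}) n :
  u != 0 -> coprimep u u^`() -> u %| v ^+ n -> u %| v.
Proof.
move=> u0 sq uv; set g := gcdp u v; have gu : g %| u by exact: dvdp_gcdl.
have /dvdpP[k ek] := gu.
have g0 : g != 0 by apply: contraNneq u0 => e; rewrite ek e mulr0.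
have k0 : k != 0 by apply: contraNneq u0 => e; rewrite ek e mul0r.
have ckg : coprimep k g.
  apply/coprimepP => e ek' eg; move/coprimepP: sq; apply.
    by rewrite ek dvdp_mulr.
  by rewrite ek derivM dvdp_add // ?(dvdp_mull _ eg) ?(dvdp_mulr _ ek').
have ckv : coprimep k v.
  apply/coprimepP => e ek' ev; move/coprimepP: ckg; apply => //.
  by rewrite dvdp_gcd ev andbT ek dvdp_mulr.
have : k %| v ^+ n by apply: dvdp_trans uv; rewrite ek dvdp_mulr.
have := coprimep_expr n ckv; rewrite coprimep_sym => c1 c2.
have : coprimep k k by apply: coprimep_dvdl c2 _; rewrite coprimep_sym.
rewrite coprimepp => /size_poly1P[c c0 ekc].
apply: dvdp_trans (dvdp_gcdr u v); rewrite -/g ek ekc mul_polyC.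
by rewrite (eqp_dvdl _ (eqp_scale _ c0)).
Qed.

Lemma coprimep_prod_XsubC (F : fieldType) (u : {poly F}) (rs : seq F) :
  all (fun c => ~~ root u c) rs -> coprimep u (\prod_(c <- rs) ('X - c%:P)).
Proof.
elim: rs => [_|c rs IH /= /andP[h1 h2]]; first by rewrite big_nil coprimep1.
by rewrite big_cons coprimepMr IH // andbT coprimep_XsubC.
Qed.

(** * The trace of Frobenius *)

Section FiniteCurve.
Variables (F : finFieldType) (p : nat).
Hypotheses (cardF : #|F| = p) (pF : p \in [pchar F]).
Variables (K : fieldType) (tf : {rmorphism {poly F} -> K}).
Hypotheses (tf_inj : injective tf)
  (tf_surj : forall x, exists u v : {poly F}, v != 0 /\ x = tf u / tf v).
Variables (r : F).
Hypotheses (hr : r ^+ 2 = 2) (two0 : 2 != 0 :> F) (three0 : 3 != 0 :> F)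
  (n17 : 17 != 0 :> F) (n23 : 23 != 0 :> F).

Let a := 6 * r. Let b := 9 - 6 * r.
Let f : {poly F} := fpoly r.
Let half := p.-1./2.
Let E := twist tf_inj hr two0 three0.

Lemma p_odd : odd p.
Proof.
have := pcharf_prime pF; case/even_prime => // e.
by have := pcharf0 pF; rewrite e => /eqP; rewrite (negPf two0).
Qed.

Lemma halfE : half.*2.+1 = p.
Proof. by have := p_odd; rewrite /half; lia. Qed.

Definition cub (u : {poly F}) : {poly F} := u ^+ 3 + a *: u ^+ 2 + b *: u.

Lemma cubX : cub 'X = f.
Proof. by rewrite /cub /f /fpoly -/a -/b -!mul_polyC; ring. Qed.

Lemma frobD (u v : {poly F}) : (u + v) ^+ p = u ^+ p + v ^+ p.
Proof.
have pP : p \in [pchar {poly F}] by rewrite pchar_poly.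
by rewrite exprDn_pchar // pnatE ?(pcharf_prime pF).
Qed.

Lemma frobZ (c : F) (u : {poly F}) : (c *: u) ^+ p = c *: u ^+ p.
Proof. by rewrite exprZn -{1}cardF expf_card. Qed.

Lemma cub_frob u : cub u ^+ p = cub (u ^+ p).
Proof. by rewrite /cub !frobD !frobZ -!exprM mulnC [(2 * p)%N]mulnC. Qed.

Lemma tf_cub u : cubic (tf a%:P) (tf b%:P) (tf u) = tf (cub u).
Proof. by rewrite /cubic /cub -!mul_polyC; ring. Qed.

Lemma f_half : f * (f ^+ half) ^+ 2 = f ^+ p.
Proof. by rewrite -exprM muln2 -exprS halfE. Qed.

Fact frobenius_on_curve :
  on_curve (tf f) (tf a%:P) (tf b%:P) (Some (tf 'X^p, tf (f ^+ half))).
Proof.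
by rewrite /= tf_cub -cub_frob cubX -rmorphXn -rmorphM f_half.
Qed.

Definition Q0 : ecpt E := @EcPt K E _ frobenius_on_curve.

Lemma f_neq0 : f != 0. Proof. exact: fpoly_neq0. Qed.

Lemma f_squarefree : coprimep f f^`().
Proof.
have b0 := b_neq0 hr three0; have d0 := disc_neq0 hr two0 three0.
rewrite /f /fpoly -/a -/b; set h := _ + b%:P.
have dh : h^`() = 2 *: 'X + a%:P.
  by rewrite /h expr2 !derivE -!mul_polyC polyC_natr; ring.
have h0 : h.[0] = b.
  by rewrite /h !(hornerD, hornerZ, hornerXn, hornerX, hornerC) expr0n /= mulr0 !add0r.
have cX : coprimep h 'X by rewrite coprimepX rootE h0.
rewrite derivM derivX mul1r coprimepMl; apply/andP; split.
  rewrite addrC mulrC coprimep_addl_mul coprimep_sym; exact: cX.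
have -> : h + 'X * h^`() = 1 * h + h^`() * 'X by ring.
rewrite coprimep_addl_mul coprimepMr cX andbT dh.
have four0 : 4 != 0 :> F by rewrite (_ : 4 = 2 * 2) ?mulf_neq0 //; ring.
rewrite coprimep_sym -(coprimepZr _ _ four0).
have -> : 4 *: h = (2 *: 'X + a%:P) * (2 *: 'X + a%:P) + (- (a ^+ 2 - 4 * b))%:P.
  rewrite /h -!mul_polyC !(polyC_natr, polyCN, polyCB, polyCM, polyC_exp); ring.
rewrite coprimep_addl_mul -[(- (a ^+ 2 - 4 * b))%:P]alg_polyC coprimepZr ?oppr_eq0 ?coprimep1 //.
Qed.

(** F[t] is integrally closed: a denominator in lowest terms divides a square to which it is
    prime. *)
Lemma int_closed y u : y ^+ 2 = tf u -> exists w, y = tf w.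
Proof.
move=> e; have d0 := fden_neq0 tf_inj tf_surj y.
have cop := coprime_numden tf_inj tf_surj y; have ey := fnumE tf_inj tf_surj y.
move: (fnum _ _ y) (fden _ _ y) d0 cop ey => m n n0 cop ey.
have : n %| m ^+ 2.
  apply/dvdpP; exists (u * n); apply: tf_inj.
  by rewrite rmorphXn !rmorphM -ey -e; ring.
have c2 : coprimep n (m ^+ 2) by rewrite coprimep_expr // coprimep_sym.
move=> nm; have : coprimep n n by apply: coprimep_dvdl nm c2.
rewrite coprimepp => /size_poly1P[c c0 ec].
exists (c^-1 *: m); rewrite -mul_polyC rmorphM -ey ec.
transitivity (y * (tf (c^-1 * c)%:P)); first by rewrite mulVf // rmorph1 mulr1.
by rewrite polyCM rmorphM; ring.
Qed.

Lemma fE : f = 'X^3 + a *: 'X^2 + b *: 'X.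
Proof. by rewrite /f /fpoly -/a -/b -!mul_polyC; ring. Qed.

Lemma size_f : size f = 4%N.
Proof.
rewrite fE -addrA size_polyDl size_polyXn // ltnS.
by apply: size_add_le; apply: size_scale_le; rewrite ?size_polyXn ?size_polyX.
Qed.

(** The coefficient of degree 2 gives be = 2 r (al - 1), that of degree 1 gives al = 1 or -1, and
    the constant term excludes -1. The factors 5 + 2 r and 7 + 6 r to be inverted, of norms 17 and
    -23, vanish where j is 0 or 1728, that is where E has further automorphisms. *)
Lemma affine_frobenius al be : al != 0 -> f %| cub (al *: 'X + be%:P) ->
  al = 1 /\ be = 0.
Proof.
move=> al0.
have -> : cub (al *: 'X + be%:P) = al ^+ 3 *: 'X^3 + (3 * al ^+ 2 * be + a * al ^+ 2) *: 'X^2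
   + (3 * al * be ^+ 2 + 2 * a * al * be + b * al) *: 'X + (be ^+ 3 + a * be ^+ 2 + b * be)%:P.
  rewrite /cub -!mul_polyC !(polyC_natr, polyC_exp, polyCM, polyCD); ring.
set G := (X in _ %| X) => /dvdpP[q eq].
have sG : (size G <= 4)%N.
  apply: size_add_le; last by rewrite size_polyC; case: (_ != 0).
  apply: size_add_le; last by apply: size_scale_le; rewrite size_polyX.
  by apply: size_add_le; apply: size_scale_le; rewrite size_polyXn.
have [c ec] : exists c, q = c%:P.
  exists q`_0; apply: size1_polyC.
  have [-> | q0] := eqVneq q 0; first by rewrite size_poly0.
  by move: sG; rewrite eq size_mul ?f_neq0 // size_f; sizelia.
have co i := congr1 (fun u : {poly F} => u`_i) eq.
have e0 := co 0%N; have e1 := co 1%N; have e2 := co 2%N; have e3 := co 3%N.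
move: e0 e1 e2 e3; rewrite ec mul_polyC fE /G !(coefD, coefZ, coefXn, coefX, coefC) /=.
rewrite !(mulr0, mulr1, addr0, add0r) => e0 e1 e2 e3.
rewrite -{}e3 in e1 e2.
have {}e2 : be = 2 * r * (al - 1).
  have n3 : 3 * al ^+ 2 != 0 by rewrite mulf_neq0 // expf_neq0.
  apply: (mulfI n3); transitivity (3 * al ^+ 2 * be + a * al ^+ 2 - a * al ^+ 2); first by ring.
  by rewrite e2 /a; ring.
have {}e1 : 3 * be ^+ 2 + 2 * a * be + b = al ^+ 2 * b.
  by apply: (mulfI al0); rewrite -[RHS]/(al * (al ^+ 2 * b)); transitivity (al ^+ 3 * b); [rewrite -e1|]; ring.
have : (al - 1) * (al + 1) * (24 - b) = 0.
  apply/eqP; rewrite -(subrr (al ^+ 2 * b)) -{1}e1 e2 /a /b; apply/eqP.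
  by ring: hr.
have b24 : 24 - b != 0.
  apply/negP => /eqP e; have /eqP : (24 - b) * (5 - 2 * r) = 3 * 17 by rewrite /b; ring: hr.
  by rewrite e mul0r eq_sym mulf_eq0 (negPf three0) (negPf n17).
move/eqP; rewrite mulf_eq0 (negPf b24) orbF mulf_eq0 subr_eq0 addr_eq0.
case/orP=> /eqP eal; first by rewrite e2 eal subrr mulr0.
exfalso; have r0 : r != 0.
  by apply: contraNneq two0 => r0; rewrite -hr r0 expr0n.
have : (4 * r) * (7 + 6 * r) = 0.
  by rewrite -[RHS]e0 e2 eal /a /b; ring: hr.
have four0 : 4 != 0 :> F by rewrite (_ : 4 = 2 * 2) ?mulf_neq0 //; ring.
move/eqP; rewrite !mulf_eq0 (negPf four0) (negPf r0) /= => /eqP e7.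
have /eqP : (7 + 6 * r) * (7 - 6 * r) = - 23 by ring: hr.
by rewrite e7 mul0r eq_sym oppr_eq0 (negPf n23).
Qed.

Lemma frobenius_unique (P : ecpt E) : lam (dfrac tf_inj tf_surj) P = 0 ->
  hpt tf_inj tf_surj P = p -> polept tf_inj tf_surj P -> P = Q0 \/ P = - Q0.
Proof.
have p0 := prime_gt0 (pcharf_prime pF).
case eP: (ecval P) => [[x y]|]; last by rewrite /hpt eP => _ e; rewrite -e in p0.
rewrite /lam /hpt /polept eP => dx hx px.
have dx0 : dfrac tf_inj tf_surj x = 0.
  rewrite (@lam_dx K _ E (dfracD tf_inj tf_surj) (dfracM tf_inj tf_surj) (dconst _ _ _) (dconst _ _ _) P x y eP).
  by rewrite /lam eP dx mul0r.
have [al [be [al0 ex]]] := inseparable pF dx0 (eq_leq hx) px.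
have ce : tf f * y ^+ 2 = tf (cub (al *: 'X + be%:P) ^+ p).
  have := ecvalP P; rewrite eP => /eqP /= ->.
  by rewrite ex tf_cub cub_frob frobD frobZ -polyC_exp -{3}cardF expf_card.
set G := cub _ in ce.
(* The ordinate y might have a denominator, but f y has the polynomial square f G^p. *)
have [w ew] : exists w, tf f * y = tf w.
  apply: (int_closed (u := f * G ^+ p)); rewrite [tf (f * _)]rmorphM -ce; ring.
(* Squarefreeness serves twice: f divides the square of w = f y, hence w; so f divides G^p, hence
   G. *)
have fG : f %| G.
  apply: (squarefree_dvdp_exp (n := p) f_neq0 f_squarefree).
  have : f %| w.
    apply: (squarefree_dvdp_exp (n := 2) f_neq0 f_squarefree).
    apply/dvdpP; exists (G ^+ p); apply: tf_inj.
    by rewrite rmorphXn -ew [tf (_ * f)]rmorphM -ce; ring.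
  case/dvdpP=> v ev; apply/dvdpP; exists (v ^+ 2).
  apply: (mulfI f_neq0); apply: tf_inj; rewrite rmorphM -ce.
  transitivity ((tf f * y) ^+ 2); first by ring.
  by rewrite ew ev !rmorphM; ring.
have [al1 be0] := affine_frobenius al0 fG.
have eG : G = f by rewrite /G al1 be0 scale1r addr0 cubX.
have tf0 : tf f != 0 by rewrite (tf_eq0 tf_inj) f_neq0.
have : y ^+ 2 = tf (f ^+ half) ^+ 2.
  apply: (mulfI tf0); rewrite ce eG -f_half rmorphM rmorphXn //.
move/eqP; rewrite eqf_sqr => /orP[] /eqP ey; [left | right]; apply: val_inj => /=.
  by rewrite eP ex ey al1 be0 scale1r addr0.
by rewrite eP ex ey al1 be0 scale1r addr0.
Qed.

(** The quadratic character with values in F, by Euler's criterion. *)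
Definition chi (c : F) : F := c ^+ half.

Lemma half_gt0 : (0 < half)%N.
Proof.
have := pcharf_prime pF; have := halfE => e pr.
by rewrite lt0n; apply/negP => /eqP h; move: pr; rewrite -e h.
Qed.

Lemma chi_cases c : [\/ c = 0 /\ chi c = 0, c != 0 /\ chi c = 1 | c != 0 /\ chi c = -1].
Proof.
have [-> | c0] := eqVneq c 0.
  by constructor 1; rewrite /chi expr0n (gtn_eqF half_gt0).
have : chi c ^+ 2 = 1 ^+ 2.
  rewrite -exprM muln2 expr1n; apply: (mulfI c0).
  by rewrite -exprS halfE -cardF expf_card mulr1.
by move/eqP; rewrite eqf_sqr => /orP[] /eqP ->; [constructor 2 | constructor 3].
Qed.

Let zs := [seq c <- enum F | f.[c] == 0].
Let rs := [seq c <- enum F | chi f.[c] == 1].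
Let ns := [seq c <- enum F | chi f.[c] == -1].

Lemma one_neqN1 : (1 == -1 :> F) = false.
Proof. by rewrite -addr_eq0 -mulr2n (negPf two0). Qed.

Lemma split_prod (V : comNzRingType) (G : F -> V) :
  \prod_c G c = \prod_(c <- zs) G c * \prod_(c <- rs) G c * \prod_(c <- ns) G c.
Proof.
rewrite !big_filter !big_enum_cond /= (bigID (fun c => f.[c] == 0)) /= -mulrA; congr (_ * _).
rewrite (bigID (fun c => chi f.[c] == 1)) /=; congr (_ * _); apply: eq_bigl => c.
  case: (chi_cases f.[c]) => [[-> ->] | [/negPf -> ->] | [/negPf -> ->]]; rewrite ?eqxx //.
  by rewrite eq_sym oner_eq0.
case: (chi_cases f.[c]) => [[-> ->] | [/negPf -> ->] | [/negPf -> ->]]; rewrite ?eqxx //=.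
- by rewrite eq_sym oppr_eq0 oner_eq0.
- by rewrite one_neqN1.
by rewrite eq_sym one_neqN1.
Qed.

Lemma split_sum (V : nmodType) (G : F -> V) :
  \sum_c G c = \sum_(c <- zs) G c + \sum_(c <- rs) G c + \sum_(c <- ns) G c.
Proof.
rewrite !big_filter !big_enum_cond /= (bigID (fun c => f.[c] == 0)) /= -addrA; congr (_ + _).
rewrite (bigID (fun c => chi f.[c] == 1)) /=; congr (_ + _); apply: eq_bigl => c.
  case: (chi_cases f.[c]) => [[-> ->] | [/negPf -> ->] | [/negPf -> ->]]; rewrite ?eqxx //.
  by rewrite eq_sym oner_eq0.
case: (chi_cases f.[c]) => [[-> ->] | [/negPf -> ->] | [/negPf -> ->]]; rewrite ?eqxx //=.
- by rewrite eq_sym oppr_eq0 oner_eq0.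
- by rewrite one_neqN1.
by rewrite eq_sym one_neqN1.
Qed.

Lemma split_size : (size zs + size rs + size ns = p)%N.
Proof.
have := split_sum (fun _ => 1%N); rewrite sum1_card cardF => ->.
by rewrite !sum1_size.
Qed.

Lemma sum_chi : \sum_c chi f.[c] = (size rs)%:R - (size ns)%:R.
Proof.
rewrite split_sum big1_seq => [|c]; last first.
  rewrite mem_filter => /andP[_ /andP[/eqP -> _]].
  by rewrite /chi expr0n (gtn_eqF half_gt0).
rewrite add0r (eq_big_seq (fun => 1)) => [|c]; last by rewrite mem_filter => /andP[/eqP].
rewrite [X in _ + X](eq_big_seq (fun => -1)) => [|c]; last by rewrite mem_filter => /andP[/eqP].
by rewrite !big_const_seq !count_predT !iter_addr_0 mulNrn.
Qed.

Let Z0 := \prod_(c <- zs) ('X - c%:P).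
Let Zr := \prod_(c <- rs) ('X - c%:P).
Let Zn := \prod_(c <- ns) ('X - c%:P).
Let g := f ^+ half.

Lemma genpolyE : 'X^p - 'X = Z0 * Zr * Zn.
Proof. by rewrite -cardF finField_genPoly split_prod. Qed.

Lemma uniq_filter (q : pred F) : uniq_roots [seq c <- enum F | q c].
Proof. by rewrite uniq_rootsE filter_uniq // enum_uniq. Qed.

(** On F the polynomial g takes the values of the character, so 1 + g vanishes exactly where f is a
    nonsquare. That U is prime to Z0 uses that f is squarefree. *)
Lemma reduced_parts : exists U : {poly F},
  f * (1 + g) ^+ 2 = Z0 * Zn ^+ 2 * U /\ coprimep U (Z0 * Zr ^+ 2).
Proof.
have /dvdpP[f1 ef] : Z0 %| f.
  apply: uniq_roots_dvdp; last exact: uniq_filter.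
  by apply/allP => c; rewrite mem_filter => /andP[].
have /dvdpP[h1 eh] : Zn %| 1 + g.
  apply: uniq_roots_dvdp; last exact: uniq_filter.
  apply/allP => c; rewrite mem_filter => /andP[/eqP e _].
  by rewrite rootE hornerD hornerC horner_exp -/(chi _) e subrr.
exists (f1 * h1 ^+ 2); split; first by rewrite eh {1}ef; ring.
have h1g c v : chi f.[c] = v -> 1 + v != 0 -> ~~ root h1 c.
  move=> e; apply: contraNN => /rootP e0.
  by rewrite -e /chi -horner_exp -/g -(hornerC 1 c) -hornerD eh hornerM e0 mul0r.
rewrite coprimepMr; apply/andP; split.
  apply: coprimep_prod_XsubC; apply/allP => c cz; have := cz.
  rewrite mem_filter => /andP[/eqP fc _]; rewrite expr2 !rootM !negb_or.
  have hc : ~~ root h1 c.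
    by apply: (h1g c 0); rewrite ?addr0 ?oner_eq0 // fc /chi expr0n (gtn_eqF half_gt0).
  rewrite hc /= andbT; apply/negP => /rootP f1c.
  have := coprimep_root f_squarefree (introT rootP fc).
  have z0c : Z0.[c] = 0 by apply/rootP; rewrite root_prod_XsubC.
  by rewrite ef derivM hornerD !hornerM f1c z0c !(mul0r, mulr0) addr0 eqxx.
apply/coprimep_expr/coprimep_prod_XsubC/allP => c; rewrite mem_filter => /andP[/eqP fc _].
rewrite expr2 !rootM !negb_or (h1g c 1) //= ?andbT //.
apply/negP => /rootP f1c; move/eqP: fc; rewrite ef hornerM f1c mul0r /chi expr0n (gtn_eqF half_gt0).
by rewrite eq_sym oner_eq0.
Qed.

Lemma size_prods : [/\ size Z0 = (size zs).+1, size Zr = (size rs).+1 & size Zn = (size ns).+1].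
Proof. by rewrite !size_prod_XsubC. Qed.

(** Since f g^2 = f^p = f(X^p), the terms in (X^p)^3 and a (X^p)^2 cancel, and X (X^p)^2, of degree
    2p + 1, is left in front. *)
Lemma size_num_Q0P0 :
  size (f * (1 + g) ^+ 2 - (a%:P + 'X^p + 'X) * ('X^p - 'X) ^+ 2) = (p.*2).+2.
Proof.
set Y : {poly F} := 'X^p.
have eg : f * g ^+ 2 = Y ^+ 3 + a *: Y ^+ 2 + b *: Y by rewrite f_half -cubX cub_frob.
have -> : f * (1 + g) ^+ 2 - (a%:P + Y + 'X) * (Y - 'X) ^+ 2 = 'X * Y ^+ 2 +
   (f + 2 *: (f * g) + b *: Y + 'X^2 * Y + (2 * a) *: ('X * Y) - a *: 'X^2 - 'X^3).
  transitivity (f + 2 *: (f * g) + f * g ^+ 2 - (a%:P + Y + 'X) * (Y - 'X) ^+ 2).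
    by rewrite -!mul_polyC ?polyC_natr; ring.
  by rewrite eg -!mul_polyC (polyCM 2) polyC_natr; ring.
have p3 : (3 <= p)%N by have := halfE; have := half_gt0; lia.
have sY : size Y = p.+1 by rewrite size_polyXn.
have Y0 : Y != 0 by rewrite -size_poly_eq0 sY.
have X0 : 'X != 0 :> {poly F} by rewrite polyX_eq0.
have e1 : size ('X * Y ^+ 2) = p.*2.+2.
  by rewrite expr2 !size_mul ?mulf_neq0 // sY size_polyX; lia.
have sg : (size g <= (3 * half).+1)%N.
  by apply: leq_trans (size_poly_exp_leq _ _) _; rewrite size_f.
rewrite size_polyDl e1 // ltnS.
have s4 : (size f <= 3.+1)%N by rewrite size_f.
have sfg := size_mul_top s4 sg; have hE := halfE.
do ?apply: size_add_le; rewrite ?size_polyN; do ?apply: size_scale_le.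
- by apply: leq_trans s4 _; lia.
- by apply: leq_trans sfg _; lia.
- by rewrite sY; lia.
- by rewrite size_mul ?expf_neq0 // sY size_polyXn; lia.
- by rewrite size_mul // sY size_polyX; lia.
- by rewrite size_polyXn; lia.
by rewrite size_polyXn; lia.
Qed.

(** The chord formula gives the abscissa f (1 + g)^2 / (X^p - X)^2 - (a + X^p + X), with reduced
    denominator [Z0 * Zr ^+ 2]. The resulting height is the number of points of E over F, the origin
    included. *)
Lemma hpt_Q0P0 :
  hpt tf_inj tf_surj (Q0 - P0 tf_inj hr two0 three0) = (size zs + 2 * size rs).+1.
Proof.
have [U [eU cU]] := reduced_parts; have [sz sr sn] := size_prods.
have [z0 r0 n0] : [/\ Z0 != 0, Zr != 0 & Zn != 0].
  by rewrite -!size_poly_gt0 sz sr sn.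
pose den := Z0 * Zr ^+ 2; pose num := U - (a%:P + 'X^p + 'X) * den.
have d0 : den != 0 by rewrite mulf_neq0 // expf_neq0.
have cop : coprimep num den.
  by rewrite coprimep_sym /num addrC -mulNr coprimep_addl_mul coprimep_sym.
have T0 : 'X^p - 'X != 0 :> {poly F} by rewrite genpolyE !mulf_neq0.
have xX : (tf 'X^p == tf 'X) = false.
  by rewrite -subr_eq0 -rmorphB (tf_eq0 tf_inj) (negPf T0).
rewrite /hpt ecval_add ecval_opp /= xX /=; set x3 := _ - tf 'X.
have e3 : x3 * tf den = tf num.
  have eT : tf 'X^p - tf 'X = tf Z0 * tf Zr * tf Zn by rewrite -rmorphB genpolyE !rmorphM.
  have eK : tf f * (1 + tf g) ^+ 2 = tf Z0 * tf Zn ^+ 2 * tf U.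
    have := congr1 tf eU; rewrite [tf (f * _)]rmorphM [tf ((1 + g) ^+ 2)]rmorphXn [tf (1 + g)]rmorphD.
    by rewrite rmorph1 => ->; rewrite [tf (Z0 * _ * U)]rmorphM [tf (Z0 * _)]rmorphM rmorphXn.
  have dK : tf den = tf Z0 * tf Zr ^+ 2 by rewrite [LHS]rmorphM rmorphXn.
  have -> : tf num = tf U - (tf a%:P + tf 'X^p + tf 'X) * tf den.
    by rewrite [LHS]rmorphB [tf (_ * den)]rmorphM [tf (_ + 'X)]rmorphD [tf (a%:P + _)]rmorphD.
  have exp : tf 'X^p = tf 'X + tf Z0 * tf Zr * tf Zn by rewrite -eT; ring.
  have [zK rK nK] : [/\ tf Z0 != 0, tf Zr != 0 & tf Zn != 0] by rewrite !(tf_eq0 tf_inj).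
  rewrite /x3 /slope xX /= dK -/g; move: eK exp zK rK nK.
  move: (tf Z0) (tf Zr) (tf Zn) (tf f) (tf g) (tf U) (tf 'X^p) (tf 'X) (tf a%:P).
  move=> z v n f' g' u xp x a' eK -> zK vK nK.
  transitivity (f' * (1 + g') ^+ 2 / (z * n ^+ 2) - (a' + (x + z * v * n) + x) * (z * v ^+ 2)).
    field; rewrite nK zK /= (_ : x - (x + z * v * n) = - (z * v * n)); last by ring.
    by rewrite oppr_eq0 !mulf_neq0.
  by rewrite eK; field; rewrite zK nK.
have [e4 e5] := frac_coprime tf_inj tf_surj d0 cop e3.
have eB : f * (1 + g) ^+ 2 - (a%:P + 'X^p + 'X) * ('X^p - 'X) ^+ 2 = num * (Z0 * Zn ^+ 2).
  by rewrite genpolyE eU /num /den; ring.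
have num0 : num != 0.
  by apply/negP => /eqP e; have := size_num_Q0P0; rewrite eB e mul0r size_poly0.
have sr2 : size (Zr ^+ 2) = (size rs + size rs).+1.
  by rewrite expr2 (size_mul r0 r0) sr addSn addnS.
have sn2 : size (Zn ^+ 2) = (size ns + size ns).+1.
  by rewrite expr2 (size_mul n0 n0) sn addSn addnS.
have r20 : Zr ^+ 2 != 0 by rewrite expf_neq0.
have n20 : Zn ^+ 2 != 0 by rewrite expf_neq0.
have sd : size den = (size zs + 2 * size rs).+1 by rewrite /den (size_mul z0 r20) sz sr2 addSn addnS mul2n addnn.
have s0n : size (Z0 * Zn ^+ 2) = (size zs + 2 * size ns).+1 by rewrite (size_mul z0 n20) sz sn2 addSn addnS mul2n addnn.
have snum : size num = (size zs + 2 * size rs).+2.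
  have := size_num_Q0P0; rewrite eB (size_mul num0 (mulf_neq0 z0 n20)) s0n.
  by move: split_size; move: (size num) (size zs) (size rs) (size ns); clear; lia.
by rewrite /ht e4 e5 snum sd maxnSS (maxn_idPl (leqnSn _)).
Qed.

Theorem trace_sqr (x y : int) : p%:Z = x ^+ 2 + 6 * y ^+ 2 ->
  (\sum_c chi f.[c]) ^+ 2 = (4 * x ^+ 2)%:~R.
Proof.
move=> exy; have p_pr := pcharf_prime pF.
have pz : (x ^+ 2 + 6 * y ^+ 2)%:~R = 0 :> F.
  by rewrite -exy; exact: pcharf0 pF.
(* If p divided y, either y = 0 and the prime p would be a square, or 6 y^2 would exceed p. *)
have y0 : y%:~R != 0 :> F.
  have -> : (y%:~R == 0 :> F) = (p %| `|y|)%N.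
    rewrite (dvdn_pcharf pF); case: y {exy pz} => n //.
    by rewrite NegzE mulrNz oppr_eq0 -pmulrn.
  apply/negP => /dvdnP[k ek]; have [k0 | k0] := posnP k.
    have y0 : y = 0 by move: ek; rewrite k0; lia.
    have ep : p = (`|x| * `|x|)%N by move: exy; rewrite y0; nia.
    have px : (p %| `|x|)%N.
      have : (p %| `|x| * `|x|)%N by rewrite -ep.
      by rewrite Euclid_dvdM // orbb.
    case/dvdnP: px => j ej; move: ep; rewrite ej; have := prime_gt1 p_pr.
    by case: j {ej} => [|j]; [lia | nia].
  have := prime_gt1 p_pr; move: exy; have : (p <= `|y|)%N by rewrite ek leq_pmull.
  nia.
pose s : F := - (x%:~R / y%:~R).
have hs : s ^+ 2 = - 6.
  rewrite /s sqrrN expr_div_n; apply: (mulIf (expf_neq0 2 y0)); rewrite mulfVK ?expf_neq0 //.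
  apply/eqP; rewrite mulNr -addr_eq0; apply/eqP; rewrite -[RHS]pz.
  by rewrite rmorphD rmorphM !rmorphXn.
pose al := P0 tf_inj hr two0 three0 *~ x + Phi tf_inj hr two0 three0 hs *~ y.
have hal : hpt tf_inj tf_surj al = p.
  by have := hpt_comb tf_inj tf_surj hr two0 three0 hs x y; rewrite -exy => -[].
have lal : lam (dfrac tf_inj tf_surj) al = 0.
  rewrite /al lam_comb /s mulNr mulfVK // subrr; exact: rmorph0.
have pal := polept_comb tf_inj tf_surj hr two0 three0 hs x y.
(* The height (x - e)^2 + 6 y^2 = p + 1 - 2 e x is the number of points, while p is the sum of the
   sizes of [zs], [rs] and [ns]. *)
have count e : al = Q0 *~ e -> e = 1 \/ e = -1 ->
  (size rs)%:Z - (size ns)%:Z = - (2 * e * x).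
  move=> ale he.
  have := hpt_comb tf_inj tf_surj hr two0 three0 hs (x - e) y.
  have -> : P0 tf_inj hr two0 three0 *~ (x - e) + Phi tf_inj hr two0 three0 hs *~ y =
     (Q0 - P0 tf_inj hr two0 three0) *~ e.
    by rewrite mulrzBl -ale mulrzBr addrAC.
  have -> : hpt tf_inj tf_surj ((Q0 - P0 tf_inj hr two0 three0) *~ e) =
     (size zs + 2 * size rs).+1.
    by rewrite -hpt_Q0P0; case: he => ->; rewrite ?mulr1z ?mulrN1z ?hptN.
  have := split_size; have : e ^+ 2 = 1 by case: he => ->.
  move: exy; rewrite -!mulrA; nia.
have [e [ale he]] : exists e, al = Q0 *~ e /\ (e = 1 \/ e = -1).
  have [-> | ->] := frobenius_unique lal hal pal.
    by exists 1; rewrite mulr1z; split; last left.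
  by exists (-1); rewrite mulrN1z; split; last right.
have := count e ale he; rewrite sum_chi => /(congr1 (fun z : int => z%:~R : F)).
rewrite rmorphB /= => ->; rewrite -rmorphXn; congr (_%:~R).
by case: he => ->; ring.
Qed.

End FiniteCurve.

(** * Character sums *)

Section PowerSums.
Variables (F : finFieldType) (p : nat).
Hypotheses (cardF : #|F| = p) (pF : p \in [pchar F]) (p_gt3 : (3 < p)%N).

Let half := p.-1./2.

Lemma fermat (c : F) : c != 0 -> c ^+ p.-1 = 1.
Proof.
move=> c0; apply: (mulfI c0); rewrite -exprS prednK ?mulr1 -?cardF ?expf_card //.
by rewrite cardF; lia.
Qed.

Lemma sum_one : \sum_(c : F) 1 = 0 :> F.
Proof. by rewrite sumr_const cardF (pcharf0 pF). Qed.

Lemma non_root_of_unity n : (0 < n < p.-1)%N -> exists u : F, u != 0 /\ u ^+ n != 1.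
Proof.
case/andP=> n0 np.
have [/existsP[u /andP[u0 un]] | none] := boolP [exists u : F, (u != 0) && (u ^+ n != 1)].
  by exists u.
have all1 (u : F) : u != 0 -> u ^+ n = 1.
  move=> u0; apply/eqP; apply: contraNT none => un.
  by apply/existsP; exists u; rewrite u0.
have q0 : 'X^n - 1%:P != 0 :> {poly F} by rewrite -size_poly_gt0 size_XnsubC.
have := @max_poly_roots F ('X^n - 1%:P) (enum (predC1 0)) q0 _ (enum_uniq _).
rewrite size_XnsubC // -cardE cardC1 cardF => h.
have : (p.-1 < n.+1)%N by apply: h; apply/allP => u; rewrite mem_enum inE => u0; rewrite rootE !hornerE all1 ?subrr.
by lia.
Qed.

Lemma power_sum_lt n : (n < p.-1)%N -> \sum_(c : F) c ^+ n = 0.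
Proof.
move=> np; case: n np => [|n] np; first by rewrite -[RHS]sum_one; apply: eq_bigr.
have [u [u0 un]] := @non_root_of_unity n.+1 np.
have e : \sum_(c : F) c ^+ n.+1 = u ^+ n.+1 * \sum_(c : F) c ^+ n.+1.
  rewrite {1}(reindex_inj (mulfI u0)) mulr_sumr; apply: eq_bigr => c _.
  by rewrite exprMn.
have /eqP : (1 - u ^+ n.+1) * \sum_(c : F) c ^+ n.+1 = 0 by rewrite mulrBl mul1r -e subrr.
by rewrite mulf_eq0 subr_eq0 eq_sym (negPf un) => /eqP.
Qed.

Lemma power_sum_pred : \sum_(c : F) c ^+ p.-1 = -1.
Proof.
rewrite (bigD1 0) //= expr0n (_ : (p.-1 == 0)%N = false) ?add0r; last by lia.
rewrite (eq_bigr (fun=> 1)) => [|c c0]; last exact: fermat.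
by apply: (addrI 1); rewrite subrr -[RHS]sum_one [RHS](bigD1 0).
Qed.

Lemma power_sum n : (n < p.-1.*2)%N -> \sum_(c : F) c ^+ n = - (n == p.-1)%:R.
Proof.
move=> n2; have [lt | gt | ->] := ltngtP n p.-1; last exact: power_sum_pred.
  by rewrite power_sum_lt // oppr0.
rewrite oppr0; transitivity (\sum_(c : F) c ^+ (n - p.-1)); last by apply: power_sum_lt; lia.
apply: eq_bigr => c _; have [-> | c0] := eqVneq c 0.
  by rewrite !expr0n; congr (_%:R); lia.
by rewrite -{1}(subnK (ltnW gt)) exprD fermat // mulr1.
Qed.

Lemma power_sum_double : \sum_(c : F) c ^+ p.-1.*2 = -1.
Proof.
rewrite -power_sum_pred; apply: eq_bigr => c _; have [-> | c0] := eqVneq c 0.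
  by rewrite !expr0n; congr (_%:R); lia.
by rewrite -muln2 exprM fermat // expr1n.
Qed.

(** The binomial coefficients of index p - 1 are (-1)^i modulo p; the identity follows from u^p -
    v^p = u - v after division by u - v. *)
Lemma geometric (u v : F) : (u - v) ^+ p.-1 = \sum_(i < p) u ^+ (p.-1 - i) * v ^+ i.
Proof.
have [-> | uv] := eqVneq u v.
  rewrite subrr expr0n; have -> : (p.-1 == 0)%N = false by lia.
  rewrite (eq_bigr (fun=> v ^+ p.-1)) => [|i _]; last by rewrite -exprD subnK //; have := ltn_ord i; lia.
  by rewrite sumr_const card_ord (mulrn_pchar pF).
have uv0 : u - v != 0 by rewrite subr_eq0.
apply: (mulfI uv0); rewrite -subrXX -exprS prednK; last by lia.
by rewrite -cardF !expf_card.
Qed.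

Lemma double_half_pchar : half.*2 = p.-1.
Proof.
have : odd p by case: (even_prime (pcharf_prime pF)) => // e; move: p_gt3; rewrite e.
by rewrite /half; lia.
Qed.

(** Each term is 0 at a square root of e and 1 elsewhere, so the sum is minus the number of square
    roots. In the expansion only i = 0 and i = (p-1)/2 have a nonzero power sum. *)
Lemma sum_quadratic e : \sum_(y : F) (y ^+ 2 - e) ^+ p.-1 = - (1 + e ^+ half).
Proof.
have hd := double_half_pchar.
transitivity (\sum_(i < p) e ^+ i * \sum_(y : F) y ^+ (p.-1 - i).*2).
  under eq_bigr => y _ do rewrite geometric.
  rewrite exchange_big /=; apply: eq_bigr => i _; rewrite mulr_sumr; apply: eq_bigr => y _.
  by rewrite mulrC -exprM mul2n.
have p0 : (0 < p)%N by lia.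
have hp : (half < p)%N by lia.
rewrite (bigD1 (Ordinal p0)) //= expr0 mul1r subn0 power_sum_double.
rewrite (bigD1 (Ordinal hp)) /=; last by rewrite -val_eqE /=; lia.
rewrite power_sum; last by lia.
rewrite big1 ?addr0 => [|i /andP[i0 ih]].
  by rewrite (_ : (p.-1 - half).*2 == p.-1) ?mulrN1 ?opprD //; lia.
rewrite -!val_eqE /= in i0 ih.
rewrite power_sum; last by lia.
by rewrite (_ : _ == _ = false) ?oppr0 ?mulr0 //; have := ltn_ord i; lia.
Qed.

Lemma fact_neq0_lt n : (n < p)%N -> (n`!)%:R != 0 :> F.
Proof.
elim: n => [|n IH] np; first exact: oner_neq0.
by rewrite factS natrM mulf_neq0 ?IH ?(natf_neq0_lt pF) //; lia.
Qed.

Lemma wilson_fact k : (k < p)%N ->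
  ((p.-1 - k)`! * k`!)%:R = (-1) ^+ k * (p.-1`!)%:R :> F.
Proof.
elim: k => [|k IH] kp; first by rewrite subn0 muln1 expr0 mul1r.
have e : (p.-1 - k)`! = ((p.-1 - k) * (p.-1 - k.+1)`!)%N.
  by rewrite (_ : p.-1 - k = (p.-1 - k.+1).+1)%N ?factS //; lia.
have k0 : (p.-1 - k)%:R = - k.+1%:R :> F.
  apply/eqP; rewrite -addr_eq0 -natrD (_ : _ + _ = p)%N ?(pcharf0 pF) //; lia.
have kn0 : k.+1%:R != 0 :> F by apply: (natf_neq0_lt pF).
have h := IH (ltnW kp); rewrite e !natrM k0 in h.
rewrite factS !natrM exprS; transitivity (- (- k.+1%:R * ((p.-1 - k.+1)`!)%:R * (k`!)%:R) : F); first by ring.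
by rewrite h; ring.
Qed.

(** Wilson's theorem, in the form [wilson_fact], is applied at i and 3 i; these have the same
    parity, so the signs cancel. *)
Lemma hyp_binom i : (3 * i <= p.-1)%N ->
  ('C(p.-1 - i, p.-1 - 2 * i) * 'C(p.-1 - 2 * i, i))%:R = (hyp i)%:R :> F.
Proof.
move=> ip; have i1 : (i < p)%N by lia.
have i3 : (i * 3 < p)%N by lia.
have b1 : (p.-1 - 2 * i <= p.-1 - i)%N by lia.
have b2 : (i <= p.-1 - 2 * i)%N by lia.
have := bin_fact b1; rewrite (_ : p.-1 - i - (p.-1 - 2 * i) = i)%N; last by lia.
rewrite -(bin_fact b2) (_ : p.-1 - 2 * i - i = p.-1 - i * 3)%N; last by lia.
move=> b3; set x1 := 'C(p.-1 - i, _) in b3 *; set x2 := 'C(_, i) in b3 *.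
have e1 : x1%:R * (x2%:R * ((i`!)%:R * ((p.-1 - i * 3)`!)%:R) * (i`!)%:R) = ((p.-1 - i)`!)%:R :> F.
  by rewrite -!natrM b3.
have e2 : (hyp i)%:R * (i`!)%:R ^+ 3 = ((i * 3)`!)%:R :> F by rewrite -natrX -natrM hyp_fact.
have e3 : ((p.-1 - i * 3)`!)%:R * ((i * 3)`!)%:R = ((p.-1 - i)`!)%:R * (i`!)%:R :> F.
  rewrite -!natrM (wilson_fact i1) (wilson_fact i3).
  by rewrite -signr_odd oddM andbT signr_odd.
have f1 := fact_neq0_lt i1; have f3 : ((p.-1 - i * 3)`!)%:R != 0 :> F by apply: fact_neq0_lt; lia.
rewrite natrM; apply: (mulIf (mulf_neq0 f3 (expf_neq0 3 f1))).
transitivity (((p.-1 - i)`!)%:R * (i`!)%:R : F); first by rewrite -e1; ring.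
by rewrite -e3 -e2; ring.
Qed.

Lemma sum_product j v : (j < p.-1)%N ->
  \sum_(y : F) (y * (y + v)) ^+ j =
  - (if (p.-1 <= 2 * j)%N then 'C(j, 2 * j - p.-1)%:R * v ^+ (2 * j - p.-1) else 0).
Proof.
move=> jp.
transitivity (\sum_(k < j.+1) 'C(j, k)%:R * v ^+ k * \sum_(y : F) y ^+ (2 * j - k)).
  under eq_bigr => y _ do rewrite exprMn exprDn mulr_sumr.
  rewrite exchange_big /=; apply: eq_bigr => k _; rewrite mulr_sumr; apply: eq_bigr => y _.
  have kj : (k <= j)%N by rewrite -ltnS.
  rewrite -mulr_natl; transitivity ('C(j, k)%:R * v ^+ k * (y ^+ j * y ^+ (j - k))); first by ring.
  by rewrite -exprD; congr (_ * _ ^+ _); lia.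
have [le | gt] := leqP p.-1 (2 * j); last first.
  rewrite big1 ?oppr0 // => k _; rewrite power_sum_lt ?mulr0 //; lia.
have kP : (2 * j - p.-1 < j.+1)%N by lia.
rewrite (bigD1 (Ordinal kP)) //= [X in _ + X]big1 ?addr0 => [|k]; last first.
  rewrite -val_eqE /= => kn; rewrite power_sum; last by lia.
  by rewrite (_ : _ == _ = false) ?oppr0 ?mulr0 //; have := ltn_ord k; lia.
by rewrite (_ : (2 * j - (2 * j - p.-1) = p.-1)%N) ?power_sum_pred ?mulrN1 //; lia.
Qed.

Lemma sum_linear (al be : F) i n : (0 < i < p.-1)%N -> (n = p.-1 - 2 * i)%N -> (2 * i <= p.-1)%N ->
  \sum_(w : F) w ^+ (3 * i) * (al * w + be) ^+ n = - ('C(n, i)%:R * al ^+ (n - i) * be ^+ i).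
Proof.
move=> ip en i2.
transitivity (\sum_(k < n.+1) 'C(n, k)%:R * al ^+ (n - k) * be ^+ k * \sum_(w : F) w ^+ (3 * i + (n - k))).
  under eq_bigr => w _ do rewrite exprDn mulr_sumr.
  rewrite exchange_big /=; apply: eq_bigr => k _; rewrite mulr_sumr; apply: eq_bigr => w _.
  by rewrite -mulr_natl exprMn exprD; ring.
have [le | gt] := leqP i n; last first.
  rewrite bin_small // !mul0r oppr0 big1 // => k _; rewrite power_sum; last by lia.
  by rewrite (_ : _ == _ = false) ?oppr0 ?mulr0 //; have := ltn_ord k; lia.
have kP : (i < n.+1)%N by lia.
rewrite (bigD1 (Ordinal kP)) //= [X in _ + X]big1 ?addr0 => [|k]; last first.
  rewrite -val_eqE /= => kn; rewrite power_sum; last by lia.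
  by rewrite (_ : _ == _ = false) ?oppr0 ?mulr0 //; have := ltn_ord k; lia.
by rewrite (_ : (3 * i + (n - i) = p.-1)%N) ?power_sum_pred ?mulrN1 //; lia.
Qed.

Lemma six_neq0_lt : 6 != 0 :> F.
Proof. by have -> : 6 = 2 * 3 :> F; [ring | rewrite mulf_neq0 // (natf_neq0_lt pF) //; lia]. Qed.

(* Modulo p, minus the number of affine points of y (y + 6 w + 2 c) = w^3. *)
Lemma sum_hesse (c : F) :
  \sum_(w : F) \sum_(y : F) (y * (y + (6 * w + 2 * c)) - w ^+ 3) ^+ p.-1 =
  (hpoly F p).[c / 108].
Proof.
have p0 : (0 < p)%N by lia.
pose T i := \sum_(w : F) \sum_(y : F) (y * (y + (6 * w + 2 * c))) ^+ (p.-1 - i) * w ^+ (3 * i).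
transitivity (\sum_(i < p) T i).
  rewrite [RHS]exchange_big /=; apply: eq_bigr => w _; rewrite [RHS]exchange_big /=; apply: eq_bigr => y _.
  by rewrite geometric; apply: eq_bigr => i _; rewrite -exprM.
have six0 := six_neq0_lt; have m3 := m_le pF.
(* For i = 0 the exponent of y reaches 2 (p - 1), beyond the range of [sum_product]. *)
have T0 : T 0%N = 1.
  rewrite /T exchange_big (bigD1 0) //= big1 ?add0r => [|w _]; last first.
    by rewrite mul0r subn0 expr0n (_ : (p.-1 == 0)%N = false) ?mul0r //; lia.
  rewrite (eq_bigr (fun=> -1)) => [|y y0].
    rewrite sumrN; have := sum_one; rewrite (bigD1 0) //= => /eqP.
    by rewrite addrC addr_eq0 => /eqP ->; rewrite opprK.
  rewrite -power_sum_pred [RHS](reindex_inj (_ : injective (fun w => y + (6 * w + 2 * c)))).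
    by apply: eq_bigr => w _; rewrite subn0 muln0 expr0 mulr1 exprMn (fermat y0) mul1r.
  by move=> w1 w2 /addrI /addIr /(mulfI six0).
(* Each summation extracts the exponent p - 1: over y it leaves a binomial coefficient times a power
   of 6 w + 2 c, over w a second binomial coefficient, which is 0 beyond p %/ 3. *)
have TS i : (0 < i < p)%N -> T i = if (i <= p %/ 3)%N then (hyp i)%:R * (c / 108) ^+ i else 0.
  move=> ip; have [iE | iN] := eqVneq i p.-1.
    rewrite (_ : (i <= _)%N = false); last by lia.
    rewrite /T big1 // => w _; rewrite iE subnn.
    under eq_bigr => y _ do rewrite expr0 mul1r.
    by rewrite sumr_const cardF (mulrn_pchar pF).
  have eT : T i = \sum_(w : F) w ^+ (3 * i) * (- (if (p.-1 <= 2 * (p.-1 - i))%N then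
      'C(p.-1 - i, 2 * (p.-1 - i) - p.-1)%:R * (6 * w + 2 * c) ^+ (2 * (p.-1 - i) - p.-1) else 0)).
    apply: eq_bigr => w _; rewrite -sum_product; last by lia.
    by rewrite [RHS]mulrC mulr_suml.
  rewrite {}eT; have [le | gt] := leqP p.-1 (2 * (p.-1 - i)); last first.
    rewrite (_ : (i <= _)%N = false); last by lia.
    by rewrite big1 // => w _; rewrite oppr0 mulr0.
  have en : (2 * (p.-1 - i) - p.-1 = p.-1 - 2 * i)%N by lia.
  rewrite en; transitivity (- 'C(p.-1 - i, p.-1 - 2 * i)%:R * \sum_(w : F) w ^+ (3 * i) * (6 * w + 2 * c) ^+ (p.-1 - 2 * i)).
    by rewrite mulr_sumr; apply: eq_bigr => w _; ring.
  rewrite (@sum_linear _ _ i (p.-1 - 2 * i)%N) //; [|lia|lia].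
  have [le3 | gt3] := leqP i (p %/ 3); last first.
    by rewrite [X in - (X%:R * _ * _)]bin_small ?mul0r ?oppr0 ?mulr0 //; lia.
  rewrite -hyp_binom; last by lia.
  rewrite natrM (_ : p.-1 - 2 * i - i = p.-1 - 3 * i)%N; last by lia.
  have e6 : 6 ^+ (p.-1 - 3 * i) * 6 ^+ (3 * i) = 1 :> F by rewrite -exprD subnK ?fermat //; lia.
  have n108 : 108 != 0 :> F.
    by have -> : 108 = 6 * 6 * 3 :> F; [ring | rewrite !mulf_neq0 // (natf_neq0_lt pF)].
  have e216 : (2 * c) ^+ i = 6 ^+ (3 * i) * (c / 108) ^+ i.
    by rewrite exprM -exprMn; congr (_ ^+ i); field.
  transitivity ('C(p.-1 - i, p.-1 - 2 * i)%:R * 'C(p.-1 - 2 * i, i)%:R * (6 ^+ (p.-1 - 3 * i) * (2 * c) ^+ i)); first by ring.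
  by rewrite e216 [X in _ * X = _]mulrA e6 mul1r.
rewrite /hpoly horner_poly -(big_mkord xpredT T) (big_cat_nat _ (n := (p %/ 3).+1)) //=; last by lia.
rewrite [X in _ + X]big_nat_cond [X in _ + X]big1 ?addr0 => [|i]; last first.
  move=> /andP[/andP[h1 h2] _]; have ip : (0 < i < p)%N by rewrite h2 andbT (leq_trans _ h1).
  by rewrite (TS i ip) leqNgt h1.
rewrite big_mkord; apply: eq_bigr => i _; have ip := ltn_ord i.
have [i0 | i0] := posnP i; first by rewrite i0 T0 /hyp !bin0 expr0 mulr1.
have ip' : (0 < i < p)%N by rewrite i0 /=; lia.
by rewrite (TS i ip') -ltnS ip.
Qed.

Lemma horner_fpoly (r z : F) : (fpoly r).[z] = z ^+ 3 + 6 * r * z ^+ 2 + (9 - 6 * r) * z.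
Proof.
by rewrite /fpoly hornerM !hornerD hornerX hornerXn hornerZ hornerX hornerC; ring.
Qed.

(** With c = 2 - r, the substitution w = z + 2 r - 3 and completion of the square in y turn y (y + 6
    w + 2 c) = w^3 into E; [sum_quadratic] then counts the ordinates. *)
Lemma hpoly_trace (r : F) : r ^+ 2 = 2 ->
  (hpoly F p).[(2 - r) / 108] = - \sum_(z : F) (fpoly r).[z] ^+ half.
Proof.
move=> hr; rewrite -sum_hesse.
rewrite (reindex_inj (_ : injective (fun z => z + (2 * r - 3)))) => [|z1 z2 /addIr //].
transitivity (\sum_(z : F) \sum_(y : F) (y ^+ 2 - (fpoly r).[z]) ^+ p.-1).
  apply: eq_bigr => z _; set u := 3 * (z + (2 * r - 3)) + (2 - r).
  rewrite (reindex_inj (_ : injective (fun y => y - u))) => [|y1 y2 /addIr //].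
  apply: eq_bigr => y _; congr (_ ^+ _); rewrite horner_fpoly /u; ring: hr.
under eq_bigr => z _ do rewrite sum_quadratic.
by rewrite sumrN big_split /= sum_one add0r.
Qed.

Lemma indicator_quadratic (b z v : F) : z != 0 ->
  1 - (z ^+ 2 - v * z + b) ^+ p.-1 = (v == z + b / z)%:R.
Proof.
move=> z0; have e : z ^+ 2 - v * z + b = z * (z + b / z - v) by field.
rewrite e; have [-> | vz] := eqVneq v (z + b / z).
  by rewrite subrr mulr0 expr0n (_ : (p.-1 == 0)%N = false) ?subr0 //; lia.
by rewrite fermat ?subrr // mulf_neq0 // subr_eq0 eq_sym.
Qed.

(* The isogeny with kernel generated by (0, 0): f(z) = z^2 (v + a), v = z + b / z. *)
Lemma trace_conj (r : F) : r ^+ 2 = 2 ->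
  \sum_(z : F) (fpoly r).[z] ^+ half = \sum_(z : F) (fpoly (- r)).[z] ^+ half.
Proof.
move=> hr; have hd := double_half_pchar; have h0 : (0 < half)%N by lia.
have n2 : 2 != 0 :> F by apply: (natf_neq0_lt pF); lia.
have n4 : 4 != 0 :> F by have -> : 4 = 2 * 2 :> F; [ring | rewrite mulf_neq0].
have r0 : r != 0 by apply: contraNneq n2 => r0; rewrite -hr r0 expr0n.
have chi_sqr (c : F) : c != 0 -> (c ^+ 2) ^+ half = 1.
  by move=> c0; rewrite -exprM mul2n hd fermat.
have chi2 : 2 ^+ half = 1 :> F by rewrite -hr chi_sqr.
pose b := 9 - 6 * r; pose a := 6 * r.
have b0 : b != 0.
  apply: b_neq0 => //; apply: (natf_neq0_lt pF); lia.
pose ind (z v : F) : F := 1 - (z ^+ 2 - v * z + b) ^+ p.-1.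
have indE z v : z != 0 -> ind z v = (v == z + b / z)%:R := @indicator_quadratic b z v.
(* The indicator introduces v = z + b / z; z = 0 contributes 0 to both sides because b^(p-1) = 1. *)
transitivity (\sum_(z : F) \sum_(v : F) ind z v * (v + a) ^+ half).
  apply: eq_bigr => z _; have [-> | z0] := eqVneq z 0.
    rewrite horner_fpoly big1 => [|v _].
      by rewrite !expr0n /= !mulr0 !addr0 expr0n (gtn_eqF h0).
    by rewrite /ind expr0n mulr0 subr0 add0r fermat // subrr mul0r.
  rewrite (bigD1 (z + b / z)) //= big1 => [|v vz]; last first.
    by rewrite indE // (negPf vz) mul0r.
  rewrite indE // eqxx mul1r addr0 -[RHS]mul1r -(chi_sqr z z0) -exprMn; congr (_ ^+ _).
  by rewrite horner_fpoly /a /b; field.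
rewrite exchange_big /=.
(* The preimages of v are the roots of z^2 - v z + b, counted by the character of the
   discriminant. *)
transitivity (\sum_(v : F) (1 + (v ^+ 2 - 4 * b) ^+ half) * (v + a) ^+ half).
  apply: eq_bigr => v _; rewrite -mulr_suml; congr (_ * _).
  rewrite /ind sumrB sum_one sub0r.
  rewrite (reindex_inj (_ : injective (fun z => z + v / 2))) => [|z1 z2 /addIr //].
  transitivity (- \sum_(z : F) (z ^+ 2 - (v ^+ 2 - 4 * b) / 2 ^+ 2) ^+ p.-1).
    by congr (- _); apply: eq_bigr => z _; congr (_ ^+ _); field; rewrite n2 n4.
  rewrite sum_quadratic opprK; congr (1 + _).
  by rewrite expr_div_n chi_sqr // divr1.
rewrite (eq_bigr (fun v => (v + a) ^+ half + (v ^+ 2 - 4 * b) ^+ half * (v + a) ^+ half)) => [|v _]; last by rewrite mulrDl mul1r.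
rewrite big_split /= (_ : \sum_(v : F) (v + a) ^+ half = 0) ?add0r; last first.
  transitivity (\sum_(c : F) c ^+ half); last by apply: power_sum_lt; lia.
  by rewrite [RHS](reindex_inj (addIr a)).
(* Replacing v by 2 v - a turns (v^2 - 4 b)(v + a) into 8 times the cubic for -r, and 8 is a square
   because 2 is. *)
rewrite (reindex_inj (_ : injective (fun v => 2 * v - a))) => [|v1 v2 /addIr /(mulfI n2) //].
apply: eq_bigr => v _; rewrite -exprMn.
transitivity ((2 ^+ 3 * (fpoly (- r)).[v]) ^+ half).
  by congr (_ ^+ _); rewrite horner_fpoly /a /b; ring: hr.
by rewrite exprMn -exprM mulnC exprM chi2 expr1n mul1r.
Qed.

(** The reflection b -> 1/27 - b exchanges (2 - r)/108 and (2 + r)/108. The value changes sign by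
    [hpoly_anti] but, being minus a trace, is preserved by [trace_conj]. *)
Lemma hpoly_supersingular (r : F) : r ^+ 2 = 2 -> odd (p %/ 3) ->
  (hpoly F p).[(2 - r) / 108] = 0.
Proof.
move=> hr oddm; have n2 : 2 != 0 :> F by apply: (natf_neq0_lt pF); lia.
have n3 : 3 != 0 :> F by apply: (natf_neq0_lt pF).
have n27 : 27 != 0 :> F by have -> : 27 = 3 * 3 * 3 :> F; [ring | rewrite !mulf_neq0].
have n108 : 108 != 0 :> F by have -> : 108 = 2 * 2 * 27 :> F; [ring | rewrite !mulf_neq0].
have hr' : (- r) ^+ 2 = 2 by rewrite sqrrN.
have anti := hpoly_anti pF p_gt3 ((2 - r) / 108) oddm.
have e : 27^-1 - (2 - r) / 108 = (2 - - r) / 108 by field; rewrite n27 n108.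
rewrite e (hpoly_trace hr') -(trace_conj hr) -(hpoly_trace hr) in anti.
apply: (mulfI n2); rewrite mulr0 mulr_natl mulr2n {2}anti; exact: subrr.
Qed.

Lemma hpoly_ordinary (r : F) (b := (2 - r) / 108) : r ^+ 2 = 2 ->
  \sum_(k < (p %/ 3).+1) (acoef k)%:R / 216 ^+ k = (hpoly F p).[b] ^+ 2.
Proof.
move=> hr; have n2 : 2 != 0 :> F by apply: (natf_neq0_lt pF); lia.
have n3 : 3 != 0 :> F by apply: (natf_neq0_lt pF).
have n108 : 108 != 0 :> F by have -> : 108 = 2 * 2 * 3 * 3 * 3 :> F; [ring | rewrite !mulf_neq0].
have n216 : 216 != 0 :> F by have -> : 216 = 2 * 108 :> F; [ring | rewrite !mulf_neq0].
rewrite (clausen_horner pF p_gt3); apply: eq_bigr => k _; rewrite -exprVn; congr (_ * _ ^+ _).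
apply: (mulfI n108); apply: (mulfI n108); apply: (mulfI n216).
transitivity (108 * 108 : F); first by field.
transitivity (216 * (2 - r) * (108 - 27 * (2 - r))); last by rewrite /b; field.
by ring: hr.
Qed.

Lemma domb_sum_eval (r : F) : r ^+ 2 = 2 ->
  \sum_(n < p) (A n)%:R / (- 8) ^+ n = (\sum_(z : F) (fpoly r).[z] ^+ half) ^+ 2.
Proof.
move=> hr; have n2 : 2 != 0 :> F by apply: (natf_neq0_lt pF); lia.
have n3 : 3 != 0 :> F by apply: (natf_neq0_lt pF).
have n8 : 8 != 0 :> F by have -> : 8 = 2 * 2 * 2 :> F; [ring | rewrite !mulf_neq0].
have n216 : 216 != 0 :> F by have -> : 216 = 8 * 3 * 3 * 3 :> F; [ring | rewrite !mulf_neq0].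
rewrite -sqrrN -(hpoly_trace hr) -(hpoly_ordinary hr).
have nN8 : - 8 != 0 :> F by rewrite oppr_eq0.
have e1 : 1 - 4 * (- 8)^-1 = 3 / 2 :> F by field; rewrite n2 nN8.
have nz : 1 - 4 * (- 8)^-1 != 0 :> F by rewrite e1 mulf_neq0 // invr_eq0.
have := domb_sum_hyp pF p_gt3 nz fermat.
under eq_bigr => n _ do rewrite exprVn.
move=> ->; apply: eq_bigr => k _; rewrite -exprVn; congr (_ * _ ^+ _).
have n27 : 27 != 0 :> F by have -> : 27 = 3 * 3 * 3 :> F; [ring | rewrite !mulf_neq0].
by rewrite e1; field; rewrite n2 n27 nN8 n216.
Qed.

End PowerSums.

(** * Square roots and representation by x^2 + 6 y^2 *)

Section Squares.
Variables (F : finFieldType) (p : nat).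
Hypotheses (cardF : #|F| = p) (pF : p \in [pchar F]) (p_gt3 : (3 < p)%N).

Let half := p.-1./2.

Lemma intr_eq0_dvdz (m : int) : (m%:~R == 0 :> F) = (p %| m)%Z.
Proof. by case: m => n; rewrite ?NegzE ?rmorphN ?oppr_eq0 /= dvdzE /= (dvdn_pcharf pF). Qed.

(** If e had no square root, all terms of the sum in [sum_quadratic] would be 1 and the sum 0,
    forcing the character of e to be -1. *)
Lemma euler_square (e : F) : e ^+ half != -1 -> exists y : F, y ^+ 2 = e.
Proof.
move=> he; have [/existsP[y /eqP hy] | none] := boolP [exists y : F, y ^+ 2 == e].
  by exists y.
have := sum_quadratic cardF pF p_gt3 e.
rewrite (eq_bigr (fun=> 1)) => [|y _]; last first.
  apply: fermat => //; rewrite subr_eq0; apply: contraNneq none => hy.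
  by apply/existsP; exists y; apply/eqP.
rewrite (sum_one cardF pF) => /eqP; rewrite eq_sym oppr_eq0 addrC addr_eq0.
by rewrite (negPf he).
Qed.

(** Pigeonhole for u1 - t u2 with u1, u2 at most m, the integer part of the square root of p: there
    are more than p pairs. The bounds are strict since a prime is not a square. *)
Lemma thue (t : F) : exists x y : int,
  [/\ x%:~R = t * y%:~R, (x != 0) || (y != 0), x ^+ 2 < p%:Z & y ^+ 2 < p%:Z].
Proof.
have p_pr := pcharf_prime pF.
have [m [m1 m2]] : exists m : nat, (m * m < p)%N /\ (p < m.+1 * m.+1)%N.
  have ex0 : exists m, (m * m <= p)%N by exists 0%N.
  have bnd m : (m * m <= p)%N -> (m <= p)%N by nia.
  case: (ex_maxnP ex0 bnd) => m mp mmax; exists m; split.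
    rewrite ltn_neqAle mp andbT; apply: contraTneq p_pr => <-.
    have [->|m0] := posnP m; first by [].
    have [m1|m1] := leqP m 1; first by rewrite (_ : m = 1%N) //; lia.
    by apply/primePn; right; exists m; rewrite ?dvdn_mulr //; nia.
  by rewrite ltnNge; apply/negP => /mmax; lia.
pose phi (u : 'I_m.+1 * 'I_m.+1) : F := u.1%:R - t * u.2%:R.
have /injectivePn[[u1 u2] [[v1 v2] uv e]] : ~~ injectiveb phi.
  apply/negP => /injectiveP /leq_card; rewrite card_prod !card_ord cardF; lia.
have e0 : phi (u1, u2) - phi (v1, v2) = 0 by rewrite e subrr.
exists ((u1 : nat)%:Z - (v1 : nat)%:Z), ((u2 : nat)%:Z - (v2 : nat)%:Z); split.
- rewrite !rmorphB /= -!pmulrn; apply/eqP; rewrite -subr_eq0 -e0 /phi /=; apply/eqP; ring.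
- rewrite !subr_eq0 -negb_and; apply: contraNN uv => /andP[/eqP[e1] /eqP[e2]].
  by rewrite (val_inj e1) (val_inj e2).
- by move: (ltn_ord u1) (ltn_ord v1); set a := nat_of_ord _; set b := nat_of_ord _ => ha hb; nia.
- by move: (ltn_ord u2) (ltn_ord v2); set a := nat_of_ord _; set b := nat_of_ord _ => ha hb; nia.
Qed.

Lemma thue_form (n : nat) (t : F) : (0 < n)%N -> t ^+ 2 = - n%:R ->
  exists x y k : nat, (0 < k <= n)%N /\ (x * x + n * (y * y) = k * p)%N.
Proof.
move=> n0 ht; have [x [y [e xy hx hy]]] := thue t.
have dv : (p %| `|x| * `|x| + n * (`|y| * `|y|))%N.
  have -> : (p %| `|x| * `|x| + n * (`|y| * `|y|))%N = (p %| x * x + n%:Z * (y * y))%Z.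
    by rewrite dvdzE; congr (_ %| _)%N; lia.
  rewrite -intr_eq0_dvdz rmorphD !rmorphM /= e -pmulrn; apply/eqP.
  transitivity ((t ^+ 2 + n%:R) * y%:~R ^+ 2); first by ring.
  by rewrite ht addNr mul0r.
case/dvdnP: dv => k hk; exists `|x|%N, `|y|%N, k; split=> //.
have hX : (`|x| * `|x| < p)%N by lia.
have hY : (`|y| * `|y| < p)%N by lia.
apply/andP; split.
  have : (0 < `|x| * `|x| + n * (`|y| * `|y|))%N.
    by rewrite addn_gt0 !muln_gt0 n0 /= !andbb !absz_gt0.
  by rewrite hk muln_gt0 => /andP[].
rewrite -ltnS -(ltn_pmul2r (_ : 0 < p)%N); last by lia.
by rewrite -hk mulSn -addSn leq_add // leq_mul2l (ltnW hY) orbT.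
Qed.

Lemma square_two : (p %% 8)%N \in [:: 1; 7]%N -> exists r : F, r ^+ 2 = 2.
Proof.
rewrite !inE => /orP[] /eqP p8; have hd := double_half_pchar cardF pF p_gt3.
  have [|u [u0 u1]] := @non_root_of_unity F p cardF pF p_gt3 half; first by lia.
  have {}u1 : (u ^+ (p %/ 8)) ^+ 4 = -1.
    rewrite -exprM (_ : p %/ 8 * 4 = half)%N; last by lia.
    have /eqP : (u ^+ half) ^+ 2 = 1 by rewrite -exprM muln2 hd; exact: fermat.
    by rewrite sqrf_eq1 (negPf u1) => /eqP.
  (* As z^4 = -1, z is a primitive eighth root of unity and the witness is z + 1/z. *)
  set z := u ^+ _ in u1; exists (z - z ^+ 3).
  transitivity (z ^+ 2 - 2 * z ^+ 4 + z ^+ 2 * z ^+ 4); first by ring.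
  by rewrite u1; ring.
(* Here -1 is a nonsquare, so if 2 were one too, -2 would be a square and x^2 + 2 y^2 would
   represent p or 2 p, which are 7, 15 or 14 modulo 16. *)
apply: euler_square; apply: contraTneq isT => chi2.
have [|t ht] := @euler_square (- 2).
  rewrite -mulN1r exprMn chi2 -signr_odd (_ : odd half) ?expr1 ?mulrNN ?mulr1; last by lia.
  rewrite -addr_eq0; apply: (@natf_neq0_lt F p pF 2); lia.
have [x [y [k [k2 e]]]] := thue_form (isT : 0 < 2)%N ht.
have res : ((x * x + 2 * (y * y)) %% 16 \notin [:: 7; 14; 15])%N.
  have := divn_eq x 16; have := divn_eq y 16; have := ltn_pmod x (isT : 0 < 16)%N.
  have := ltn_pmod y (isT : 0 < 16)%N; move: (x %/ 16)%N (x %% 16)%N (y %/ 16)%N (y %% 16)%N => q a q' b.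
  move=> b16 a16 -> ->; set n := (_ + _)%N.
  have -> : n = ((q * (q * 16 + 2 * a) + 2 * (q' * (q' * 16 + 2 * b))) * 16 + (a * a + 2 * (b * b)))%N.
    by rewrite /n; ring.
  rewrite modnMDl.
  have : all (fun a => all (fun b => (a * a + 2 * (b * b)) %% 16 \notin [:: 7; 14; 15])%N (iota 0 16)) (iota 0 16) by [].
  move/allP/(_ a); rewrite mem_iota a16 // => /(_ isT) /allP/(_ b).
  by rewrite mem_iota b16 => /(_ isT).
move: res; rewrite e !inE; have [-> | ->] : k = 1%N \/ k = 2%N by lia.
  lia.
lia.
Qed.

(** The square root is 2 w + 1 with w a primitive cube root of unity. *)
Lemma square_N3 : (p %% 3 = 1)%N -> exists s : F, s ^+ 2 = - 3.
Proof.
move=> p3; have [|u [u0 u1]] := @non_root_of_unity F p cardF pF p_gt3 (p %/ 3); first by lia.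
have w3 : (u ^+ (p %/ 3)) ^+ 3 = 1.
  by rewrite -exprM (_ : p %/ 3 * 3 = p.-1)%N ?(fermat cardF pF p_gt3) //; lia.
set w := u ^+ _ in u1 w3; exists (2 * w + 1).
have /eqP : (w - 1) * (w ^+ 2 + w + 1) = 0 by transitivity (w ^+ 3 - 1); [ring | rewrite w3 subrr].
rewrite mulf_eq0 subr_eq0 (negPf u1) /= => /eqP h.
by transitivity (4 * (w ^+ 2 + w + 1) - 3); [ring | rewrite h mulr0 sub0r].
Qed.

(** As -6 = 2 (-3) is a square, x^2 + 6 y^2 = k p for some k from 1 to 6. Squares modulo 3 exclude k
    = 2, 3, 5; for k = 4 and 6, dividing out common factors gives a representation of p. *)
Lemma represented_by_form : (p %% 24)%N \in [:: 1; 7]%N ->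
  exists x y : nat, (p = x * x + 6 * (y * y))%N.
Proof.
rewrite !inE => p24.
have p3 : (p %% 3 = 1)%N by lia.
have [r hr] : exists r : F, r ^+ 2 = 2 by apply: square_two; rewrite !inE; lia.
have [s hs] := square_N3 p3.
have hrs : (r * s) ^+ 2 = - 6%:R by rewrite exprMn hr hs; ring.
have [x [y [k [k6 e]]]] := thue_form (isT : 0 < 6)%N hrs.
have sq3 z : (z * z %% 3 <= 1)%N /\ ((z * z %% 3 = 0)%N -> exists q, z = (3 * q)%N).
  have := divn_eq z 3; have := ltn_pmod z (isT : 0 < 3)%N.
  move: (z %/ 3)%N (z %% 3)%N => q a a3 ->.
  have -> : ((q * 3 + a) * (q * 3 + a) = q * (3 * q + 2 * a) * 3 + a * a)%N by ring.
  rewrite modnMDl; case: a a3 => [|[|[|//]]] _; split=> // _.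
  by exists q; rewrite addn0 mulnC.
have sq2 z : ~~ odd (z * z) -> exists q, z = (2 * q)%N.
  by rewrite oddM andbb => ez; exists z./2; lia.
have [x1 x0] := sq3 x; have [y1 _] := sq3 y.
have : k \in iota 1 6 by rewrite mem_iota; lia.
rewrite !inE => /or4P[/eqP ek | /eqP ek | /eqP ek | /or3P[] /eqP ek]; subst k.
- by exists x, y; rewrite e mul1n.
- lia.
- have [|q eq] := x0; first by lia.
  have e' : (3 * (q * q) + 2 * (y * y) = p)%N by move: e; rewrite eq; lia.
  lia.
- have [|q eq] := sq2 x; first by lia.
  have e' : (2 * (q * q) + 3 * (y * y) = 2 * p)%N by move: e; rewrite eq; lia.
  have [|w ew] := sq2 y; first by lia.
  by exists q, w; move: e'; rewrite ew; lia.
- lia.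
have [|q eq] := x0; first by lia.
have [|w ew] := sq2 q; first by move: e; rewrite eq; lia.
by exists y, w; move: e; rewrite eq ew; lia.
Qed.

End Squares.

(** * Congruences between rationals *)

Lemma tofrac_surj (R : idomainType) (x : {fraction R}) :
  exists u v : R, v != 0 /\ x = tofrac u / tofrac v.
Proof.
elim/quotW: x => x; exists \n_x, \d_x; split; first exact: denom_ratioP.
have d0 : tofrac \d_x != 0 by rewrite tofrac_eq0 denom_ratioP.
apply: (mulIf d0); rewrite divfK //; unlock FracField.tofrac.
rewrite -[LHS]FracField.pi_mul; apply/eqmodP.
by rewrite /= FracField.equivfE /FracField.mulf !numden_Ratio ?(oner_neq0, mulf_neq0, denom_ratioP) //= ?mulr1 mulrC.
Qed.

Lemma congQ_frac p (M d z : int) : prime p -> coprime p `|d| -> (p %| M - d * z)%Z ->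
  congQ p (M%:~R / d%:~R) z%:~R.
Proof.
move=> p_pr cpd pdv.
have d0 : d%:~R != 0 :> rat.
  by rewrite intr_eq0; apply: contraTneq cpd => ->; rewrite /coprime gcdn0; case: p p_pr {pdv} => [|[|]].
set q : rat := _ / _.
have qd : q * d%:~R = M%:~R by rewrite /q divfK.
have nd : numq q * d = M * denq q.
  apply: (intr_inj (R := rat)); rewrite !rmorphM /= -qd.
  by rewrite -{2}(divq_num_den q) mulrAC divfK // intr_eq0 denq_neq0.
have den : (`|denq q| %| `|d|)%N.
  have : (denq q %| numq q * d)%Z by rewrite nd dvdz_mull.
  by rewrite Gauss_dvdzr // coprimezE coprime_sym coprime_num_den.
have cpden : coprime p `|denq q| by apply: coprime_dvdr den cpd.
apply/and3P; split=> //; first by rewrite /denom_prime_to denq_int coprimen1.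
set t := q - z%:~R.
have td : numq t * d = (M - d * z) * denq t.
  apply: (intr_inj (R := rat)); rewrite !rmorphM /= rmorphB rmorphM /=.
  transitivity (t * (denq t)%:~R * d%:~R); first by rewrite -{2}(divq_num_den t) divfK // intr_eq0 denq_neq0.
  by rewrite /t mulrAC mulrBl qd; congr (_ * _); rewrite mulrC.
have : (p%:Z %| numq t * d)%Z by rewrite td dvdz_mulr.
by rewrite Gauss_dvdzl // coprimezE.
Qed.

(** The common denominator (-8)^(p-1) is 1 modulo p, so the rational sum reduces to the sum taken in
    ['F_p]. *)
Lemma congQ_A_sum p (z : int) : prime p -> (3 < p)%N ->
  \sum_(n < p) (A n)%:R / (- 8) ^+ n = z%:~R :> 'F_p -> congQ p (A_sum p) z%:~R.
Proof.
move=> p_pr p3 h.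
pose d : int := (- 8) ^+ p.-1.
pose M : int := \sum_(n < p) (A n)%:R * (- 8) ^+ (p.-1 - n).
have -> : A_sum p = M%:~R / d%:~R.
  rewrite /A_sum /M rmorph_sum mulr_suml big_mkord; apply: eq_bigr => n _.
  have n8 : - 8%:R != 0 :> rat by [].
  rewrite rmorphM /= rmorph_nat /d !rmorphXn /= rmorphN /= rmorph_nat -mulrA; congr (_ * _).
  have le : (n <= p.-1)%N by have := ltn_ord n; lia.
  by rewrite -{2}(subnK le) exprD invfM mulVKf // expf_neq0.
have cardF := card_Fp p_pr; have pF := pchar_Fp p_pr.
have n8 : - 8 != 0 :> 'F_p.
  have n2 : 2 != 0 :> 'F_p by apply: (natf_neq0_lt pF); lia.
  by rewrite oppr_eq0; have -> : 8 = 2 * 2 * 2 :> 'F_p; [ring | rewrite !mulf_neq0].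
apply: congQ_frac => //.
  rewrite /d abszX coprimeXr // (_ : absz _ = 2 ^ 3)%N // coprimeXr //.
  by rewrite prime_coprime // gtnNdvd // ltnW.
rewrite -(intr_eq0_dvdz pF) rmorphB rmorphM /= -h /d rmorphXn /= rmorphN /=.
rewrite (fermat cardF pF p3 n8) mul1r subr_eq0 /M rmorph_sum; apply/eqP/eq_bigr => n _.
have le : (n <= p.-1)%N by have := ltn_ord n; lia.
rewrite rmorphM rmorphXn rmorphN /= !rmorph_nat; congr (_ * _).
apply: (mulIf (expf_neq0 n n8)); rewrite mulVf ?expf_neq0 // -exprD subnK //.
exact: (fermat cardF pF p3 n8).
Qed.

Unset Implicit Arguments.
Set Strict Implicit.

Theorem theorem3p3 (p : nat) (p_prime : prime p)
  (p_mod24 : (p %% 24)%N \in [:: 1%N; 7%N; 17%N; 23%N]) :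
  ((p %% 24)%N \in [:: 1%N; 7%N] ->
     (exists x y : int, p%:Z = x ^+ 2 + 6%:Z * y ^+ 2) /\
     (forall x y : int, p%:Z = x ^+ 2 + 6%:Z * y ^+ 2 ->
        congQ p (A_sum p) (4%:Q * x%:Q ^+ 2))) /\
  ((p %% 24)%N \in [:: 17%N; 23%N] -> congQ p (A_sum p) 0).
Proof.
have p_gt3 : (3 < p)%N.
  by move: p_mod24 p_prime; case: p => [|[|[|[|]]]].
have cardF := card_Fp p_prime; have pF := pchar_Fp p_prime.
have [r hr] : exists r : 'F_p, r ^+ 2 = 2.
  apply: (square_two cardF pF p_gt3); move: p_mod24; rewrite !inE; clear; lia.
split=> [p24 | p24]; last first.
  apply: (congQ_A_sum (z := 0)) => //; rewrite (domb_sum_eval cardF pF p_gt3 hr).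
  (* For p = 24 q + 17 or 24 q + 23, p %/ 3 is 8 q + 5 or 8 q + 7. *)
  have oddm : odd (p %/ 3) by move: p24; rewrite !inE; lia.
  have := hpoly_supersingular cardF pF p_gt3 hr oddm.
  by rewrite hpoly_trace // => /eqP; rewrite oppr_eq0 => /eqP ->; rewrite expr0n.
split=> [|x y pxy].
  have [x [y e]] := represented_by_form cardF pF p_gt3 p24.
  by exists x%:Z, y%:Z; rewrite {1}e PoszD !PoszM !expr2.
have -> : 4%:Q * x%:Q ^+ 2 = (4 * x ^+ 2)%:~R by rewrite rmorphM rmorphXn.
apply: congQ_A_sum => //; rewrite (domb_sum_eval cardF pF p_gt3 hr).
have prime_neq0 q : prime q -> q != p -> q%:R != 0 :> 'F_p.
  by move=> q_pr qp; rewrite -(dvdn_pcharf pF) dvdn_prime2 // eq_sym.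
have tf_inj : injective (@tofrac {poly 'F_p}) by move=> u v /eqP; rewrite tofrac_eq => /eqP.
apply: (trace_sqr cardF pF tf_inj (@tofrac_surj _) hr (prime_neq0 2 _ _)
  (prime_neq0 3 _ _) (prime_neq0 17 _ _) (prime_neq0 23 _ _) pxy) => //.
(* None of 2, 3, 17, 23 is 1 or 7 modulo 24, so p differs from each of them. *)
all: by apply: contraTneq p24 => <-.
Qed.
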